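(* There is a randomized algorithm that, given oracle access to $F:\{0,1\}^n\to\{-1,1\}$ and input parameters $\delta,\theta>0$, outputs a list $L$ of subsets of $[n]$ such that with probability $1-\delta$: (1) every $U$ satisfying $|\hat F(U)|\ge\theta$ is in $L$, and (2) every $U\in L$ satisfies $|\hat F(U)|\ge\theta/2$. The number of queries made by the algorithm is \[ O\left(\frac{n}{\theta^{11}\log(1/\theta)}\log\left(\frac{n}{\delta\theta}\right)\right), \] the number of random bits used is $O(n + (\log n)\log(1/\delta))$, and the runtime is $\mathrm{poly}(n,1/\theta,\log(1/\delta))$.
   Context: $[n]=\{1,\dots,n\}$. For $U\subseteq[n]$, the Fourier coefficient is $\hat F(U) = \mathbb{E}_{y\in\{0,1\}^n}[F(y)\prod_{j\in U}(-1)^{y_j}]$, $y$ uniform. $O(\cdot)$ constants are absolute. *)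

(* Defs.v *)
From HB Require Import structures.
From mathcomp Require Import all_boot all_order all_algebra.
From mathcomp Require Import reals exp.

Set Implicit Arguments.
Unset Strict Implicit.
Unset Printing Implicit Defensive.

Import Order.TTheory GRing.Theory Num.Theory.

Local Open Scope ring_scope.

(* {0,1}^n; the coordinate set [n] is represented by 'I_n, so coordinates are
   numbered from 0. *)
Definition cube (n : nat) := {ffun 'I_n -> bool}.

Definition fourier (R : realType) (n : nat) (F : cube n -> int)
    (U : {set 'I_n}) : R :=
  (2 ^+ n)^-1 *
  \sum_(y : cube n) (F y)%:~R * \prod_(j in U) (-1) ^+ (y j : nat).

(* Randomized oracle algorithms are programs for a random access machine with
   the uniform cost measure.  The registers M[0], M[1], ... hold natural
   numbers, and the only arithmetic operations are addition and truncated
   subtraction: unit-cost multiplication would make the machine stronger than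
   Turing machines up to polynomial time.  An expression is evaluated in one
   step; this only affects the running time by a factor depending on the
   program text. *)
Inductive expr : Type :=
| Const of nat
| Fetch of expr
| Add of expr & expr
| Sub of expr & expr.

(* The real parameters theta and delta are read-only; a program accesses them
   by comparing them with nonnegative rationals a / b, in the form
   a <= b * theta, where a and b have been computed in registers. *)
Inductive test : Type :=
| Le of expr & expr
| LeTheta of expr & expr
| LeDelta of expr & expr.

Inductive command : Type :=
| Skip
| Store of expr & expr
| Flip of expr
| Query of expr & expr
| Seq of command & command
| If of test & command & command
| While of test & command.

Definition memory := nat -> nat.

Definition update (M : memory) (a v : nat) : memory :=
  fun i => if i == a then v else M i.

Fixpoint eval (M : memory) (e : expr) : nat :=
  match e with
  | Const k => k
  | Fetch a => M (eval M a)
  | Add a b => (eval M a + eval M b)%N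
  | Sub a b => (eval M a - eval M b)%N
  end.

Definition eval_test (R : realType) (delta theta : R) (M : memory)
    (t : test) : bool :=
  match t with
  | Le a b => (eval M a <= eval M b)%N
  | LeTheta a b => (eval M a)%:R <= (eval M b)%:R * theta
  | LeDelta a b => (eval M a)%:R <= (eval M b)%:R * delta
  end.

(* [todo] is the stack of commands still to be executed; [coins] and [queries]
   count the random bits and the oracle calls used so far. *)
Record config : Type := Config {
  todo : seq command;
  mem : memory;
  coins : nat;
  queries : nat
}.

(* The string y in {0,1}^n stored at M[a], ..., M[a + n - 1], where nonzero
   registers stand for 1. *)
Definition read_point (n : nat) (M : memory) (a : nat) : cube n :=
  [ffun j : 'I_n => M (a + j)%N != 0%N].

(* One machine step, with w the sequence of random bits.  [Flip a] stores the
   next random bit at address a; [Query a b] stores at address a the bit c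
   such that F y = (-1) ^ c, where y is the point stored from address b on. *)
Definition step (R : realType) (n : nat) (F : cube n -> int)
    (delta theta : R) (w : seq bool) (c : config) : config :=
  let: Config k M i q := c in
  match k with
  | [::] => c
  | Skip :: k => Config k M i q
  | Store a b :: k => Config k (update M (eval M a) (eval M b)) i q
  | Flip a :: k => Config k (update M (eval M a) (nth false w i)) i.+1 q
  | Query a b :: k =>
      let ans := F (read_point n M (eval M b)) == -1 in
      Config k (update M (eval M a) ans) i q.+1
  | Seq p1 p2 :: k => Config (p1 :: p2 :: k) M i q
  | If t p1 p2 :: k =>
      Config ((if eval_test delta theta M t then p1 else p2) :: k) M i q
  | While t p :: k =>
      Config (if eval_test delta theta M t then p :: While t p :: k else k)
        M i q
  end.

(* Initially M[0] = n and all other registers are 0. *)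
Definition init (A : command) (n : nat) : config :=
  Config [:: A] (update (fun=> 0%N) 0 n) 0 0.

(* The configuration after T steps; a halted machine does not move any more. *)
Definition run (R : realType) (A : command) (n : nat) (F : cube n -> int)
    (delta theta : R) (w : seq bool) (T : nat) : config :=
  iter T (step F delta theta w) (init A n).

Definition halted (c : config) : bool := nilp (todo c).

(* The output list: its length is M[0], and its k-th set is given by its
   indicator vector in the n registers starting at 1 + k * n. *)
Definition output (n : nat) (c : config) : seq {set 'I_n} :=
  [seq [set j : 'I_n | mem c (1 + k * n + j)%N != 0%N]
     | k <- iota 0 (mem c 0)].

Definition correct_list (R : realType) (n : nat) (F : cube n -> int)
    (theta : R) (L : seq {set 'I_n}) : bool :=
  [forall U : {set 'I_n}, (theta <= `|fourier R F U|) ==> (U \in L)] &&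
  all (fun U => theta / 2 <= `|fourier R F U|) L.

(* Probability of the event E over r independent uniform bits. *)
Definition coin_prob (R : realType) (r : nat) (E : seq bool -> bool) : R :=
  #|[set w : r.-tuple bool | E w]|%:R / 2 ^+ r.

(* Main.v *)
(* The search runs over prefixes.  For a subset P of the first j coordinates let
   W_j(P) be the sum of hat F(U)^2 over all U that meet these coordinates in P.
   The weights of a level sum to 1, so at most 4 / theta^2 prefixes have weight
   at least theta^2 / 4; every prefix of a set U with |hat F(U)| >= theta has
   weight at least theta^2; and W_n(U) = hat F(U)^2.  Extending level by level
   the prefixes of large estimated weight therefore gives the list.  W_(j+1)(P)
   is the mean of (-1)^<P,y> F(x) F(x + y') over x and y, where y' is y with all
   coordinates after the first j + 1 replaced by 0.

   These means are estimated on 2^k points of F_2^(2n), with 2^k of order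
   theta^-6, which a Hankel matrix v makes pairwise independent: v consists of
   only O(n + k) bits, and by Chebyshev's inequality and a union bound over the
   candidates of a level, v is bad for that level with probability at most
   1/1024.  To reduce the failure probability to delta / n per level, the
   algorithm takes a majority vote over O(log(n / delta)) matrices visited by a
   random walk on F_2^m whose steps come from a small-bias generator, so that a
   step costs O(log n) bits.  The generator reads the scalar products
   <x^i, y> in F_2[X] / (X^q - 1) for q = 3^(a+1): since 2 is a primitive root
   modulo q, a primitive q-th root of unity has degree 2 * 3^a over F_2, and few
   x are roots of a given nonzero polynomial of degree less than m.  No
   irreducible polynomial has to be computed.  If 2n is not much larger than k,
   the sample can be taken to be the whole cube and no coins are needed.

   The algorithm is written in a language with arrays and bounded loops, which
   is compiled to the machine. *)

Require Import Defs.
From mathcomp Require Import all_boot all_order all_algebra.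
From mathcomp Require Import reals exp.
From mathcomp Require Import fingroup cyclic finfield.
From mathcomp Require Import ring lra zify.

Set Implicit Arguments.
Unset Strict Implicit.
Unset Printing Implicit Defensive.

Import Order.TTheory GRing.Theory Num.Theory.
Local Open Scope ring_scope.

(** * Fourier analysis on the cube *)

(** The search is adaptive, but as long as no vote fails the prefixes it can examine are fixed by F
    ([candidates]). A union bound over them is therefore legitimate, and one table of samples serves
    all levels. The two values of F in an observation do not involve the candidate, so a sample
    point costs n + 1 queries however many candidates there are.

    The coin budget n + log n log(1/delta) contains no theta and leaves room for only one matrix of
    fresh coins. A matrix costs O(n) coins only if k = O(n); for larger k the exhaustive sample
    takes over. The walk costs (log n + log(1/delta)) log n further coins, and the term log^2 n is
    absorbed by n.

    T and r have to be chosen before F and the coins. This is why the loop language has loop counts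
    fixed by parameters and no coins or queries in branches, and why the computed dimensions are
    characterised by inequalities with a unique solution. *)

Definition cadd (n : nat) (y z : cube n) : cube n := [ffun j => y j (+) z j].

Definition unitv (n : nat) (i : 'I_n) : cube n := [ffun j => j == i].

Lemma caddK n (z : cube n) : involutive (fun y => cadd y z).
Proof. by move=> y; apply/ffunP=> j; rewrite !ffunE -addbA addbb addbF. Qed.

Section Fourier.
Variable R : realType.

Definition chi n (A : {set 'I_n}) (y : cube n) : R :=
  \prod_(j in A) (-1) ^+ (y j : nat).

Definition mean n (f : cube n -> R) : R := (2 ^+ n)^-1 * \sum_y f y.

Definition fcoef n (f : cube n -> R) (A : {set 'I_n}) : R :=
  mean (fun y => f y * chi A y).

Lemma pow2_neq0 n : (2 ^+ n : R) != 0.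
Proof. by rewrite expf_neq0 // pnatr_eq0. Qed.

Lemma pow2_gt0 n : 0 < (2 ^+ n : R).
Proof. by rewrite exprn_gt0 // ltr0n. Qed.

Lemma card_cube n : #|{: cube n}| = (2 ^ n)%N.
Proof. by rewrite card_ffun card_bool card_ord. Qed.

Lemma mean_le n (f g : cube n -> R) : (forall y, f y <= g y) -> mean f <= mean g.
Proof.
by move=> fg; rewrite /mean ler_pM2l ?invr_gt0 ?pow2_gt0 //; apply: ler_sum.
Qed.

Lemma mean_cst n c : mean (fun _ : cube n => c) = c.
Proof.
rewrite /mean sumr_const card_cube -[c *+ _]mulr_natl natrX mulrA mulVf ?mul1r //.
exact: pow2_neq0.
Qed.

Lemma meanD n (f g : cube n -> R) : mean (fun y => f y + g y) = mean f + mean g.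
Proof. by rewrite /mean big_split mulrDr. Qed.

Lemma meanZ n c (f : cube n -> R) : mean (fun y => c * f y) = c * mean f.
Proof. by rewrite /mean -mulr_sumr mulrCA. Qed.

Lemma mean_sum n (I : Type) (r : seq I) (P : pred I) (f : I -> cube n -> R) :
  mean (fun y => \sum_(i <- r | P i) f i y) = \sum_(i <- r | P i) mean (f i).
Proof. by rewrite /mean exchange_big /= mulr_sumr. Qed.

Lemma eq_mean n (f g : cube n -> R) : f =1 g -> mean f = mean g.
Proof. by move=> fg; rewrite /mean (eq_bigr _ (fun y _ => fg y)). Qed.

Lemma mean_ge0 n (f : cube n -> R) : (forall y, 0 <= f y) -> 0 <= mean f.
Proof. by move=> f0; rewrite -(mean_cst n 0); apply: mean_le. Qed.

Lemma mean_shift n (f : cube n -> R) z : mean (fun y => f (cadd y z)) = mean f.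
Proof.
rewrite /mean; congr (_ * _); rewrite [RHS](reindex_inj (inv_inj (caddK z))).
by apply: eq_bigr.
Qed.

(** Translation by a unit vector preserves the mean and negates [f]. Orthogonality of characters and
    pairwise independence of the sample points are both reduced to finding such a coordinate. *)
Lemma mean_flip n (f : cube n -> R) i :
  (forall y, f (cadd y (unitv i)) = - f y) -> mean f = 0.
Proof.
move=> fN; have: mean f = - mean f.
  by rewrite -{1}(mean_shift _ (unitv i)) -mulN1r -meanZ; apply: eq_mean=> y; rewrite fN mulN1r.
by lra.
Qed.

Lemma chiD n (A : {set 'I_n}) y z : chi A (cadd y z) = chi A y * chi A z.
Proof.
by rewrite /chi -big_split; apply: eq_bigr => j _; rewrite ffunE signr_addb.
Qed.

Lemma chi0 n (y : cube n) : chi set0 y = 1.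
Proof. by rewrite /chi big_set0. Qed.

Lemma chi_unit n (A : {set 'I_n}) i : chi A (unitv i) = (-1) ^+ (i \in A).
Proof.
rewrite /chi; case: (boolP (i \in A)) => iA.
  rewrite (bigD1 i) //= ffunE eqxx big1 ?mulr1 // => j /andP[_ ji].
  by rewrite ffunE (negbTE ji).
rewrite big1 // => j jA; rewrite ffunE; case: eqP => // ji; by rewrite -ji jA in iA.
Qed.

Lemma chi_sqr n (A : {set 'I_n}) y : chi A y * chi A y = 1.
Proof.
rewrite -chiD /chi big1 // => j _; by rewrite ffunE addbb.
Qed.

Lemma chi_parity n (A : {set 'I_n}) y :
  chi A y = (-1) ^+ (\big[addb/false]_(j in A) y j).
Proof.
rewrite /chi; apply: (big_rec2 (fun a (b : bool) => a = (-1) ^+ b)) => //.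
by move=> j a b _ ->; rewrite signr_addb.
Qed.

Lemma mean_chi n (A : {set 'I_n}) : mean (chi A) = (A == set0)%:R.
Proof.
case: (set_0Vmem A) => [->|[i iA]].
  by rewrite eqxx (eq_mean (@chi0 n)) mean_cst.
have /negPf -> : A != set0 by apply/set0Pn; exists i.
by apply: (mean_flip (i := i)) => y; rewrite chiD chi_unit iA expr1 mulrN1.
Qed.

Lemma sum_chi n (y : cube n) :
  \sum_(A : {set 'I_n}) chi A y = (y == [ffun=> false])%:R * 2 ^+ n.
Proof.
have -> : \sum_(A : {set 'I_n}) chi A y = \prod_(j < n) ((-1) ^+ (y j : nat) + 1).
  rewrite bigA_distr; apply: eq_bigr => A _.
  by rewrite /chi [RHS](bigID (mem A)) /= [X in _ * X]big1 ?mulr1 => [|j /negPf->//];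
    apply: eq_bigr => j ->.
case: eqP => [->|yN0].
  rewrite mul1r -[n in RHS]card_ord -prodr_const.
  by apply: eq_bigr => j _; rewrite ffunE expr0; lra.
case: (pickP y) => [j yj|H]; last first.
  by case: yN0; apply/ffunP => j; rewrite ffunE; exact: H.
by rewrite (bigD1 j) //= yj expr1 addNr !mul0r.
Qed.

Lemma fourier_inversion n (f : cube n -> R) y : f y = \sum_A fcoef f A * chi A y.
Proof.
rewrite /fcoef /mean.
under eq_bigr => A _ do rewrite -mulrA mulr_suml.
rewrite -mulr_sumr exchange_big /=.
under eq_bigr => z _ do
  [under eq_bigr => A _ do rewrite -mulrA -chiD; rewrite -mulr_sumr sum_chi].
rewrite (bigD1 y) //= [X in _ + X]big1 => [|z zy].
  have -> : cadd y y = [ffun=> false] by apply/ffunP => j; rewrite !ffunE addbb.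
  by rewrite eqxx mul1r addr0 mulrC mulfK ?pow2_neq0.
case: eqP; rewrite ?mul0r ?mulr0 // => /ffunP E; case/eqP: zy.
by apply/ffunP=> j; move: (E j); rewrite !ffunE; case: (z j); case: (y j).
Qed.

Lemma mean_chi2 n (A B : {set 'I_n}) :
  mean (fun y => chi A y * chi B y) = (A == B)%:R.
Proof.
case: eqP => [->|AB].
  by rewrite (eq_mean (g := fun=> 1)) ?mean_cst // => y; rewrite chi_sqr.
case: (pickP (fun i => (i \in A) != (i \in B))) => [i iAB|H]; last first.
  by case: AB; apply/setP => i; apply/eqP/negbFE/H.
apply: (mean_flip (i := i)) => y; rewrite !chiD !chi_unit.
by move: iAB; case: (i \in A); case: (i \in B) => // _; rewrite ?expr1 ?expr0; ring.
Qed.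

Lemma parseval2 n (f g : cube n -> R) :
  mean (fun y => f y * g y) = \sum_A fcoef f A * fcoef g A.
Proof.
under eq_mean => y do rewrite (fourier_inversion f y) mulr_suml.
rewrite mean_sum; apply: eq_bigr => A _.
by rewrite /fcoef -[RHS]meanZ; apply: eq_mean => y; ring.
Qed.

Lemma parseval n (f : cube n -> R) : mean (fun y => f y ^+ 2) = \sum_A fcoef f A ^+ 2.
Proof. exact: parseval2. Qed.

Lemma fcoef0 n (f : cube n -> R) : fcoef f set0 = mean f.
Proof. by apply: eq_mean => y; rewrite chi0 mulr1. Qed.

Lemma fcoef_lin n (c : {set 'I_n} -> R) B :
  fcoef (fun y => \sum_A c A * chi A y) B = c B.
Proof.
rewrite /fcoef; under eq_mean => y do rewrite mulr_suml.
rewrite mean_sum (bigD1 B) //= big1 ?addr0 => [|A AB].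
  under eq_mean => y do rewrite -mulrA; rewrite meanZ mean_chi2 eqxx mulr1 //.
under eq_mean => y do rewrite -mulrA; by rewrite meanZ mean_chi2 (negPf AB) mulr0.
Qed.

(** By Parseval, since [mean f] is the coefficient at the empty set. *)
Lemma mean_jensen n (f : cube n -> R) : mean f ^+ 2 <= mean (fun y => f y ^+ 2).
Proof.
rewrite parseval -fcoef0 (bigD1 set0) //= lerDl; apply: sumr_ge0 => A _; exact: sqr_ge0.
Qed.

Lemma fourier_fcoef n (F : cube n -> int) U :
  fourier R F U = fcoef (fun y => (F y)%:~R) U.
Proof. by []. Qed.

End Fourier.

(** * Random walks with small-bias steps *)

Definition cube_of (o m : nat) (w : seq bool) : cube m :=
  [ffun j : 'I_m => nth false w (o + j)].

Section CoinExpectation.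
Variable R : realType.

(** Recursion on the first coin makes it easy to average over consecutive blocks of coins
    ([ebits_add]), which is how the walk is analysed; [ebits_sum] leads back to uniform tuples. *)
Fixpoint ebits (r : nat) (f : seq bool -> R) : R :=
  if r is r'.+1 then
    (ebits r' (fun w => f (true :: w)) + ebits r' (fun w => f (false :: w))) / 2
  else f [::].

Lemma eq_ebits r (f g : seq bool -> R) :
  (forall w, size w = r -> f w = g w) -> ebits r f = ebits r g.
Proof.
elim: r f g => [|r IH] f g fg /=; first exact: fg.
by congr ((_ + _) / 2); apply: IH => w sw; apply: fg; rewrite /= sw.
Qed.

Lemma ebits_add a b f :
  ebits (a + b) f = ebits a (fun u => ebits b (fun v => f (u ++ v))).
Proof. by elim: a f => //= a IH f; rewrite !IH. Qed.

Lemma ebits_sum r f : ebits r f = (2 ^+ r)^-1 * \sum_(w : r.-tuple bool) f w.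
Proof.
elim: r f => [|r IH] f /=.
  rewrite expr0 invr1 mul1r (bigD1 [tuple]) //= big1 ?addr0 // => w.
  by case/negP; rewrite tuple0.
pose h (p : bool * r.-tuple bool) := [tuple of p.1 :: p.2].
have hb : bijective h.
  exists (fun w : r.+1.-tuple bool => (thead w, [tuple of behead w])).
    by case=> b w; congr (_, _); apply: val_inj.
  by move=> w; rewrite /h /=; apply: val_inj; rewrite /= [in RHS](tuple_eta w).
rewrite (reindex h) /=; last exact: onW_bij.
rewrite -(pair_bigA _ (fun b (w : r.-tuple bool) => f (b :: w))) /= big_bool /= !IH.
rewrite exprS invfM; field; exact: pow2_neq0.
Qed.

Lemma coin_probE r E : coin_prob R r E = ebits r (fun w => (E w)%:R).
Proof.
rewrite ebits_sum /coin_prob mulrC; congr (_ * _).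
rewrite -sum1_card natr_sum big_mkcond /=; apply: eq_bigr => w _.
by rewrite inE; case: (E w).
Qed.

Lemma ebits_cube m (f : cube m -> R) : ebits m (fun w => f (cube_of 0 m w)) = mean f.
Proof.
rewrite ebits_sum /mean; congr (_ * _); symmetry.
pose h (w : m.-tuple bool) := cube_of 0 m w.
apply: (reindex h); apply: onW_bij; exists (fun y : cube m => [tuple y i | i < m]).
  by move=> w; apply: eq_from_tnth => i; rewrite tnth_mktuple ffunE add0n -tnth_nth.
by move=> y; apply/ffunP => i; rewrite ffunE add0n -tnth_nth tnth_mktuple.
Qed.

Lemma ebits_le r (f g : seq bool -> R) :
  (forall w, size w = r -> f w <= g w) -> ebits r f <= ebits r g.
Proof.
elim: r f g => [|r IH] f g fg /=; first exact: fg.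
rewrite ler_pM2r ?invr_gt0 ?ltr0n //.
by apply: lerD; apply: IH => w sw; apply: fg; rewrite /= sw.
Qed.

Lemma ebits_sumr r (I : Type) (s : seq I) (f : I -> seq bool -> R) :
  ebits r (fun w => \sum_(i <- s) f i w) = \sum_(i <- s) ebits r (f i).
Proof. by rewrite ebits_sum exchange_big mulr_sumr; apply: eq_bigr => i _; rewrite ebits_sum. Qed.

Lemma ebitsZ r c f : ebits r (fun w => c * f w) = c * ebits r f.
Proof. by rewrite !ebits_sum -mulr_sumr mulrCA. Qed.

Lemma ebits_cst r c : ebits r (fun=> c) = c.
Proof. by elim: r => //= r ->; lra. Qed.

Lemma ebitsB r (f g : seq bool -> R) : ebits r (fun w => f w - g w) = ebits r f - ebits r g.
Proof. by rewrite !ebits_sum sumrB mulrBr. Qed.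

End CoinExpectation.

Section Walk.
Variables (R : realType) (m c : nat) (g : cube c -> cube m).

(** The offset [o] counts the coins spent before the walk, so the steps are addressed by absolute
    position in the coin sequence, as the program reads them. *)
Fixpoint vert (v : cube m) (w : seq bool) (o u : nat) : cube m :=
  if u is u'.+1 then cadd (vert v w o u') (g (cube_of (o + u' * c) c w)) else v.

Lemma cube_of_cat o a w w' : size a = o -> cube_of (o + w') c (a ++ w) = cube_of w' c w.
Proof.
by move=> sa; apply/ffunP=> j; rewrite !ffunE nth_cat sa -addnA ltnNge leq_addr /= addKn.
Qed.

Lemma cube_of_catl o a w : size a = c -> o = 0%N -> cube_of o c (a ++ w) = cube_of 0 c a.
Proof.
by move=> sa ->; apply/ffunP=> j; rewrite !ffunE nth_cat sa ltn_ord.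
Qed.

Lemma vert_cat v a w o u : size a = o -> vert v (a ++ w) o u = vert v w 0 u.
Proof. by move=> sa; elim: u => //= u ->; rewrite cube_of_cat. Qed.

(** [vert] recurses on the last step, whereas the moment recursion [zwalkS] conditions on the first
    one. *)
Lemma vert_shift v a w u : size a = c ->
  vert v (a ++ w) 0 u.+1 = vert (cadd v (g (cube_of 0 c a))) w 0 u.
Proof.
move=> sa; elim: u => [|u IH]; first by rewrite /= cube_of_catl.
rewrite -[LHS]/(cadd (vert v (a ++ w) 0 u.+1) _) IH /=.
by rewrite !add0n mulSn cube_of_cat.
Qed.

(** The transition operator of the walk on the Cayley graph of F_2^m whose steps are the values of
    [g]. The characters are its eigenfunctions, with the eigenvalues [bias A]. *)
Definition avgop (f : cube m -> R) (v : cube m) : R := mean (fun r => f (cadd v (g r))).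

Definition bias (A : {set 'I_m}) : R := mean (fun r => chi R A (g r)).

Lemma bias0 : bias set0 = 1.
Proof. by rewrite /bias (eq_mean (g := fun=> 1)) ?mean_cst // => r; rewrite chi0. Qed.

Lemma avgopE f v : avgop f v = \sum_A (fcoef f A * bias A) * chi R A v.
Proof.
rewrite /avgop; under eq_mean => r do rewrite (fourier_inversion f).
rewrite mean_sum; apply: eq_bigr => A _.
by under eq_mean => r do rewrite chiD mulrA; rewrite meanZ mulrAC.
Qed.

Lemma fcoef_avgop f A : fcoef (avgop f) A = fcoef f A * bias A.
Proof. by rewrite -[RHS](fcoef_lin (fun A => fcoef f A * bias A)); apply: eq_mean=> v; rewrite avgopE. Qed.

Hypothesis small_bias : forall A, A != set0 -> bias A ^+ 2 <= 1024^-1.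

Variable B : pred (cube m).
Hypothesis small_bad : mean (fun v => (B v)%:R : R) <= 1024^-1.

(* A path on which more than half of the votes fail has a product of weights of
   at least 16^((tm+1)/2) = 4^(tm+1), so it suffices that the mean of this
   product is at most 2^(tm+1). *)
Definition weight v : R := if B v then 16 else 1.

(* The constant part of [avgop f] only meets the mean of [weight ^+ 2], which is
   at most 1 + 255 / 1024; the rest shrinks by the factor 1 / 32, which absorbs
   the factor 16. *)
Lemma avgop_contract f :
  mean (fun v => (weight v * avgop f v) ^+ 2) <= 2 * mean (fun v => f v ^+ 2).
Proof.
set q := mean (fun v => f v ^+ 2).
have q0 : 0 <= q by apply: mean_ge0 => v; exact: sqr_ge0.
pose a := mean f.
have aq : a ^+ 2 <= q by exact: mean_jensen.
have s1 : mean (fun v => avgop f v ^+ 2) <= q.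
  rewrite parseval /q parseval; apply: ler_sum => A _; rewrite fcoef_avgop exprMn.
  rewrite ler_piMr ?sqr_ge0 //; case: (eqVneq A set0) => [->|A0]; first by rewrite bias0 expr1n.
  by apply: le_trans (small_bias A0) _; lra.
have s2 : mean (fun v => (avgop f v - a) ^+ 2) <= 1024^-1 * q.
  rewrite parseval /q parseval mulr_sumr; apply: ler_sum => A _.
  have -> : fcoef (fun v => avgop f v - a) A = fcoef f A * bias A - a * (A == set0)%:R.
    rewrite -fcoef_avgop -mean_chi /fcoef -meanZ -[X in _ + X]mulN1r -meanZ -meanD.
    by apply: eq_mean => v; ring.
  case: (eqVneq A set0) => [->|A0].
    by rewrite bias0 fcoef0 /a !mulr1 subrr expr0n /= mulr_ge0 ?sqr_ge0 // invr_ge0.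
  by rewrite mulr0 subr0 exprMn mulrC ler_wpM2r ?sqr_ge0 // small_bias.
have -> : mean (fun v => (weight v * avgop f v) ^+ 2) =
   mean (fun v => avgop f v ^+ 2) + 255 * mean (fun v => (B v)%:R * avgop f v ^+ 2).
  rewrite -meanZ -meanD; apply: eq_mean => v; rewrite /weight; case: (B v) => /=; ring.
have s3 : mean (fun v => (B v)%:R * avgop f v ^+ 2) <= 2 * a ^+ 2 * 1024^-1 + 2 * (1024^-1 * q).
  apply: (le_trans (y := mean (fun v => 2 * a ^+ 2 * (B v)%:R + 2 * (avgop f v - a) ^+ 2))).
    apply: mean_le => v; case: (B v) => /=; last first.
      by rewrite mul0r mulr0 add0r; have := sqr_ge0 (avgop f v - a); lra.
    by have := sqr_ge0 (avgop f v - 2 * a); nra.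
  rewrite meanD !meanZ; apply: lerD; last by rewrite ler_wpM2l.
  by rewrite ler_wpM2l // mulr_ge0 // sqr_ge0.
(* Altogether the factor is at most 1 + 255 * 4 / 1024 < 2; the constants 16 and 1024 are matched to
   this. *)
have := sqr_ge0 a; lra.
Qed.

Definition zwalk (tm : nat) (v : cube m) : R :=
  ebits (tm * c) (fun w => \prod_(u < tm.+1) weight (vert v w 0 u)).

Lemma zwalkS tm v : zwalk tm.+1 v = weight v * avgop (zwalk tm) v.
Proof.
rewrite /zwalk mulSn ebits_add.
rewrite (eq_ebits (g := fun a => weight v * zwalk tm (cadd v (g (cube_of 0 c a))))).
  rewrite ebitsZ /avgop; congr (_ * _).
  exact: (ebits_cube (fun y => zwalk tm (cadd v (g y)))).
move=> a sa; rewrite -ebitsZ; apply: eq_ebits => w sw.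
rewrite big_ord_recl /=; congr (_ * _); apply: eq_bigr => u _.
by rewrite -vert_shift.
Qed.

(** The recursion has to run in mean square, where [avgop] contracts; only at the end is the mean
    itself bounded, by [mean_jensen]. *)
Lemma zwalk_bound tm : mean (fun v => zwalk tm v ^+ 2) <= 2 ^+ tm.+1.
Proof.
elim: tm => [|tm IH]; last first.
  rewrite exprS; under eq_mean => v do rewrite zwalkS.
  by apply: le_trans (avgop_contract _) _; rewrite ler_pM2l.
have -> : mean (fun v => zwalk 0 v ^+ 2) = 1 + 255 * mean (fun v => (B v)%:R).
  rewrite -[X in X + _](mean_cst m) -meanZ -meanD; apply: eq_mean => v.
  by rewrite /zwalk /= big_ord1 /= /weight; case: (B v) => /=; ring.
by rewrite expr1; move: small_bad; lra.
Qed.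

Lemma weight_prod t (vs : nat -> cube m) :
  \prod_(u < t) weight (vs u) = 16 ^+ (\sum_(u < t) B (vs u))%N.
Proof.
elim: t => [|t IH]; first by rewrite !big_ord0.
by rewrite !big_ord_recr /= IH exprD /weight; case: (B _); rewrite ?expr1 ?expr0.
Qed.

(** Markov's inequality for the product of weights. A tie counts as failure: already 2 * sum >= tm +
    1 makes the product at least 4^(tm+1). The first [m] coins choose the uniform starting
    vertex. *)
Lemma walk_chernoff tm :
  ebits (m + tm * c) (fun w =>
    (tm < 2 * \sum_(u < tm.+1) B (vert (cube_of 0 m w) w m u))%N%:R) <= (2 ^+ tm.+1)^-1 :> R.
Proof.
set t := tm.+1.
apply: (le_trans (y := ebits (m + tm * c) (fun w =>
    (4 ^+ t)^-1 * \prod_(u < t) weight (vert (cube_of 0 m w) w m u)))).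
  apply: ebits_le => w _; rewrite weight_prod; case: leqP => /= H.
    by rewrite mulr_ge0 ?invr_ge0 ?exprn_ge0.
  rewrite ler_pdivlMl ?exprn_gt0 // mulr1.
  have -> : (16 : R) = 4 ^+ 2 by rewrite -natrX.
  by rewrite -exprM ler_eXn2l // ?ltr1n.
rewrite ebitsZ ebits_add.
rewrite (eq_ebits (g := fun a => zwalk tm (cube_of 0 m a))).
  rewrite (ebits_cube (zwalk tm)).
  have H := le_trans (mean_jensen (zwalk tm)) (zwalk_bound tm).
  have P4 : 0 < (4 ^+ t : R) by rewrite exprn_gt0.
  have P2 := pow2_gt0 R t.
  have E4 : 4 ^+ t = 2 ^+ t * 2 ^+ t :> R by rewrite -exprMn; congr (_ ^+ _); ring.
  rewrite ler_pdivrMl // E4 mulrK ?unitfE ?lt0r_neq0 //.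
  (* The mean square bound 2^t gives the mean bound 2^(t/2); the weaker 2^t already suffices against
     4^t. *)
  have P1 : 1 <= (2 ^+ t : R) by rewrite exprn_ege1 // ler1n.
  rewrite -[X in _ <= X]ger0_norm ?(ltW P2) // ; apply: le_trans (ler_norm _) _.
  rewrite -ler_sqr ?nnegrE ?normr_ge0 // real_normK ?num_real // real_normK ?num_real //.
  apply: le_trans H _; rewrite -/t; nra.
move=> a sa; apply: eq_ebits => w sw; apply: eq_bigr => u _.
rewrite vert_cat //; congr (weight (vert _ _ _ _)).
by apply/ffunP => j; rewrite !ffunE nth_cat sa ltn_ord.
Qed.

End Walk.

(** * A small-bias generator *)

(** The default false beyond the dimension lets index sums such as i + a stay natural numbers, and
    lets a vector be compared with a whole program array. *)
Definition bit (n : nat) (x : cube n) (i : nat) : bool := oapp x false (insub i).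

Lemma bitE n (x : cube n) (j : 'I_n) : bit x j = x j.
Proof. by rewrite /bit valK. Qed.

Lemma bit_ord n (x : cube n) i (h : (i < n)%N) : bit x i = x (Ordinal h).
Proof. by rewrite -bitE. Qed.

Lemma bit_out n (x : cube n) i : (n <= i)%N -> bit x i = false.
Proof. by move=> h; rewrite /bit insubF // ltnNge h. Qed.

Definition ccat (a b : nat) (x : cube a) (y : cube b) : cube (a + b) :=
  [ffun i => match split i with inl j => x j | inr j => y j end].

Lemma ccat_l a b (x : cube a) (y : cube b) j : ccat x y (lshift b j) = x j.
Proof. by rewrite ffunE (unsplitK (inl j)). Qed.

Lemma ccat_r a b (x : cube a) (y : cube b) j : ccat x y (rshift a j) = y j.
Proof. by rewrite ffunE (unsplitK (inr j)). Qed.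

Lemma mean_cat (R : realType) a b (f : cube (a + b) -> R) :
  mean f = mean (fun x => mean (fun y => f (ccat x y))).
Proof.
rewrite /mean -[in RHS]mulr_sumr mulrA -invfM -exprD; congr (_ * _).
rewrite pair_bigA /=; apply: (reindex (fun p : cube a * cube b => ccat p.1 p.2)).
apply: onW_bij; exists (fun z : cube (a + b) =>
   ([ffun j => z (lshift b j)], [ffun j => z (rshift a j)])).
  by case=> x y; congr (_, _); apply/ffunP => j; rewrite !ffunE ?ccat_l ?ccat_r //=;
    rewrite ?(unsplitK (inl j)) ?(unsplitK (inr j)).
move=> z; apply/ffunP => i; rewrite ffunE /=.
by case: splitP => j ij; rewrite ffunE; congr (z _); apply: val_inj.
Qed.

(** Lifting the exponent: 4 = 1 + 3, and each cubing of 1 + 3^b u with u prime to 3 raises the power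
    of 3 by exactly one. *)
Lemma dvd3_order a e : (3 ^ a.+1 %| 4 ^ e - 1)%N -> (3 ^ a %| e)%N.
Proof.
have lift3 b : exists u, (4 ^ (3 ^ b) = 1 + 3 ^ b.+1 * u)%N /\ (u %% 3 = 1)%N.
  elim: b => [|b [u [Eu u1]]]; first by exists 1%N.
  exists (u + 3 ^ b.+1 * u ^ 2 + 3 ^ (b + b.+1) * u ^ 3)%N; split; last first.
    by rewrite -addnA -modnDmr expnS addnS !expnS -!mulnA -mulnDr modnMr addn0.
  rewrite expnSr expnM Eu.
  by rewrite addnS !expnS expnD; ring.
elim: a e => [|a IH] e; first by rewrite expn0 dvd1n.
move=> H; have /dvdnP[f Ef] : (3 ^ a %| e)%N.
  by apply: IH; apply: dvdn_trans H; apply: dvdn_exp2l.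
move: H; rewrite {}Ef mulnC expnM; have [u [-> u1]] := lift3 a.
(* The binomial expansion modulo 3^(a+2): only the linear term survives, so one more factor 3 must
   divide f. *)
have [w Ew] : exists w, ((1 + 3 ^ a.+1 * u) ^ f = 1 + 3 ^ a.+1 * u * f + 3 ^ a.+2 * w)%N.
  elim: f => [|f [w Ew]]; first by exists 0%N; rewrite !muln0 expn0 !addn0.
  exists (w * (1 + 3 ^ a.+1 * u) + 3 ^ a * u ^ 2 * f)%N.
  by rewrite expnSr Ew !expnS; ring.
rewrite Ew -addnA addKn dvdn_addl; last exact: dvdn_mulr.
rewrite expnSr -!mulnA dvdn_pmul2l ?expn_gt0 // => H; rewrite expnSr.
rewrite dvdn_pmul2l ?expn_gt0 //; move: H; rewrite Gauss_dvdr //.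
by rewrite prime_coprime // /dvdn u1.
Qed.

(** Ensures that the multiplicative group of the field with 4^(3^a) elements contains an element of
    order 3^(a+1). *)
Lemma dvd3_4exp a : (3 ^ a.+1 %| 4 ^ (3 ^ a) - 1)%N.
Proof.
elim: a => [|a IH] //.
have /dvdnP[u Eu] := IH.
have {Eu} Eu : (4 ^ (3 ^ a) = 1 + 3 ^ a.+1 * u)%N.
  by rewrite [RHS]addnC mulnC -Eu subnK // expn_gt0.
apply/dvdnP; exists (u + 3 ^ a.+1 * u ^ 2 + 3 ^ (a + a.+1) * u ^ 3)%N.
rewrite expnSr expnM Eu; apply/eqP; rewrite -(eqn_add2l 1) subnKC ?expn_gt0 //.
by apply/eqP; rewrite addnS !expnS expnD; ring.
Qed.

(** 3 divides 2^d - 1 only for even d; then 2^d is a power of 4 and [dvd3_order] applies. *)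
Lemma order2_mod3 a d : (0 < d)%N -> (3 ^ a.+1 %| 2 ^ d - 1)%N -> (2 * 3 ^ a <= d)%N.
Proof.
move=> d0 H; have H3 : (3 %| 2 ^ d - 1)%N by apply: dvdn_trans H; rewrite expnS dvdn_mulr.
have dE : odd d = false.
  apply/negP => dO; move: H3; rewrite -(odd_double_half d) dO add1n -mul2n expnS expnM.
  have [u Eu] : exists u, ((2 ^ 2) ^ d./2 = 1 + 3 * u)%N.
    elim: d./2 => [|k [u Eu]]; first by exists 0%N.
    by exists (4 * u + 1)%N; rewrite expnS Eu; ring.
  rewrite Eu; have -> : (2 * (1 + 3 * u) - 1 = 3 * (2 * u) + 1)%N by lia.
  by rewrite dvdn_addr ?dvdn_mulr.
move: H d0; rewrite -(odd_double_half d) dE add0n -mul2n expnM => /dvd3_order H d0.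
by rewrite leq_mul2l /= dvdn_leq //; lia.
Qed.

(* 2 is a primitive root modulo 3^(a+1), so the powers z^j, j < 2 * 3^a, of a
   primitive root of unity z are linearly independent over F_2. *)
Lemma exists_root_field a : exists (K : finFieldType) (z : K),
  [/\ (2%N \in [pchar K])%R, z ^+ (3 ^ a.+1) = 1 &
   forall x : nat -> bool, \sum_(j < 2 * 3 ^ a) (x j)%:R * z ^+ j = 0 ->
     forall j, (j < 2 * 3 ^ a)%N -> x j = false].
Proof.
have h0 : (0 < 2 * 3 ^ a)%N by rewrite muln_gt0 expn_gt0.
have [K pK cK] := @pPrimePowerField 2 _ isT h0.
have [z zP] : exists z : K, (3 ^ a.+1).-primitive_root z.
  have /cyclicP[g Eg] := field_unit_group_cyclic [set: {unit K}]%G.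
  have og : #[g]%g = (2 ^ (2 * 3 ^ a) - 1)%N.
    by rewrite /order -Eg card_finField_unit cK subn1.
  have dq : (3 ^ a.+1 %| #[g]%g)%N by rewrite og expnM dvd3_4exp.
  pose u := (g ^+ (#[g] %/ 3 ^ a.+1))%g.
  have ou : #[u]%g = (3 ^ a.+1)%N.
    rewrite orderXdiv ?dvdn_div // divnA // ?mulKn ?order_gt0 //.
  exists (val u); apply/andP; split; first by rewrite expn_gt0.
  apply/forallP => -[i ilt] /=; apply/eqP.
  rewrite unity_rootE -FinRing.val_unitX -[1]/(val (1%g : {unit K})) (inj_eq val_inj).
  rewrite -order_dvdn ou; apply/idP/eqP => [H|<-] //; apply/eqP.
  by rewrite eqn_leq ilt dvdn_leq.
exists K, z; split => //; first exact: prim_expr_order.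
move=> x Ex; pose p := \poly_(j < 2 * 3 ^ a) ((x j)%:R : K).
(* The coefficients of [p] lie in F_2, so the Frobenius map sends roots to roots. By [order2_mod3]
   the first 2 * 3^a conjugates of [z] are distinct, which is too many roots for the degree of a
   nonzero [p]. *)
have px i : root p (z ^+ (2 ^ i)).
  elim: i => [|i IH].
    by rewrite expn0 expr1 /root horner_poly Ex.
  rewrite /root expnSr exprM; move/rootP: IH; rewrite !horner_poly => IH.
  have E := congr1 (pFrobenius_aut pK) IH; rewrite rmorph0 rmorph_sum in E.
  apply/eqP; rewrite -[RHS]E; apply: eq_bigr => j _.
  by rewrite /= rmorphM rmorph_nat rmorphXn.
have p0 : p = 0.
  apply/eqP/negPn/negP => pN0.
  pose rs := [seq z ^+ (2 ^ i) | i <- iota 0 (2 * 3 ^ a)].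
  have: (size rs < size p)%N.
    apply: max_poly_roots => //; first by apply/allP => _ /mapP[i _ ->].
    rewrite map_inj_in_uniq ?iota_uniq // => i j; rewrite !mem_iota /= !add0n => Hi Hj /eqP.
    rewrite (eq_prim_root_expr zP).
    wlog ij : i j Hi Hj / (i <= j)%N => [W|] E.
      have [ij|ij] := leqP i j; first exact: W.
      by apply/esym; apply: W => //; [exact: ltnW|rewrite eq_sym].
    move: E; rewrite eq_sym eqn_mod_dvd ?leq_exp2l //.
    rewrite -(subnKC ij) expnD -{2}[(2 ^ i)%N]muln1 -mulnBr Gauss_dvdr; last first.
      by rewrite coprime_pexpl // coprimeXr.
    case: (posnP (j - i)%N) => [->|ji /order2_mod3]; first by rewrite addn0.
    by move/(_ ji); lia.
  by rewrite size_map size_iota ltnNge size_poly.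
move=> j jh; have := coef_poly (2 * 3 ^ a) (fun j => (x j)%:R : K) j; rewrite -/p p0 coef0 jh.
by case: (x j) => // /esym/eqP; rewrite oner_eq0.
Qed.

Lemma card_bigcup_le (I T : finType) (P : pred I) (F : I -> {set T}) :
  (#|\bigcup_(i | P i) F i| <= \sum_(i | P i) #|F i|)%N.
Proof.
apply: (big_rec2 (fun (A : {set T}) k => (#|A| <= k)%N)); first by rewrite cards0.
move=> i k A _ Ak; rewrite (leq_trans (leq_card_setU _ _).1) // leq_add2l //.
Qed.

Section Generator.
Variables q m : nat.

(** Multiplication in F_2[X] / (X^q - 1), written as a parity over pairs of indices, which is the
    form in which [conv_prog] computes it. *)
Definition conv (x y : cube q) : cube q :=
  [ffun r : 'I_q => \big[addb/false]_(j < q) \big[addb/false]_(l < q)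
     [&& (j + l) %% q == r, x j & y l]]%N.

Definition pw (x : cube q) (i : nat) : cube q :=
  iter i (fun u => conv u x) [ffun j : 'I_q => (j : nat) == 0%N].

Definition gen (r : cube (q + q)) : cube m :=
  [ffun i : 'I_m => \big[addb/false]_(j < q)
     (pw [ffun j => r (lshift q j)] i j && r (rshift q j))].

Lemma natr_bigaddb (K : nzRingType) (I : Type) (s : seq I) (P : pred I) (b : I -> bool) :
  2%N \in [pchar K] ->
  (\big[addb/false]_(i <- s | P i) b i)%:R = \sum_(i <- s | P i) (b i)%:R :> K.
Proof.
move=> pK; apply: (big_morph (fun b : bool => b%:R : K)) => // a c.
move: a c => [] [] /=; [|by rewrite addr0|by rewrite add0r|by rewrite addr0].
by rewrite -[RHS]/(2%:R) (pcharf0 pK).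
Qed.

Section Eval.
Variables (K : fieldType) (z : K).
Hypotheses (pK : 2%N \in [pchar K]) (zq : z ^+ q = 1) (q0 : (0 < q)%N).

(** Evaluation at [z]. Since z^q = 1 it is multiplicative for [conv], so a relation among the powers
    of [x] becomes a polynomial equation for a single field element. *)
Definition ev (x : cube q) : K := \sum_(j < q) (x j)%:R * z ^+ j.

Lemma ev_conv x y : ev (conv x y) = ev x * ev y.
Proof.
rewrite /ev big_distrlr /=.
transitivity (\sum_(r < q) \sum_(j < q) \sum_(l < q)
   (if ((j + l) %% q == r)%N then (x j && y l)%:R * z ^+ (j + l) else 0)).
  apply: eq_bigr => r _; rewrite ffunE natr_bigaddb // mulr_suml.
  apply: eq_bigr => j _; rewrite natr_bigaddb // mulr_suml; apply: eq_bigr => l _.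
  by case: eqP => [<-|] /=; rewrite ?mul0r // (expr_mod _ zq).
rewrite exchange_big; apply: eq_bigr => j _; rewrite exchange_big; apply: eq_bigr => l _.
rewrite -big_mkcond (big_pred1 (Ordinal (ltn_pmod (j + l) q0))) => [|r]; last first.
  by rewrite /= eq_sym.
by rewrite exprD -mulnb natrM; ring.
Qed.

Lemma ev_pw x i : ev (pw x i) = ev x ^+ i.
Proof.
elim: i => [|i IH]; last by rewrite exprSr -IH -ev_conv.
rewrite /ev /pw /= (bigD1 (Ordinal q0)) //= big1 => [|j j0].
  by rewrite ffunE /= mul1r addr0.
by move: j0; rewrite -val_eqE ffunE /= => /negbTE ->; rewrite mul0r.
Qed.

End Eval.

(** The last q - h bits determine a point of the fibre: if two points agree there, their difference
    is a vanishing F_2-combination of the first [h] powers of [z], hence zero. *)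
Lemma ev_fiber (K : fieldType) (z : K) h k :
  2%N \in [pchar K] -> (h <= q)%N ->
  (forall x : nat -> bool, \sum_(j < h) (x j)%:R * z ^+ j = 0 ->
     forall j, (j < h)%N -> x j = false) ->
  (#|[set x : cube q | ev z x == k]| <= 2 ^ (q - h))%N.
Proof.
move=> pK hq inj.
pose hi (x : cube q) : cube (q - h) := [ffun j : 'I_(q - h) => bit x (h + j)].
rewrite -(card_cube (q - h)) -(card_in_imset (f := hi)) ?max_card // => x y.
rewrite !inE => /eqP xk /eqP yk E; apply/ffunP => j.
case: (ltnP j h) => jh; last first.
  have jj : (j - h < q - h)%N by rewrite ltn_sub2r ?(leq_ltn_trans jh).
  by move/ffunP/(_ (Ordinal jj)): E; rewrite !ffunE /= subnKC // !bitE.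
pose d i := bit x i (+) bit y i.
suff: d j = false by rewrite /d !bitE; case: (x j); case: (y j).
apply: (inj d) => //.
have dz i : (d i)%:R = (bit x i)%:R + (bit y i)%:R :> K.
  by rewrite /d; case: bit; case: bit; rewrite /= ?addr0 ?add0r // -[RHS]/(2%:R) (pcharf0 pK).
transitivity (ev z x + ev z y); last by rewrite xk yk -mulr2n -mulr_natr (pcharf0 pK) mulr0.
rewrite /ev -big_split /=.
transitivity (\sum_(0 <= j < q) (d j)%:R * z ^+ j); last first.
  by rewrite big_mkord; apply: eq_bigr => i _; rewrite dz !bitE mulrDl.
rewrite (big_cat_nat (n := h)) //= [X in _ = _ + X]big_nat_cond [X in _ = _ + X]big1 ?addr0 ?big_mkord //.
move=> i /andP[/andP[hi' iq] _]; have jj : (i - h < q - h)%N by rewrite ltn_sub2r ?(leq_ltn_trans hi').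
move/ffunP/(_ (Ordinal jj)): E; rewrite !ffunE /= subnKC // /d => ->.
by rewrite addbb mul0r.
Qed.

Lemma chi_gen (R : realType) (A : {set 'I_m}) x y : chi R A (gen (ccat x y)) =
  chi R [set j | \big[addb/false]_(i in A) pw x i j] y.
Proof.
rewrite !chi_parity; congr (_ ^+ _).
rewrite (eq_bigr (fun i : 'I_m => \big[addb/false]_(j < q) (pw x i j && y j))); last first.
  move=> i _; rewrite ffunE; apply: eq_bigr => j _; rewrite ccat_r; congr (pw _ _ _ && _).
  by apply/ffunP=> k; rewrite ffunE ccat_l.
congr nat_of_bool; rewrite exchange_big /= [RHS]big_mkcond /=; apply: eq_bigr => j _.
rewrite inE -(big_distrl (y j)) /=.
by case: (y j); rewrite ?andbT ?andbF; case: (\big[_/_]_(i in A) _).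
Qed.

(** Averaging over the second half of the seed leaves the density of the set [Z] of those x for
    which the sum of x^i over [A] is 0. Then [ev x] is a root of a nonzero polynomial of degree
    below m, so |Z| <= m 2^(q-h), and the bias, being nonnegative, lies between 0 and m / 2^h <= 1 /
    32. *)
Lemma gen_bias (R : realType) a (A : {set 'I_m}) :
  q = (3 ^ a.+1)%N -> (32 * m <= 2 ^ (2 * 3 ^ a))%N -> A != set0 ->
  bias R gen A ^+ 2 <= 1024^-1.
Proof.
move=> qE mh A0; have q0 : (0 < q)%N by rewrite qE expn_gt0.
have [K [z [pK zq inj]]] := exists_root_field a; rewrite -qE in zq.
set h := (2 * 3 ^ a)%N in mh inj; have hq : (h <= q)%N by rewrite qE expnS /h; lia.
pose Z := [set x : cube q | [forall j, ~~ \big[addb/false]_(i in A) pw x i j]].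
have biasE : bias R gen A = (2 ^+ q)^-1 * #|Z|%:R.
  rewrite /bias mean_cat.
  under eq_mean => x do [under eq_mean => y do rewrite chi_gen; rewrite mean_chi].
  rewrite /mean; congr (_ * _); rewrite -sum1_card natr_sum [RHS]big_mkcond /=.
  apply: eq_bigr => x _; rewrite inE.
  set S := [set j | _]; suff -> : (S == set0) = [forall j, ~~ \big[addb/false]_(i in A) pw x i j].
    by case: forallP.
  apply/eqP/forallP => [/setP E j|E]; first by have := E j; rewrite !inE => ->.
  by apply/setP => j; rewrite !inE; apply/negbTE/E.
pose p : {poly K} := \sum_(i in A) 'X^i.
have [i0 i0A] := set0Pn _ A0.
have pi0 : p`_i0 = 1.
  rewrite coef_sum (bigD1 i0) //= coefXn eqxx big1 ?addr0 // => i /andP[_ ii0].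
  by rewrite coefXn eq_sym -val_eqE in ii0 *; rewrite (negbTE ii0).
have p0 : p != 0 by apply: contraTneq isT => p0; move: pi0; rewrite p0 coef0 => /eqP; rewrite eq_sym oner_eq0.
have sp : (size p <= m)%N.
  apply: leq_trans (size_sum _ _ _) _; apply/bigmax_leqP => i _.
  by rewrite size_polyXn.
pose rs := enum [pred k : K | root p k].
have srs : (size rs <= m)%N.
  apply: leq_trans sp; apply: ltnW; apply: max_poly_roots => //; last exact: enum_uniq.
  by apply/allP => k; rewrite mem_enum.
have sub : Z \subset \bigcup_(k in [pred k : K | root p k]) [set x | ev z x == k].
  apply/subsetP => x; rewrite inE => /forallP xZ; apply/bigcupP; exists (ev z x); rewrite inE //.
  rewrite /root horner_sum.
  under eq_bigr => i _ do rewrite hornerXn -(ev_pw pK zq q0).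
  rewrite exchange_big /= big1 // => j _; rewrite -mulr_suml -natr_bigaddb //.
  by rewrite (negbTE (xZ j)) mul0r.
have cZ : (#|Z| <= m * 2 ^ (q - h))%N.
  apply: leq_trans (subset_leq_card sub) _; apply: leq_trans (card_bigcup_le _ _) _.
  apply: (leq_trans (n := (\sum_(k in [pred k : K | root p k]) 2 ^ (q - h))%N)).
    by apply: leq_sum => k _; apply: ev_fiber pK hq inj.
  by rewrite sum_nat_const leq_mul2r cardE srs orbT.
have b0 : 0 <= bias R gen A by rewrite biasE mulr_ge0 // invr_ge0 ltW ?pow2_gt0.
have b1 : bias R gen A <= 32^-1.
  rewrite biasE ler_pdivrMl ?pow2_gt0 // ler_pdivlMr ?ltr0n // -natrX -natrM ler_nat.
  apply: leq_trans (leq_mul cZ (leqnn 32)) _; rewrite -{2}(subnK hq) expnD.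
  rewrite mulnAC mulnC leq_mul2l; apply/orP; right; rewrite mulnC; exact: mh.
have -> : (1024 : R)^-1 = 32^-1 ^+ 2 by rewrite exprVn -natrX.
by rewrite ler_sqr ?nnegrE // invr_ge0.
Qed.

End Generator.

(** * Pairwise independent samples *)

Definition sbit (s i : nat) : bool := odd (s %/ 2 ^ i).

Lemma sbit_inj k s s' : (s < 2 ^ k)%N -> (s' < 2 ^ k)%N ->
  (forall i : 'I_k, sbit s i = sbit s' i) -> s = s'.
Proof.
elim: k s s' => [|k IH] s s'; first by rewrite expn0 !ltnS !leqn0 => /eqP-> /eqP->.
rewrite expnS => hs hs' E.
have H : s./2 = s'./2.
  apply: IH => [||i]; [lia | lia |].
  by have := E (lift ord0 i); rewrite /sbit /= /bump /= add1n expnS !divnMA !divn2.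
have := E ord0; rewrite /sbit /= expn0 !divn1 => H0.
by rewrite -(odd_double_half s) -(odd_double_half s') H H0.
Qed.

Section Sampler.
Variables d k : nat.
Notation m := (d + k + d)%N.

(* The point with index s is the product of the Hankel matrix (v_(i+a)) with the
   bit vector s, plus a shift stored in the last d coordinates of v. *)
Definition zpt (v : cube m) (s : nat -> bool) : cube d :=
  [ffun a : 'I_d => bit v (d + k + a) (+) \big[addb/false]_(i < k) (s i && bit v (i + a))].

Lemma bit_cadd n (x y : cube n) i : bit (cadd x y) i = bit x i (+) bit y i.
Proof. by rewrite /bit; case: insub => //= j; rewrite ffunE. Qed.

(** Linearity in the seed: characters of sample points are characters of the seed. *)
Lemma zptD v u s : zpt (cadd v u) s = cadd (zpt v s) (zpt u s).
Proof.
apply/ffunP => a; rewrite !ffunE bit_cadd -!addbA; congr (_ (+) _).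
rewrite addbCA; congr (_ (+) _); rewrite -big_split; apply: eq_bigr => i _.
by rewrite bit_cadd /=; case: (s i).
Qed.

Lemma bit_unitv n (c : 'I_n) i : bit (unitv c) i = (i == c).
Proof.
case: (ltnP i n) => h; first by rewrite (bit_ord _ h) ffunE -val_eqE.
rewrite /bit insubF ?ltnNge ?h //=; apply/esym/eqP => E; by rewrite E leqNgt ltn_ord in h.
Qed.

Section Moments.
Variable R : realType.

(** The left side is the mean of a character of the seed, so where it has to vanish it suffices to
    find one unit vector on which this character is -1. For A = A' the vector is found in the Hankel
    part, for different sets in the shift. *)
Lemma mean_chi_pair (A A' : {set 'I_d}) s s' :
  mean (fun v => chi R A (zpt v s) * chi R A' (zpt v s')) =
  ((A == A') && ((A == set0) || [forall i : 'I_k, s i == s' i]))%:R.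
Proof.
have flip B u (H : chi R A (zpt u s) * chi R B (zpt u s') = -1) c : u = unitv c ->
  mean (fun v => chi R A (zpt v s) * chi R B (zpt v s')) = 0.
  move=> uc; apply: (mean_flip (i := c)) => v; rewrite -uc !zptD !chiD.
  by rewrite mulrACA H mulrN1.
case: eqP => /= [<-|AA'].
  case: eqP => /= [->|/eqP A0].
    by rewrite (eq_mean (g := fun=> 1)) ?mean_cst // => v; rewrite !chi0 mulr1.
  case: forallP => ss.
    rewrite (eq_mean (g := fun=> 1)) ?mean_cst // => v.
    have -> : zpt v s' = zpt v s; last by rewrite chi_sqr.
    apply/ffunP => a; rewrite !ffunE; congr (_ (+) _); apply: eq_bigr => i _.
    by have /eqP -> := ss i.
  have [i0 i0P] : exists i0 : 'I_k, s i0 != s' i0.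
    by apply/existsP/negbNE; rewrite negb_exists; apply/negP => /forallP H;
      case: ss => i; rewrite -[_ == _]negbK.
  (* Take the largest index where s and s' differ and the largest element of [A]. Among all such
     pairs (i, a) only this one lies on the antidiagonal i1 + a1, so the coordinate i1 + a1 of the
     seed flips exactly one factor. *)
  have [i1 i1P imax] := @arg_maxnP _ i0 (fun i : 'I_k => s i != s' i) (fun i => i : nat) i0P.
  have [a0 a0A] := set0Pn _ A0.
  have [a1 a1A amax] := @arg_maxnP _ a0 (mem A) (fun a => a : nat) a0A.
  have cm : (i1 + a1 < m)%N by have := ltn_ord i1; have := ltn_ord a1; lia.
  apply: (flip _ (unitv (Ordinal cm)) _ (Ordinal cm) erefl).
  rewrite -chiD /chi (bigD1 a1) //= big1 => [|a /andP[aA aN]].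
    rewrite mulr1 !ffunE !bit_unitv /=.
    have -> : (d + k + a1 == i1 + a1)%N = false by apply/negbTE; have := ltn_ord i1; lia.
    rewrite /= -big_split /= (bigD1 i1) //= big1 => [|i ii1].
      by rewrite bit_unitv eqxx !andbT addbF; case: (s i1) (s' i1) i1P => [] [].
    rewrite bit_unitv /= eqn_add2r (negbTE (_ : (i : nat) != i1)) ?andbF //.
  rewrite !ffunE !bit_unitv /=.
  have al : (a < a1)%N.
    by rewrite ltn_neqAle; apply/andP; split; [exact: aN | exact: amax].
  have -> : (d + k + a == i1 + a1)%N = false by apply/negbTE; have := ltn_ord i1; have := ltn_ord a1; lia.
  rewrite /= -big_split /= big1 // => i _; rewrite bit_unitv /=.
  case: (eqVneq (s i) (s' i)) => [->|/imax le]; first by rewrite addbb.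
  have -> : (i + a == i1 + a1)%N = false by apply/negbTE; move: le al; rewrite /=; lia.
  by rewrite !andbF.
case: (pickP (fun i => (i \in A) != (i \in A'))) => [a aA|H]; last first.
  by case: AA'; apply/setP => i; apply/eqP/negbFE/H.
(* A shift coordinate moves both sample points by the same unit vector, which exactly one of the two
   characters notices. *)
have cm : (d + k + a < m)%N by rewrite ltn_add2l.
apply: (flip _ (unitv (Ordinal cm)) _ (Ordinal cm) erefl).
have zu t : zpt (unitv (Ordinal cm)) t = unitv a.
  apply/ffunP => b; rewrite !ffunE bit_unitv /= eqn_add2l val_eqE big1 ?addbF // => i _.
  rewrite bit_unitv /=; have -> : (i + b == d + k + a)%N = false; last by rewrite andbF.
  by apply/negbTE; have := ltn_ord i; have := ltn_ord b; lia.
rewrite !zu !chi_unit; move: aA; case: (a \in A); case: (a \in A') => // _;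
  by rewrite ?expr1 ?expr0 ?mulr1 ?mul1r.
Qed.

Lemma mean_pair (f : cube d -> R) s s' : mean f = 0 ->
  mean (fun v => f (zpt v s) * f (zpt v s')) =
  [forall i : 'I_k, s i == s' i]%:R * mean (fun y => f y ^+ 2).
Proof.
move=> f0.
under eq_mean => v do rewrite (fourier_inversion f (zpt v s)) (fourier_inversion f (zpt v s')) big_distrlr /=.
rewrite mean_sum parseval mulr_sumr; apply: eq_bigr => A _.
rewrite mean_sum (bigD1 A) //= big1 ?addr0 => [|A' AA'].
  under eq_mean => v do rewrite mulrACA; rewrite meanZ mean_chi_pair eqxx /=.
  case: eqP => [->|_] /=; last by rewrite mulrC.
  by rewrite fcoef0 f0; ring.
under eq_mean => v do rewrite mulrACA; rewrite meanZ mean_chi_pair eq_sym.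
by rewrite (negbTE AA') mulr0.
Qed.

Lemma second_moment (f : cube d -> R) : mean f = 0 ->
  mean (fun v => (\sum_(s < 2 ^ k) f (zpt v (sbit s))) ^+ 2) =
  2 ^+ k * mean (fun y => f y ^+ 2).
Proof.
move=> f0; under eq_mean => v do rewrite expr2 big_distrlr /=.
rewrite mean_sum -natrX -[(2 ^ k)%N in RHS]card_ord mulr_natl -sumr_const.
apply: eq_bigr => s _; rewrite mean_sum (bigD1 s) //= big1 ?addr0 => [|s' ss'].
  by rewrite mean_pair //; case: forallP => [_|[] i]; rewrite ?mul1r ?eqxx.
rewrite mean_pair //; case: forallP => [H|_]; last by rewrite mul0r.
case/eqP: ss'; apply: val_inj; apply/esym; apply: (@sbit_inj k) => //= i.
exact/eqP/H.
Qed.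

Lemma sampler_chebyshev (f : cube d -> R) (mu eps : R) : (forall y, f y ^+ 2 = 1) ->
  mean f = mu -> 0 < eps ->
  mean (fun v => (eps * 2 ^+ k <= `|\sum_(s < 2 ^ k) f (zpt v (sbit s)) - mu * 2 ^+ k|)%R%:R)
    <= (eps ^+ 2 * 2 ^+ k)^-1 :> R.
Proof.
move=> f1 fmu e0; pose f0 y := f y - mu; have P := pow2_gt0 R k.
have f00 : mean f0 = 0 by rewrite meanD fmu mean_cst subrr.
have sq : mean (fun y => f0 y ^+ 2) <= 1.
  have -> : mean (fun y => f0 y ^+ 2) = mean (fun y => 1 + (- (2 * mu) * f y + mu ^+ 2)).
    by apply: eq_mean => y; rewrite /f0 sqrrB f1; ring.
  by rewrite !meanD !mean_cst meanZ fmu; have := sqr_ge0 mu; lra.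
apply: (le_trans (y := mean (fun v => ((eps * 2 ^+ k) ^+ 2)^-1 *
    (\sum_(s < 2 ^ k) f0 (zpt v (sbit s))) ^+ 2))).
  apply: mean_le => v.
  have -> : \sum_(s < 2 ^ k) f0 (zpt v (sbit s)) = \sum_(s < 2 ^ k) f (zpt v (sbit s)) - mu * 2 ^+ k.
    by rewrite sumrB sumr_const card_ord -[mu *+ _]mulr_natr natrX.
  set x := _ - _; have E0 : 0 < eps * 2 ^+ k by rewrite mulr_gt0.
  case: (leP (eps * 2 ^+ k) `|x|) => /= H; last first.
    by apply: mulr_ge0; rewrite ?invr_ge0 sqr_ge0.
  rewrite ler_pdivlMl ?exprn_gt0 // mulr1 -[X in _ <= X]real_normK ?num_real //.
  by rewrite ler_sqr ?nnegrE ?normr_ge0 // ltW.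
rewrite meanZ second_moment // exprMn invfM [X in _ <= X]invfM -mulrA.
rewrite ler_wpM2l ?invr_ge0 ?sqr_ge0 // expr2 invfM -mulrA ler_piMr ?invr_ge0 ?(ltW P) //.
by rewrite mulKf // lt0r_neq0.
Qed.

End Moments.

End Sampler.

(* For a unit vector v in this position the Hankel matrix is the
   antidiagonal permutation matrix. *)
Lemma zpt_exact (R : realType) d (c : 'I_(d + d + d)) (f : cube d -> R) : (c : nat) = d.-1 ->
  \sum_(s < 2 ^ d) f (zpt (k := d) (unitv c) (sbit s)) = \sum_y f y.
Proof.
move=> cE; case: (posnP d) => [d0|d0]; first by exfalso; have := ltn_ord c; lia.
have zE s (a : 'I_d) : zpt (k := d) (unitv c) s a = s (d.-1 - a)%N.
  have h : (d.-1 - a < d)%N by lia.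
  rewrite ffunE !bit_unitv cE (bigD1 (Ordinal h)) //= bit_unitv cE big1 => [|i iN].
    have -> : (d + d + a == d.-1)%N = false by lia.
    have -> : (d.-1 - a + a == d.-1)%N by have := ltn_ord a; lia.
    by rewrite andbT addbF.
  rewrite bit_unitv cE; have -> : (i + a == d.-1)%N = false; last by rewrite andbF.
  by apply/negbTE; move: iN; rewrite -val_eqE /=; lia.
symmetry; pose h (s : 'I_(2 ^ d)) := zpt (k := d) (unitv c) (sbit s).
rewrite (reindex h) //; apply: onW_bij; apply: inj_card_bij.
  move=> s s' /ffunP E; apply: val_inj; apply: (@sbit_inj d) => //= i.
  have hi : (d.-1 - i < d)%N by lia.
  by have := E (Ordinal hi); rewrite !zE /= subKn //; have := ltn_ord i; lia.
by rewrite card_cube card_ord.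
Qed.

(** * The prefix search *)

Definition setb n (P : {set 'I_n}) (j : nat) (b : bool) : {set 'I_n} :=
  [set i : 'I_n | if (i == j :> nat) then b else i \in P].

Definition below n (j : nat) : {set 'I_n} := [set i : 'I_n | (i < j)%N].

Definition trunc n (j : nat) (x : cube n) : cube n := [ffun i : 'I_n => (i < j)%N && x i].

Definition lhalf n (z : cube (n + n)) : cube n := [ffun i => z (lshift n i)].
Definition rhalf n (z : cube (n + n)) : cube n := [ffun i => z (rshift n i)].

Section Algorithm.
Variables (n k p tm : nat) (Fb : cube n -> bool).
Notation d := (n + n)%N.
Notation m := (d + k + d)%N.

(** The observed sign as a bit, for z = (x, y). Only the last term involves [P]: the values of F can
    be tabulated once and reused for all candidates. *)
Definition obs (z : cube d) (j : nat) (P : {set 'I_n}) : bool :=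
  Fb (lhalf z) (+) Fb (cadd (lhalf z) (trunc j.+1 (rhalf z)))
  (+) \big[addb/false]_(i in P) rhalf z i.

(* The condition is mean (phi j P) >= 4 eps on the sample, see [accE]. *)
Definition acc (v : cube m) (j : nat) (P : {set 'I_n}) : bool :=
  (256 * 2 ^ k <=
   \sum_(s < 2 ^ k) (~~ obs (zpt v (sbit s)) j P) * (5 * p ^ 2) -
   \sum_(s < 2 ^ k) (obs (zpt v (sbit s)) j P) * (5 * p ^ 2))%N.

Definition accept (vs : nat -> cube m) (j : nat) (P : {set 'I_n}) : bool :=
  (tm.+1 < 2 * \sum_(u < tm.+1) acc (vs u) j P)%N.

(* [take] only serves to make the worst-case running time independent of the
   coins; it does not cut anything off as long as the votes are right. *)
Fixpoint level (vs : nat -> cube m) (j : nat) : seq {set 'I_n} :=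
  if j is j'.+1 then
    take (2 ^ k) [seq C <- [seq setb P j' b | P <- level vs j', b <- [:: false; true]]
                 | accept vs j' C]
  else [:: set0].

Section Analysis.
Variables (R : realType) (theta : R).
Hypothesis theta0 : 0 < theta.
Hypothesis p_lb : 8 <= p%:R * theta.

Definition sgF (y : cube n) : R := (-1) ^+ Fb y.

Definition wt (j : nat) (P : {set 'I_n}) : R :=
  \sum_(U | U :&: below n j == P) fcoef sgF U ^+ 2.

Definition phi j P (z : cube d) : R := (-1) ^+ obs z j P.

Lemma phi_sqr j P z : phi j P z ^+ 2 = 1.
Proof. by rewrite /phi -exprM mulnC exprM expr2 mulrN1 opprK expr1n. Qed.

Lemma chi_trunc j (U : {set 'I_n}) x : chi R U (trunc j x) = chi R (U :&: below n j) x.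
Proof.
rewrite /chi [LHS](bigID (mem (below n j))) /= [X in _ * X]big1 ?mulr1 => [|i].
  rewrite (eq_bigl (mem (U :&: below n j))) => [|i]; last by rewrite !inE.
  by apply: eq_bigr => i; rewrite !inE => /andP[_ ij]; rewrite ffunE ij.
by rewrite inE ffunE => /andP[_ /negbTE ->].
Qed.

(** Only the second factor F(x + y') is expanded in characters. Averaging over x turns each
    coefficient into its square, and averaging over y keeps the sets whose trace on the first j + 1
    coordinates is [P]. *)
Lemma mean_phi j (P : {set 'I_n}) : P \subset below n j.+1 -> mean (phi j P) = wt j.+1 P.
Proof.
move=> Pj; rewrite mean_cat.
have E w x : phi j P (ccat w x) =
    \sum_U (fcoef sgF U * (sgF w * chi R U w)) * (chi R (U :&: below n j.+1) x * chi R P x).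
  have lE : lhalf (ccat w x) = w by apply/ffunP => i; rewrite ffunE ccat_l.
  have rE : rhalf (ccat w x) = x by apply/ffunP => i; rewrite ffunE ccat_r.
  rewrite /phi /obs lE rE !signr_addb -chi_parity -/(sgF w).
  rewrite -[(-1) ^+ Fb (cadd _ _)]/(sgF _) (fourier_inversion sgF (cadd _ _)) mulr_sumr mulr_suml.
  by apply: eq_bigr => U _; rewrite chiD chi_trunc; ring.
under eq_mean => w do under eq_mean => x do rewrite E.
under eq_mean => w do rewrite mean_sum.
rewrite mean_sum /wt [RHS]big_mkcond /=; apply: eq_bigr => U _.
under eq_mean => w do rewrite meanZ mean_chi2 mulrC.
rewrite meanZ meanZ -/(fcoef _ _) expr2.
by case: eqP; rewrite ?mul1r ?mul0r.
Qed.

Lemma sgF_sqr y : sgF y ^+ 2 = 1.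
Proof. by rewrite /sgF -exprM mulnC exprM expr2 mulrN1 opprK expr1n. Qed.

Lemma sum_fcoef : \sum_U fcoef sgF U ^+ 2 = 1.
Proof. by rewrite -parseval; under eq_mean => y do rewrite sgF_sqr; rewrite mean_cst. Qed.

Lemma fcoef_le1 U : `|fcoef sgF U| <= 1.
Proof.
rewrite -ler_sqr ?nnegrE ?normr_ge0 ?ler01 // real_normK ?num_real // expr1n -sum_fcoef.
by rewrite (bigD1 U) //= lerDl; apply: sumr_ge0 => V _; exact: sqr_ge0.
Qed.

Lemma wt_ge0 j P : 0 <= wt j P.
Proof. by apply: sumr_ge0 => U _; exact: sqr_ge0. Qed.

Lemma sum_wt j : \sum_P wt j P = 1.
Proof. by rewrite -sum_fcoef /wt [RHS](partition_big (fun U => U :&: below n j) xpredT). Qed.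

Lemma wt_mono j P : wt j.+1 P <= wt j (P :&: below n j).
Proof.
rewrite /wt [X in X <= _]big_mkcond [X in _ <= X]big_mkcond /=; apply: ler_sum => U _.
case: eqP => [<-|_]; last by case: ifP => // _; exact: sqr_ge0.
rewrite -setIA; have -> : below n j.+1 :&: below n j = below n j; last by rewrite eqxx.
by apply/setP => i; rewrite !inE ltnS; case: (ltnP i j) => [/ltnW ->|_]; rewrite ?andbF.
Qed.

Lemma wt_full P : wt n P = fcoef sgF P ^+ 2.
Proof.
rewrite /wt (big_pred1 P) // => U; have -> : below n n = setT; last by rewrite setIT.
by apply/setP => i; rewrite !inE ltn_ord.
Qed.

Lemma wt0 : wt 0 set0 = 1.
Proof.
rewrite /wt -sum_fcoef; apply: eq_bigl => U; apply/eqP/setP => i; rewrite !inE ltn0 andbF //.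
Qed.

Definition heavy j : {set {set 'I_n}} := [set P | theta ^+ 2 / 4 <= wt j P].

Lemma card_heavy j : #|heavy j|%:R <= 4 / theta ^+ 2.
Proof.
have t2 : 0 < theta ^+ 2 by rewrite exprn_gt0.
suff H : #|heavy j|%:R * (theta ^+ 2 / 4) <= 1 by rewrite ler_pdivlMr //; lra.
rewrite -[X in _ <= X](sum_wt j) mulr_natl -sumr_const [X in _ <= X](bigID (mem (heavy j))) /=.
rewrite -[X in X <= _]addr0; apply: lerD; last by apply: sumr_ge0 => P _; exact: wt_ge0.
by apply: ler_sum => P; rewrite inE.
Qed.

(** A superset of what the search tries at this level while all votes are right. It depends on F
    alone and not on the coins, which is what permits a union bound for an adaptive search. *)
Definition candidates j : {set {set 'I_n}} :=
  [set P : {set 'I_n} | (P \subset below n j.+1) && (P :&: below n j \in heavy j)].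

Lemma setb_below j (P : {set 'I_n}) : P \subset below n j -> forall b, setb P j b :&: below n j = P.
Proof.
move=> /subsetP Pj b; apply/setP => i; rewrite !inE.
have Pi : i \in P -> (i < j)%N by move=> /Pj; rewrite inE.
case: eqP => [ij|_]; last by apply/andP/idP => [[]//|iP]; split => //; exact: Pi.
by rewrite ij ltnn andbF; apply/esym/negbTE/negP => /Pi; rewrite ij ltnn.
Qed.

(** A candidate is determined by its trace below [j], which is heavy, and by whether it contains
    [j]. *)
Lemma card_candidates j : #|candidates j|%:R <= 8 / theta ^+ 2.
Proof.
have H : (#|candidates j| <= 2 * #|heavy j|)%N.
  pose h (P : {set 'I_n}) := (P :&: below n j, [exists i : 'I_n, (i == j :> nat) && (i \in P)]).
  have -> : (2 * #|heavy j|)%N = #|setX (heavy j) [set: bool]| by rewrite cardsX cardsT card_bool mulnC.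
  rewrite -(card_in_imset (f := h)) => [|P Q].
    by apply/subset_leq_card/subsetP => _ /imsetP[P PC ->]; move: PC; rewrite !inE /= => /andP[_ ->].
  rewrite inE => /andP[/subsetP Pj _]; rewrite inE => /andP[/subsetP Qj _] [/setP E E2].
  apply/setP => i; case: (ltngtP i j) => ij.
  - by have := E i; rewrite !inE ij !andbT.
  - have nin (S : {set 'I_n}) : {subset S <= below n j.+1} -> i \in S = false.
      by move=> Sj; apply/negbTE/negP => /Sj; rewrite inE ltnS leqNgt ij.
    by rewrite !nin.
  have ex (S : {set 'I_n}) : [exists i : 'I_n, (i == j :> nat) && (i \in S)] = (i \in S).
    apply/existsP/idP => [[i' /andP[/eqP i'j i'S]]|iS]; last by exists i; rewrite ij eqxx.
    by have <- : i' = i by apply: val_inj; rewrite /= i'j.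
  by move: E2; rewrite !ex.
apply: (le_trans (y := (2 * #|heavy j|)%:R)); first by rewrite ler_nat.
rewrite natrM; have := card_heavy j; lra.
Qed.

(* For p close to 8 / theta, 5 eps <= theta^2 and theta^2 / 4 <= 3 eps: on a
   sample that is not bad, weight theta^2 is accepted and whatever is accepted
   has weight at least theta^2 / 4. *)
Definition eps : R := 64 / (5 * p%:R ^+ 2).

Definition bad j (v : cube m) : bool :=
  [exists P : {set 'I_n}, (P \in candidates j) &&
    (eps * 2 ^+ k <= `|\sum_(s < 2 ^ k) phi j P (zpt v (sbit s)) - wt j.+1 P * 2 ^+ k|)].

Lemma p_gt0 : 0 < p%:R :> R.
Proof. by have := p_lb; case: (posnP p) => [->|]; rewrite ?mul0r ?ltr0n //; lra. Qed.

Lemma eps_gt0 : 0 < eps.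
Proof. by rewrite divr_gt0 // mulr_gt0 // exprn_gt0 // p_gt0. Qed.

(** Each of the at most p^2 / 8 candidates fails with probability at most 1 / (eps^2 2^k), where
    eps^2 = 4096 / (25 p^4). This explains the exponent 6: the sum is at most 25 / 32768 < 1 /
    1024. *)
Lemma mean_bad j : (p ^ 6 <= 2 ^ k)%N -> mean (fun v => (bad j v)%:R : R) <= 1024^-1.
Proof.
move=> pk; have p0 := p_gt0; have e0 := eps_gt0; have K0 := pow2_gt0 R k.
apply: (le_trans (y := mean (fun v => \sum_(P in candidates j)
    (eps * 2 ^+ k <= `|\sum_(s < 2 ^ k) phi j P (zpt v (sbit s)) - wt j.+1 P * 2 ^+ k|)%R%:R))).
  apply: mean_le => v; rewrite /bad; case: existsP => [[P /andP[PC PB]]|_] /=; last first.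
    by apply: sumr_ge0 => P _; rewrite ler0n.
  by rewrite (bigD1 P) //= PB lerDl sumr_ge0 // => Q _; rewrite ler0n.
rewrite mean_sum.
apply: (le_trans (y := \sum_(P in candidates j) (eps ^+ 2 * 2 ^+ k)^-1)).
  apply: ler_sum => P; rewrite inE => /andP[Pj _]; apply: sampler_chebyshev => //.
    by move=> y; rewrite phi_sqr.
  exact: mean_phi.
rewrite sumr_const -[_ *+ _]mulr_natl.
have tp : 64 <= p%:R ^+ 2 * theta ^+ 2.
  rewrite -exprMn; have -> : (64 : R) = 8 ^+ 2 by rewrite -natrX.
  by rewrite ler_sqr ?nnegrE // mulr_ge0 // ltW.
have cc : #|candidates j|%:R <= p%:R ^+ 2 / 8 :> R.
  apply: le_trans (card_candidates j) _; rewrite ler_pdivrMr ?exprn_gt0 //; lra.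
have pk' : p%:R ^+ 6 <= 2 ^+ k :> R by rewrite -!natrX ler_nat.
have ek0 : 0 < eps ^+ 2 * 2 ^+ k by apply: mulr_gt0 => //; exact: exprn_gt0.
rewrite ler_pdivrMr //; apply: le_trans cc _; rewrite /eps expr_div_n exprMn -exprM.
have p4 : 0 < (p%:R ^+ 4 : R) by rewrite exprn_gt0.
have -> : 1024^-1 * (64 ^+ 2 / (5 ^+ 2 * p%:R ^+ (2 * 2)) * 2 ^+ k) = 4 / 25 * (2 ^+ k / p%:R ^+ 4) :> R.
  by field; rewrite lt0r_neq0.
apply: (le_trans (y := 4 / 25 * p%:R ^+ 2)); first by have := exprn_gt0 2 p0; lra.
rewrite ler_pM2l; last by lra.
by rewrite ler_pdivlMr // -exprD.
Qed.

Lemma accE (v : cube m) j (P : {set 'I_n}) :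
  acc v j P = (256 * 2 ^+ k <= (5 * p ^ 2)%:R * \sum_(s < 2 ^ k) phi j P (zpt v (sbit s)))%R.
Proof.
set A := (\sum_(s < 2 ^ k) (~~ obs (zpt v (sbit s)) j P) * (5 * p ^ 2))%N.
set B := (\sum_(s < 2 ^ k) (obs (zpt v (sbit s)) j P) * (5 * p ^ 2))%N.
have -> : (5 * p ^ 2)%:R * \sum_(s < 2 ^ k) phi j P (zpt v (sbit s)) = A%:R - B%:R :> R.
  rewrite /A /B !natr_sum -sumrB mulr_sumr; apply: eq_bigr => s _.
  by rewrite /phi !natrM; case: obs; rewrite /= ?expr1 ?expr0; ring.
rewrite /acc -/A -/B -natrX -natrM.
have K0 : (0 < 256 * 2 ^ k)%N by rewrite muln_gt0 expn_gt0.
(* Truncated subtraction is harmless because the threshold is positive: a negative difference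
   becomes 0 and is rejected, as it should be. *)
case: (leqP B A) => BA; first by rewrite -natrB // ler_nat.
have -> : (A - B = 0)%N by apply/eqP; rewrite subn_eq0 ltnW.
rewrite leqNgt K0; apply/esym/negbTE; rewrite -ltNge.
apply: (lt_trans (y := 0)); first by rewrite subr_lt0 ltr_nat.
by rewrite ltr0n.
Qed.

Section Correct.
Hypotheses (n0 : (0 < n)%N) (p_ub : (p%:R - 1) * theta < 8).
Hypothesis k_large : (p ^ 6 <= 2 ^ k)%N \/ k = (n + n)%N.
Variable vs : nat -> cube m.
Hypothesis vs_good : forall j, (j < n)%N -> (2 * \sum_(u < tm.+1) bad j (vs u) <= tm)%N.

Section LargeP.
Hypothesis p8 : (8 <= p)%N.

(** This is why [take] in [level] cuts nothing off: either 4 / theta^2 <= p^2 / 16 <= 2^k, or k = 2n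
    and there are only 2^n sets at all. *)
Lemma size_heavy_seq j (s : seq {set 'I_n}) :
  uniq s -> {subset s <= heavy j} -> (size s <= 2 ^ k)%N.
Proof.
move=> us sH; have c1 : (size s <= #|heavy j|)%N.
  by rewrite -(card_uniqP us) subset_leq_card //; apply/subsetP.
apply: leq_trans c1 _; case: k_large => [pk|->].
  apply: leq_trans pk; rewrite -(ler_nat R); apply: le_trans (card_heavy j) _.
  have p0 := p_gt0; have tp : 64 <= p%:R ^+ 2 * theta ^+ 2.
    rewrite -exprMn; have -> : (64 : R) = 8 ^+ 2 by rewrite -natrX.
    by rewrite ler_sqr ?nnegrE // mulr_ge0 // ltW.
  rewrite ler_pdivrMr ?exprn_gt0 // natrX.
  have P4 : 1 <= p%:R ^+ 4 :> R by rewrite exprn_ege1 // ler1n; lia.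
  have -> : p%:R ^+ 6 = p%:R ^+ 4 * p%:R ^+ 2 :> R by rewrite -exprD.
  rewrite -mulrA; apply: (le_trans (y := p%:R ^+ 2 * theta ^+ 2)); first lra.
  by rewrite ler_peMl //; lra.
apply: leq_trans (max_card _) _; rewrite -cardsT -powersetT card_powerset cardsT card_ord leq_exp2l //; lia.
Qed.

(** The right-hand side is 3 [eps]. Minimality of [p] gives p theta < 8p / (p - 1) <= 64 / 7 once p
    >= 8, and (64 / 7)^2 / 4 < 192 / 5. *)
Lemma theta_p : theta ^+ 2 / 4 <= 192 / (5 * p%:R ^+ 2).
Proof.
have p0 := p_gt0; have p8' : 8 <= p%:R :> R by rewrite (ler_nat R 8).
have H : p%:R * theta <= 64 / 7 by have := p_ub; nra.
rewrite ler_pdivlMr ?mulr_gt0 ?exprn_gt0 //.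
have : (p%:R * theta) ^+ 2 <= (64 / 7) ^+ 2.
  have pt0 : 0 <= p%:R * theta by apply: mulr_ge0; exact: ltW.
  by rewrite ler_sqr ?nnegrE //; lra.
rewrite exprMn; have -> : (64 / 7 : R) ^+ 2 = 4096 / 49 by field.
by lra.
Qed.

(** Fewer than half of the matrices are bad, so the good ones decide. A weight of at least theta^2
    >= 5 [eps] is seen as at least 4 [eps] by every good matrix. Conversely an accepting majority
    contains a good matrix, and its observed mean of at least 4 [eps] leaves a weight above 3
    [eps]. *)
Lemma votes j P : (j < n)%N -> P \in candidates j ->
  (theta ^+ 2 <= wt j.+1 P -> accept vs j P) /\
  (accept vs j P -> theta ^+ 2 / 4 <= wt j.+1 P).
Proof.
move=> jn PC; have vg := vs_good jn; have p0 := p_gt0; have K0 := pow2_gt0 R k.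
have p2 : 0 < (p%:R ^+ 2 : R) by rewrite exprn_gt0.
have tp : 64 <= p%:R ^+ 2 * theta ^+ 2.
  rewrite -exprMn; have -> : (64 : R) = 8 ^+ 2 by rewrite -natrX.
  by rewrite ler_sqr ?nnegrE // mulr_ge0 // ltW.
have nb (v : cube m) : ~~ bad j v ->
    `|\sum_(s < 2 ^ k) phi j P (zpt v (sbit s)) - wt j.+1 P * 2 ^+ k| < eps * 2 ^+ k.
  by move=> /existsPn /(_ P); rewrite PC /= -ltNge.
have epsE : eps * p%:R ^+ 2 = 64 / 5 by rewrite /eps; field; rewrite lt0r_neq0.
split=> [W | A].
  have good (v : cube m) : ~~ bad j v -> acc v j P.
    move=> /nb; rewrite ltr_norml => /andP[H _]; rewrite accE natrM natrX.
    set X := \sum_(s < _) _ in H *.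
    have X1 : (theta ^+ 2 - eps) * 2 ^+ k <= X by nra.
    apply: (le_trans (y := 5 * p%:R ^+ 2 * ((theta ^+ 2 - eps) * 2 ^+ k))); last first.
      by rewrite ler_pM2l // mulr_gt0.
    by rewrite mulrA ler_pM2r //; nra.
  have : (tm.+1 <= \sum_(u < tm.+1) bad j (vs u) + \sum_(u < tm.+1) acc (vs u) j P)%N.
    rewrite -big_split /= -[X in (X <= _)%N]card_ord -sum1_card; apply: leq_sum => u _.
    by case: (boolP (bad j (vs u))) => // /good ->.
  rewrite /accept; lia.
case: (pickP (fun u : 'I_tm.+1 => acc (vs u) j P && ~~ bad j (vs u))) => [u /andP[au bu]|H]; last first.
  have : (\sum_(u < tm.+1) acc (vs u) j P <= \sum_(u < tm.+1) bad j (vs u))%N.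
    by apply: leq_sum => u _; have := H u; case: acc; case: bad.
  by move: A; rewrite /accept; lia.
have := nb _ bu; rewrite ltr_norml => /andP[_]; move: au; rewrite accE natrM natrX.
set X := \sum_(s < _) _ => X1 X2; apply: le_trans theta_p _.
have X3 : X < (wt j.+1 P + eps) * 2 ^+ k by nra.
have X4 : 256 * 2 ^+ k < 5 * p%:R ^+ 2 * (wt j.+1 P + eps) * 2 ^+ k.
  by apply: le_lt_trans X1 _; rewrite -[X in _ < X]mulrA ltr_pM2l // mulr_gt0.
rewrite ltr_pM2r // in X4; rewrite ler_pdivrMr ?mulr_gt0 //; nra.
Qed.

Lemma setb_inj j (P Q : {set 'I_n}) b c : (j < n)%N -> P \subset below n j -> Q \subset below n j ->
  setb P j b = setb Q j c -> P = Q /\ b = c.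
Proof.
move=> jn Pj Qj E; split; first by rewrite -(setb_below Pj b) -(setb_below Qj c) E.
by move/setP/(_ (Ordinal jn)): E; rewrite !inE eqxx.
Qed.

(** Distinctness and heaviness belong to the invariant because together they bound the length of the
    list, without which [take] could lose prefixes at the next level. Completeness is inherited
    since passing to a shorter prefix only increases the weight ([wt_mono]). *)
Lemma level_correct j : (j <= n)%N ->
  [/\ uniq (level vs j),
     forall P : {set 'I_n}, P \in level vs j -> (P \subset below n j) && (P \in heavy j) &
     forall P : {set 'I_n}, P \subset below n j -> theta ^+ 2 <= wt j P -> P \in level vs j].
Proof.
elim: j => [|j IH] jn.
  split=> // P.
    rewrite inE => /eqP ->; rewrite sub0set inE wt0 /=.
    (* The weight at level 0 is 1, and the threshold is at most 192 / (5 * 64) < 1. *)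
    have p0 := p_gt0; have p8' : 8 <= p%:R :> R by rewrite (ler_nat R 8).
    by apply: le_trans theta_p _; rewrite ler_pdivrMr ?mulr_gt0 ?exprn_gt0 //; nra.
  move=> P0 _; rewrite inE; apply/eqP/setP => i; rewrite in_set0.
  by apply/negbTE/negP => /(subsetP P0); rewrite inE.
have [uL sL cL] := IH (ltnW jn).
set L' := [seq C <- [seq setb P j b | P <- level vs j, b <- [:: false; true]] | accept vs j C].
have cand (P : {set 'I_n}) b : P \in level vs j -> setb P j b \in candidates j.
  move=> /sL /andP[Pj PH]; rewrite inE setb_below // PH andbT.
  apply/subsetP => i; rewrite !inE ltnS; case: (eqVneq (i : nat) j) => [->|_] //.
  by move=> /(subsetP Pj); rewrite inE => /ltnW.
have L'P (P : {set 'I_n}) : P \in L' -> (P \subset below n j.+1) && (P \in heavy j.+1).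
  rewrite mem_filter => /andP[A /allpairsP[[Q b] /= [QL _ PE]]].
  have PC : P \in candidates j by rewrite PE cand.
  have := (votes jn PC).2 A; move: PC; rewrite !inE => /andP[-> _] //.
have uL' : uniq L'.
  apply: filter_uniq; apply: allpairs_uniq => //.
  move=> [P b] [Q c] PL QL /= E.
  have /allpairsP[[P' b'] /= [/sL/andP[Pj _] _ [PP' _]]] := PL.
  have /allpairsP[[Q' c'] /= [/sL/andP[Qj _] _ [QQ' _]]] := QL.
  rewrite -PP' in Pj; rewrite -QQ' in Qj.
  by have [-> ->] := setb_inj jn Pj Qj E.
have -> : level vs j.+1 = L'.
  rewrite /= -/L' take_oversize //; apply: (@size_heavy_seq j.+1) => // P /L'P /andP[_ ->] //.
split=> // P Pj W.
have PL : P :&: below n j \in level vs j.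
  by apply: cL; [exact: subsetIr | exact: le_trans W (wt_mono _ _)].
have PE : P = setb (P :&: below n j) j (Ordinal jn \in P).
  apply/setP => i; rewrite !inE; case: eqP => [ij|/eqP ij].
    by congr (_ \in P); apply: val_inj.
  case: ltngtP ij => // [ij|ij] _; first by rewrite andbT.
  by rewrite andbF; apply/negbTE/negP => /(subsetP Pj); rewrite inE ltnS leqNgt ij.
have PC : P \in candidates j by rewrite PE cand.
rewrite mem_filter (votes jn PC).1 //; apply/allpairsP.
by exists (P :&: below n j, Ordinal jn \in P); split => //=; case: (_ \in P).
Qed.

End LargeP.

Lemma levels_exact : let L := level vs n in
  (forall U, theta <= `|fcoef sgF U| -> U \in L) /\
  (forall U, U \in L -> theta / 2 <= `|fcoef sgF U|).
Proof.
case: (leqP 8 p) => p8.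
  have [_ H1 H2] := level_correct p8 (leqnn n); split=> U.
    move=> HU; apply: H2; first by apply/subsetP => i _; rewrite inE ltn_ord.
    rewrite wt_full -[X in _ <= X]real_normK ?num_real // ler_sqr ?nnegrE ?normr_ge0 //.
    exact: ltW.
  move=> /H1/andP[_]; rewrite inE wt_full -[X in _ <= X]real_normK ?num_real //.
  have -> : theta ^+ 2 / 4 = (theta / 2) ^+ 2 by field.
  by rewrite ler_sqr ?nnegrE ?normr_ge0 // divr_ge0 // ltW.
(* Here theta > 1 and no set qualifies, so the list must be empty. Indeed 5 p^2 <= 5 * 49 = 245
   stays below 256, the threshold in [acc], so that not even a constant sign is accepted. *)
have nacc v j P : acc v j P = false.
  rewrite accE; apply/negbTE; rewrite -ltNge; have K0 := pow2_gt0 R k.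
  have X1 : \sum_(s < 2 ^ k) phi j P (zpt v (sbit s)) <= 2 ^+ k.
    rewrite -natrX -[X in _ <= X%:R]card_ord -sum1_card natr_sum; apply: ler_sum => s _.
    by rewrite /phi; case: obs; rewrite ?expr0 ?expr1 //; lra.
  apply: (le_lt_trans (y := 245 * 2 ^+ k)); last by rewrite ltr_pM2r //; lra.
  have c1 : (5 * p ^ 2)%:R <= 245 :> R.
    rewrite (ler_nat R _ 245); have : (p ^ 2 <= 7 ^ 2)%N by rewrite leq_exp2r.
    by lia.
  by apply: le_trans (ler_wpM2l _ X1) _ => //; rewrite ler_pM2r.
have -> : level vs n = [::].
  (* Level 0 is not filtered, so 0 < n is needed to get rid of the initial empty prefix. *)
  suff : forall j, (0 < j)%N -> level vs j = [::] by apply.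
  case=> // j _; rewrite /= (eq_filter (a2 := pred0)) ?filter_pred0 // => P.
  by rewrite /accept big1 // => u _; rewrite nacc.
split=> // U HU; have := le_trans HU (fcoef_le1 U) => t1; exfalso.
have p7 : p%:R * theta <= 7 * theta by rewrite ler_pM2r // (ler_nat R _ 7).
have := le_trans p_lb p7; move: t1; lra.
Qed.

End Correct.

End Analysis.
End Algorithm.

(** * Probability that the search succeeds *)

Section Success.
Variables (R : realType) (n p : nat) (theta : R) (F : cube n -> int).
Hypothesis F_sign : forall y, F y = 1 \/ F y = -1.
Notation d := (n + n)%N.
Let Fb (y : cube n) : bool := F y == -1.

Lemma sgF_oracle y : sgF Fb R y = (F y)%:~R.
Proof. by rewrite /sgF /Fb; case: (F_sign y) => ->; rewrite ?expr0 // expr1 mulrN1z. Qed.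

Lemma fourier_sgF U : fourier R F U = fcoef (sgF Fb R) U.
Proof. by rewrite fourier_fcoef /fcoef; apply: eq_mean => y; rewrite sgF_oracle. Qed.

Hypotheses (n0 : (0 < n)%N) (theta0 : 0 < theta).
Hypotheses (p_lb : 8 <= p%:R * theta) (p_ub : (p%:R - 1) * theta < 8).

Lemma level_correct_list k tm (vs : nat -> cube (d + k + d)) :
  (p ^ 6 <= 2 ^ k)%N \/ k = d ->
  (forall j, (j < n)%N -> (2 * \sum_(u < tm.+1) bad p Fb theta j (vs u) <= tm)%N) ->
  correct_list F theta (level p tm Fb vs n).
Proof.
move=> kl vg; have [H1 H2] := levels_exact theta0 p_lb n0 p_ub kl vg.
apply/andP; split; first by apply/forallP => U; apply/implyP; rewrite fourier_sgF => /H1.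
by apply/allP => U /H2; rewrite fourier_sgF.
Qed.

(** The sample runs once through the whole cube, so the observed sum has deviation 0, below eps *
    2^k. *)
Lemma exact_not_bad k (c : 'I_(d + k + d)) j : k = d -> (c : nat) = d.-1 ->
  bad p Fb theta j (unitv c) = false.
Proof.
move=> kd; subst k; move=> cE; apply/existsP => -[P /andP[]]; rewrite inE => /andP[Pj _].
rewrite (zpt_exact _ cE) leNgt => /negP[].
have -> : \sum_y phi Fb R j P y = wt Fb R j.+1 P * 2 ^+ d.
  rewrite -(mean_phi Fb R Pj) /mean mulrAC mulVf ?mul1r //; exact: pow2_neq0.
rewrite subrr normr0 mulr_gt0 ?pow2_gt0 //; exact: eps_gt0 p_lb.
Qed.

(** One walk serves all levels. Each level fails with probability at most 2^-(tm+1), and the choice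
    of [tm] makes the sum over the n levels at most delta. *)
Lemma good_prob k a tm (delta : R) : let q := (3 ^ a.+1)%N in let m := (d + k + d)%N in
  (p ^ 6 <= 2 ^ k)%N -> (32 * m <= 2 ^ (2 * 3 ^ a))%N -> n%:R <= 2 ^+ tm.+1 * delta ->
  1 - delta <= ebits (m + tm * (q + q)) (fun w =>
    [forall j : 'I_n, 2 * \sum_(u < tm.+1)
        bad p Fb theta j (vert (@gen q m) (cube_of 0 m w) w m u) <= tm]%N%:R).
Proof.
move=> q m pk mh nd; set N := (m + _)%N.
pose E j w := (tm < 2 * \sum_(u < tm.+1)
        bad p Fb theta j (vert (@gen q m) (cube_of 0 m w) w m u))%N.
apply: (le_trans (y := 1 - \sum_(j < n) ebits N (fun w => (E j w)%:R))).
  rewrite lerD2l lerN2; apply: (le_trans (y := \sum_(j < n) (2 ^+ tm.+1)^-1)).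
    apply: ler_sum => j _; apply: walk_chernoff; last exact: mean_bad.
    by move=> A A0; exact: (gen_bias R (a := a)).
  rewrite sumr_const card_ord -[_ *+ _]mulr_natl ler_pdivrMr ?pow2_gt0 //; lra.
rewrite -[X in X - _](ebits_cst N) -ebits_sumr -ebitsB; apply: ebits_le => w _.
case: forallP => [_|H] /=; first by rewrite -[X in _ <= X]/(1 : R) gerBl; apply: sumr_ge0 => j _; rewrite ler0n.
case: (pickP (fun j : 'I_n => E j w)) => [j jE|H']; last first.
  by case: H => j; rewrite leqNgt; apply/negP => jE; have := H' j; rewrite /E jE.
by rewrite subr_le0 (bigD1 j) //= jE lerDl; apply: sumr_ge0 => i _; rewrite ler0n.
Qed.

End Success.

(** * A loop language and its compilation *)

Local Open Scope nat_scope.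

(* [Rd c e] is the entry e of the array number c and [Par y] a parameter, which
   a program cannot change.  [HFor x y p] runs p [Par y] times with the loop
   index in entry 0 of x, and [HQuery c e a] asks for the point in the array a. *)
Inductive hexpr : Type :=
| Cst of nat
| Par of nat
| Rd of nat & hexpr
| HAdd of hexpr & hexpr
| HSub of hexpr & hexpr.

Inductive hcmd : Type :=
| HSkip
| HSet of nat & hexpr & hexpr
| HFlip of nat & hexpr
| HQuery of nat & hexpr & nat
| HSeq of hcmd & hcmd
| HIf of hexpr & hexpr & hcmd & hcmd
| HFor of nat & nat & hcmd.

Record hst : Type := Hst { ar : nat -> nat -> nat; cn : nat; qn : nat }.

Definition setc (c i v : nat) (s : hst) : hst :=
  Hst (fun c' => if c' == c then fun i' => if i' == i then v else ar s c i' else ar s c')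
      (cn s) (qn s).

Section Semantics.
Variables (n : nat) (Fb : cube n -> bool) (w : seq bool) (par : nat -> nat).

Fixpoint heval (s : hst) (e : hexpr) : nat :=
  match e with
  | Cst k => k
  | Par y => par y
  | Rd c e => ar s c (heval s e)
  | HAdd a b => heval s a + heval s b
  | HSub a b => heval s a - heval s b
  end.

Definition pt (a : nat -> nat) : cube n := [ffun j : 'I_n => a j != 0].

Fixpoint den (p : hcmd) (s : hst) : hst :=
  match p with
  | HSkip => s
  | HSet c e1 e2 => setc c (heval s e1) (heval s e2) s
  | HFlip c e =>
      let s' := setc c (heval s e) (nth false w (cn s)) s in Hst (ar s') (cn s).+1 (qn s)
  | HQuery c e a =>
      let s' := setc c (heval s e) (Fb (pt (ar s a))) s in Hst (ar s') (cn s) (qn s).+1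
  | HSeq p1 p2 => den p2 (den p1 s)
  | HIf a b p1 p2 => if heval s a <= heval s b then den p1 s else den p2 s
  | HFor x y p => iteri (par y) (fun i s => den p (setc x 0 i s)) s
  end.

(** An upper bound that depends on the parameters only, hence is uniform in the oracle and the
    coins; a conditional is charged for both branches. The cost of a query includes copying the
    point to the n registers from M[1] on. *)
Fixpoint cost (p : hcmd) : nat :=
  match p with
  | HQuery _ _ _ => 4 * par 0 + 5
  | HSeq p1 p2 => 1 + (cost p1 + cost p2)
  | HIf _ _ p1 p2 => 1 + (cost p1 + cost p2)
  | HFor _ y p => par y * (cost p + 5) + 3
  | _ => 1
  end.

Fixpoint flips (p : hcmd) : nat :=
  match p with
  | HFlip _ _ => 1
  | HSeq p1 p2 => flips p1 + flips p2
  | HFor _ y p => par y * flips p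
  | _ => 0
  end.

Fixpoint asks (p : hcmd) : nat :=
  match p with
  | HQuery _ _ _ => 1
  | HSeq p1 p2 => asks p1 + asks p2
  | HFor _ y p => par y * asks p
  | _ => 0
  end.

End Semantics.

Ltac simpl_den := cbn [den].

Fixpoint pure (p : hcmd) : bool :=
  match p with
  | HFlip _ _ | HQuery _ _ _ => false
  | HSeq p1 p2 => pure p1 && pure p2
  | HIf _ _ p1 p2 => pure p1 && pure p2
  | HFor _ _ p => pure p
  | _ => true
  end.

Fixpoint ewf (e : hexpr) : bool :=
  match e with
  | Rd c e => (c < 62) && ewf e
  | HAdd a b | HSub a b => ewf a && ewf b
  | _ => true
  end.

(* Both branches of [HIf] must be free of coins and queries, so that their
   numbers do not depend on the run. *)
Fixpoint wf (p : hcmd) : bool :=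
  match p with
  | HSkip => true
  | HSet c a b => [&& c < 62, ewf a & ewf b]
  | HFlip c e => (c < 62) && ewf e
  | HQuery c e a => [&& c < 62, ewf e & a < 62]
  | HSeq p1 p2 => wf p1 && wf p2
  | HIf a b p1 p2 => [&& ewf a, ewf b, wf p1, wf p2, pure p1 & pure p2]
  | HFor x _ p => (x < 62) && wf p
  end.

Fixpoint mods (p : hcmd) : seq nat :=
  match p with
  | HSkip => [::]
  | HSet c _ _ | HFlip c _ | HQuery c _ _ => [:: c]
  | HSeq p1 p2 | HIf _ _ p1 p2 => mods p1 ++ mods p2
  | HFor x _ p => x :: mods p
  end.

Section DenTheory.
Variables (n : nat) (Fb : cube n -> bool) (w : seq bool) (par : nat -> nat).
Notation den := (den Fb w par).
Notation heval := (heval par).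

Lemma ar_setc c i v s c' :
  c' != c -> ar (setc c i v s) c' = ar s c'.
Proof. by move=> /negbTE H; rewrite /= H. Qed.

Lemma den_frame p s c : c \notin mods p -> ar (den p s) c = ar s c.
Proof.
elim: p s => [|c' e1 e2|c' e|c' e a|p1 IH1 p2 IH2|a b p1 IH1 p2 IH2|x y p IH] s //=;
  rewrite ?inE ?mem_cat ?negb_or.
- by move/negbTE ->.
- by move/negbTE ->.
- by move/negbTE ->.
- by move=> /andP[h1 h2]; rewrite IH2 // IH1.
- by move=> /andP[h1 h2]; case: ifP => _; rewrite ?IH1 ?IH2.
move=> /andP[h1 h2]; elim: (par y) => //= N IHN.
by rewrite IH //= (negbTE h1).
Qed.

Lemma pure_den p s : pure p -> cn (den p s) = cn s /\ qn (den p s) = qn s.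
Proof.
elim: p s => [|c' e1 e2|c' e|c' e a|p1 IH1 p2 IH2|a b p1 IH1 p2 IH2|x y p IH] s //=.
- by move=> /andP[h1 h2]; rewrite !(IH2 _ h2).1 !(IH2 _ h2).2; exact: IH1.
- by move=> /andP[h1 h2]; case: ifP => _; auto.
by move=> h; elim: (par y) => //= N IHN; rewrite !(IH _ h).1 !(IH _ h).2.
Qed.

Lemma cn_den p s : wf p -> cn (den p s) = cn s + flips par p.
Proof.
elim: p s => [|c' e1 e2|c' e|c' e a|p1 IH1 p2 IH2|a b p1 IH1 p2 IH2|x y p IH] s //=;
  rewrite ?addn0 ?addn1 //.
- by move=> /andP[h1 h2]; rewrite IH2 // IH1 // addnA.
- by move=> /and5P[_ _ _ _ /andP[h1 h2]]; case: ifP => _; rewrite (pure_den _ _).1.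
by move=> /andP[_ h]; elim: (par y) => [|N IHN] /=; rewrite ?addn0 // IH //= IHN mulSn; lia.
Qed.

Lemma qn_den p s : wf p -> qn (den p s) = qn s + asks par p.
Proof.
elim: p s => [|c' e1 e2|c' e|c' e a|p1 IH1 p2 IH2|a b p1 IH1 p2 IH2|x y p IH] s //=;
  rewrite ?addn0 ?addn1 //.
- by move=> /andP[h1 h2]; rewrite IH2 // IH1 // addnA.
- by move=> /and5P[_ _ _ _ /andP[h1 h2]]; case: ifP => _; rewrite (pure_den _ _).2.
by move=> /andP[_ h]; elim: (par y) => [|N IHN] /=; rewrite ?addn0 // IH //= IHN mulSn; lia.
Qed.

(** A loop rule in which the step may also use that arrays outside the body are as at loop entry,
    and exactly how many coins have been read. The latter locates the coins of each step of the
    walk. *)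
Lemma den_for (I : nat -> hst -> Prop) x y p s :
  wf p ->
  I 0 s ->
  (forall i t, i < par y ->
     (forall c, c \notin x :: mods p -> ar t c = ar s c) ->
     cn t = cn s + i * flips par p ->
     I i t -> I i.+1 (den p (setc x 0 i t))) ->
  I (par y) (den (HFor x y p) s).
Proof.
move=> wp I0 IS /=.
suff H N : N <= par y -> I N (iteri N (fun i s => den p (setc x 0 i s)) s) /\
    cn (iteri N (fun i s => den p (setc x 0 i s)) s) = cn s + N * flips par p.
  by have [] := H _ (leqnn _).
elim: N => [|N IHN] hN /=; first by rewrite addn0.
have [h1 h2] := IHN (ltnW hN); split; last by rewrite cn_den //= h2 mulSn; lia.
apply: IS => // c; rewrite inE negb_or => /andP[cx cp].
by elim: (N) => //= N' IHN'; rewrite den_frame //= (negbTE cx).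
Qed.

End DenTheory.

(** * Compilation to the machine *)

Definition mulK (e : expr) : expr := iter 6 (fun e => Add e e) e.

(* Entry i of array c is stored at M[0] + 1 + c + 64 i, where M[0] = n; this
   leaves M[1], ..., M[n] for the points to be queried.  Array 62 holds the
   parameters and array 63 the loop counters, indexed by nesting depth. *)
Definition cellE (c : nat) (e : expr) : expr :=
  Add (Add (Fetch (Const 0)) (Const c.+1)) (mulK e).

Definition parE (y : nat) : expr := Fetch (cellE 62 (Const y)).

Fixpoint cexp (e : hexpr) : expr :=
  match e with
  | Cst k => Const k
  | Par y => parE y
  | Rd c e => Fetch (cellE c (cexp e))
  | HAdd a b => Add (cexp a) (cexp b)
  | HSub a b => Defs.Sub (cexp a) (cexp b)
  end.

Definition cntE (d : nat) : expr := cellE 63 (Const d).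

Definition loop (d y : nat) (body : command) : command :=
  Seq (Store (cntE d) (Const 0))
      (While (Le (Add (Fetch (cntE d)) (Const 1)) (parE y))
         (Seq body (Store (cntE d) (Add (Fetch (cntE d)) (Const 1))))).

Fixpoint ccmd (d : nat) (p : hcmd) : command :=
  match p with
  | HSkip => Skip
  | HSet c e1 e2 => Store (cellE c (cexp e1)) (cexp e2)
  | HFlip c e => Flip (cellE c (cexp e))
  | HQuery c e a =>
      Seq (loop d 0 (Store (Add (Const 1) (Fetch (cntE d))) (Fetch (cellE a (Fetch (cntE d))))))
          (Query (cellE c (cexp e)) (Const 1))
  | HSeq p1 p2 => Seq (ccmd d p1) (ccmd d p2)
  | HIf a b p1 p2 => If (Le (cexp a) (cexp b)) (ccmd d p1) (ccmd d p2)
  | HFor x y p =>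
      loop d y (Seq (Store (cellE x (Const 0)) (Fetch (cntE d))) (ccmd d.+1 p))
  end.

Section Compile.
Variables (R : realType) (n : nat) (F : cube n -> int) (delta theta : R) (w : seq bool).
Notation st := (step F delta theta w).
Let Fb (y : cube n) : bool := F y == (-1)%R.

(** One number of steps has to work for every stack [k] of pending commands; this makes executions
    compose. *)
Definition runs (p : command) (M : memory) (i q : nat) (M' : memory) (i' q' N : nat) : Prop :=
  exists2 T, T <= N & forall k, iter T st (Config (p :: k) M i q) = Config k M' i' q'.

Lemma runs_le p M i q M' i' q' N N' : N <= N' ->
  runs p M i q M' i' q' N -> runs p M i q M' i' q' N'.
Proof. by move=> h [T hT H]; exists T => //; apply: leq_trans h. Qed.

Lemma runs_seq p1 p2 M i q M1 i1 q1 M2 i2 q2 N1 N2 :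
  runs p1 M i q M1 i1 q1 N1 -> runs p2 M1 i1 q1 M2 i2 q2 N2 ->
  runs (Seq p1 p2) M i q M2 i2 q2 (1 + (N1 + N2)).
Proof.
move=> [T1 h1 H1] [T2 h2 H2]; exists (T2 + (T1 + 1)); first lia.
by move=> k; rewrite iterD iterD /= H1 H2.
Qed.

Lemma runs_store a b M i q :
  runs (Store a b) M i q (update M (eval M a) (eval M b)) i q 1.
Proof. by exists 1. Qed.

Lemma runs_if t p1 p2 M i q M' i' q' N :
  runs (if eval_test delta theta M t then p1 else p2) M i q M' i' q' N ->
  runs (If t p1 p2) M i q M' i' q' (1 + N).
Proof.
by move=> [T h H]; exists (T + 1); [lia | move=> k; rewrite iterD /= H].
Qed.

Lemma runs_while0 t p M i q : eval_test delta theta M t = false ->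
  runs (While t p) M i q M i q 1.
Proof. by move=> H; exists 1 => // k /=; rewrite H. Qed.

Lemma runs_whileS t p M i q M1 i1 q1 M2 i2 q2 N1 N2 : eval_test delta theta M t ->
  runs p M i q M1 i1 q1 N1 -> runs (While t p) M1 i1 q1 M2 i2 q2 N2 ->
  runs (While t p) M i q M2 i2 q2 (1 + N1 + N2).
Proof.
move=> H [T1 h1 H1] [T2 h2 H2]; exists (T2 + (T1 + 1)); first lia.
by move=> k; rewrite iterD iterD /= H H1 H2.
Qed.

Definition adr (b c i : nat) : nat := b + c.+1 + 64 * i.

Lemma adr_eq b c c' i i' : c < 64 -> c' < 64 ->
  (adr b c i == adr b c' i') = (c == c') && (i == i').
Proof.
move=> hc hc'; apply/eqP/andP => [|[/eqP -> /eqP ->] //]; rewrite /adr => H.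
by split; lia.
Qed.

Lemma eval_mulK M e : eval M (mulK e) = 64 * eval M e.
Proof. by rewrite /mulK /=; lia. Qed.

Lemma eval_cellE M c e : eval M (cellE c e) = adr (M 0) c (eval M e).
Proof. by rewrite /cellE /adr -eval_mulK. Qed.

Lemma eval_parE M y : eval M (parE y) = M (adr (M 0) 62 y).
Proof. by rewrite -[y in RHS]/(eval M (Const y)) -eval_cellE. Qed.

Lemma eval_cntE M d : eval M (cntE d) = adr (M 0) 63 d.
Proof. by rewrite -[d in RHS]/(eval M (Const d)) -eval_cellE. Qed.

Local Opaque cellE parE cntE.

Lemma update_adr M b c i v c' i' : c < 64 -> c' < 64 ->
  update M (adr b c i) v (adr b c' i') =
  if (c' == c) && (i' == i) then v else M (adr b c' i').
Proof. by move=> h h'; rewrite /update adr_eq. Qed.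

Lemma update_other M b c i v a : a <= b -> update M (adr b c i) v a = M a.
Proof. by move=> ab; rewrite /update; case: eqP => // E; rewrite /adr in E; lia. Qed.

Variable par : nat -> nat.
Definition rep (M : memory) (s : hst) : Prop :=
  [/\ M 0 = n,
      forall c i, c < 62 -> M (adr n c i) = ar s c i &
      forall y, M (adr n 62 y) = par y].

Definition same_cnt (d : nat) (M M' : memory) : Prop :=
  forall d', d' < d -> M' (adr n 63 d') = M (adr n 63 d').

Lemma eval_cexp M s e : rep M s -> ewf e -> eval M (cexp e) = heval par s e.
Proof.
move=> [M0 Mc Mp]; elim: e => [k|y|c e IH|a IHa b IHb|a IHa b IHb] //=.
- by move=> _; rewrite eval_parE M0 Mp.
- by move=> /andP[hc he]; rewrite eval_cellE M0 IH // Mc.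
- by move=> /andP[ha hb]; rewrite IHa // IHb.
- by move=> /andP[ha hb]; rewrite IHa // IHb.
Qed.

Lemma rep_set M s c i v : rep M s -> c < 62 -> rep (update M (adr n c i) v) (setc c i v s).
Proof.
move=> [M0 Mc Mp] hc; have hc' : c < 64 by lia.
split=> [|c' i' h'|y]; first by rewrite update_other.
  rewrite update_adr //; last by lia.
  rewrite /=; case: eqP => [->|_] /=; last exact: Mc.
  by case: eqP => // _; exact: Mc.
have ne : (62 == c) = false by lia.
by rewrite update_adr // ne Mp.
Qed.

Lemma rep_cnt M s d v : rep M s -> rep (update M (adr n 63 d) v) s.
Proof.
move=> [M0 Mc Mp]; split=> [|c' i' h'|y]; first by rewrite update_other.
  rewrite update_adr //; last by lia.
  have ne : (c' == 63) = false by lia.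
  by rewrite ne Mc.
by rewrite update_adr //= Mp.
Qed.

Lemma same_cnt_set d M c i v : c < 62 -> same_cnt d M (update M (adr n c i) v).
Proof.
move=> hc d' _; rewrite update_adr //; last by lia.
have ne : (63 == c) = false by lia.
by rewrite ne.
Qed.

Lemma same_cnt_trans d M1 M2 M3 : same_cnt d M1 M2 -> same_cnt d M2 M3 -> same_cnt d M1 M3.
Proof. by move=> h1 h2 d' hd; rewrite h2 // h1. Qed.

(* The loop counter lives in a register that the body does not touch, so the
   loop runs [par y] times whatever the body does to the visible variable. *)
Lemma runs_loop (I : nat -> memory -> nat -> nat -> Prop) d y body N M i q :
  (forall j M i q, I j M i q -> M 0 = n /\ M (adr n 62 y) = par y) ->
  (forall j M i q v, I j M i q -> I j (update M (adr n 63 d) v) i q) ->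
  I 0 M i q ->
  (forall j M i q, j < par y -> M (adr n 63 d) = j -> I j M i q ->
     exists M' i' q', [/\ runs body M i q M' i' q' N, M' (adr n 63 d) = j & I j.+1 M' i' q']) ->
  exists M' i' q', runs (loop d y body) M i q M' i' q' (par y * (N + 3) + 3) /\
    I (par y) M' i' q'.
Proof.
move=> Ip Iu I0 IS.
have cE (M1 : memory) : M1 0 = n -> eval M1 (cntE d) = adr n 63 d by move=> E; rewrite eval_cntE E.
suff W r j M1 i1 q1 : j + r = par y -> M1 (adr n 63 d) = j -> I j M1 i1 q1 ->
    exists M' i' q', runs (While (Le (Add (Fetch (cntE d)) (Const 1)) (parE y))
         (Seq body (Store (cntE d) (Add (Fetch (cntE d)) (Const 1))))) M1 i1 q1 M' i' q' (r * (N + 3) + 1)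
      /\ I (par y) M' i' q'.
  have [M0 _] := Ip _ _ _ _ I0.
  have := W (par y) 0 (update M (adr n 63 d) 0) i q (add0n _).
  rewrite update_adr // !eqxx /= => /(_ erefl (Iu _ _ _ _ _ I0)) [M' [i' [q' [h1 h2]]]].
  exists M', i', q'; split=> //; apply: runs_le (runs_seq (runs_store _ _ _ _ _) _).
    2: by rewrite cE //; exact: h1.
  by lia.
elim: r j M1 i1 q1 => [|r IH] j M1 i1 q1 jr M1j IM1; have [M0 Mp] := Ip _ _ _ _ IM1.
  exists M1, i1, q1; split; last by rewrite -jr addn0.
  by apply: runs_while0; rewrite /= cE // eval_parE M0 Mp M1j -jr addn0 addn1 ltnn.
have jy : j < par y by lia.
have [M2 [i2 [q2 [h1 h2 h3]]]] := IS _ _ _ _ jy M1j IM1.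
have [M20 _] := Ip _ _ _ _ h3.
have := IH j.+1 (update M2 (adr n 63 d) j.+1) i2 q2.
rewrite update_adr // !eqxx => /(_ _ erefl (Iu _ _ _ _ _ h3)) [|M' [i' [q' [h4 h5]]]]; first lia.
exists M', i', q'; split=> //.
have E : update M2 (eval M2 (cntE d)) (eval M2 (Add (Fetch (cntE d)) (Const 1))) =
    update M2 (adr n 63 d) j.+1 by rewrite /= cE // h2 addn1.
rewrite -E in h4.
have T : eval_test delta theta M1 (Le (Add (Fetch (cntE d)) (Const 1)) (parE y)).
  by rewrite /= cE // eval_parE M0 Mp M1j addn1.
by apply: runs_le (runs_whileS T (runs_seq h1 (runs_store _ _ _ _ _)) h4); rewrite mulSn; lia.
Qed.

Hypothesis par0 : par 0 = n.

(** The depth [d] is general in the induction: a loop body is compiled at depth d + 1 and so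
    preserves the counter at depth d, together with those of all enclosing loops. *)
Lemma ccmd_correct p d s M : wf p -> rep M s ->
  exists2 M', runs (ccmd d p) M (cn s) (qn s) M' (cn (den Fb w par p s))
                (qn (den Fb w par p s)) (cost par p) &
    rep M' (den Fb w par p s) /\ same_cnt d M M'.
Proof.
elim: p d s M => [|c e1 e2|c e|c e a|p1 IH1 p2 IH2|a b p1 IH1 p2 IH2|x y p IH] d s M /=.
- by move=> _ r; exists M => //; exists 1.
- move=> /and3P[hc he1 he2] r; exists (update M (adr n c (heval par s e1)) (heval par s e2)).
    have [M0 _ _] := r; rewrite -(eval_cexp r he1) -(eval_cexp r he2) -{1}M0 -eval_cellE.
    exact: runs_store.
  by split; [exact: rep_set | exact: same_cnt_set].
- move=> /andP[hc he] r; exists (update M (adr n c (heval par s e)) (nth false w (cn s))).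
    have [M0 _ _] := r; rewrite -(eval_cexp r he) -{1}M0 -eval_cellE.
    by exists 1.
  by split; [have := rep_set (heval par s e) (nth false w (cn s)) r hc | exact: same_cnt_set].
- move=> /and3P[hc he ha] r.
  pose I j M1 i q := [/\ j <= n, i = cn s /\ q = qn s, rep M1 s, same_cnt d M M1 &
     forall j', j' < j -> M1 j'.+1 = ar s a j'].
  have := @runs_loop I d 0 (Store (Add (Const 1) (Fetch (cntE d))) (Fetch (cellE a (Fetch (cntE d)))))
     1 M (cn s) (qn s).
  case.
  + by move=> j M1 i q [_ _ [h1 h2 h3] _ _].
  + move=> j M1 i q v [jn h1 h3 h4 h5]; split=> //; first exact: rep_cnt.
      move=> d' hd; have ne : (d' == d) = false by lia.
      by rewrite update_adr // ne andbF h4.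
    by move=> j' hj'; rewrite update_other ?h5 //; lia.
  + by split.
  + move=> j M1 i q; rewrite par0 => jn M1j [_ [-> ->] [M0 Mc Mp] s1 h5].
    exists (update M1 j.+1 (ar s a j)), (cn s), (qn s).
    have low b c' i' : n <= b -> update M1 j.+1 (ar s a j) (adr b c' i') = M1 (adr b c' i').
      by rewrite /update /adr => nb; case: eqP => // ?; lia.
    split; last split=> //.
    * have -> : update M1 j.+1 (ar s a j) = update M1 (eval M1 (Add (Const 1) (Fetch (cntE d))))
          (eval M1 (Fetch (cellE a (Fetch (cntE d))))).
        by rewrite /= eval_cellE /= eval_cntE M0 M1j Mc.
      exact: runs_store.
    * by rewrite low.
    * by split=> [|c' i' hc'|y]; [rewrite /update /= M0 | rewrite low // Mc | rewrite low // Mp].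
    * by move=> d' hd; rewrite low // s1.
    move=> j'; rewrite ltnS leq_eqVlt /update => /orP[/eqP ->|hj]; first by rewrite eqxx.
    have ne : (j'.+1 == j.+1) = false by lia.
    by rewrite ne h5.
  move=> M1 [i [q [h1 I1]]]; case: I1 h1 => _ [-> ->] r1 s1 h5 h1; have [M0 Mc Mp] := r1.
  have ptE : pt n (ar s a) = read_point n M1 1.
    by apply/ffunP => j; rewrite !ffunE add1n h5 // par0.
  exists (update M1 (adr n c (heval par s e)) (Fb (pt n (ar s a)))).
    rewrite (_ : 4 * par 0 + 5 = 1 + ((par 0 * (1 + 3) + 3) + 1)); last by lia.
    apply: runs_seq h1 _; rewrite ptE -(eval_cexp r1 he) -{1}M0 -eval_cellE.
    by exists 1.
  split; first by have := rep_set (heval par s e) (Fb (pt n (ar s a))) r1 hc.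
  apply: same_cnt_trans s1 _; exact: same_cnt_set.
- move=> /andP[w1 w2] r; have [M1 h1 [r1 s1]] := IH1 d s M w1 r.
  have [M2 h2 [r2 s2]] := IH2 d _ M1 w2 r1; exists M2; first exact: runs_seq h1 h2.
  by split=> //; exact: same_cnt_trans s1 s2.
- move=> /and5P[ha hb w1 w2 _] r.
  have E : eval_test delta theta M (Le (cexp a) (cexp b)) = (heval par s a <= heval par s b).
    by rewrite /= (eval_cexp r ha) (eval_cexp r hb).
  case: ifP => L; rewrite L in E.
    have [M1 h1 [r1 s1]] := IH1 d s M w1 r; exists M1 => //.
    by apply: runs_if; rewrite E; apply: runs_le h1; lia.
  have [M1 h1 [r1 s1]] := IH2 d s M w2 r; exists M1 => //.
  by apply: runs_if; rewrite E; apply: runs_le h1; lia.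
move=> /andP[hx hp] r.
pose S j := iteri j (fun i s => den Fb w par p (setc x 0 i s)) s.
pose I j M1 i q := [/\ i = cn (S j), q = qn (S j), rep M1 (S j) & same_cnt d M M1].
have := @runs_loop I d y (Seq (Store (cellE x (Const 0)) (Fetch (cntE d))) (ccmd d.+1 p))
     (cost par p + 2) M (cn s) (qn s).
case.
- by move=> j M1 i q [_ _ [h1 h2 h3] _].
- move=> j M1 i q v [h1 h2 h3 h4]; split=> //; first exact: rep_cnt.
  move=> d' hd; have ne : (d' == d) = false by lia.
  by rewrite update_adr // ne andbF h4.
- by split.
- move=> j M1 i q jy M1j [-> -> r1 s1].
  have r2 := rep_set 0 j r1 hx.
  have [M2 h2 [r3 s3]] := IH d.+1 _ _ hp r2.
  exists M2, (cn (S j.+1)), (qn (S j.+1)); split.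
  + have [M0 _ _] := r1.
    have E : update M1 (eval M1 (cellE x (Const 0))) (eval M1 (Fetch (cntE d))) =
        update M1 (adr n x 0) j by rewrite eval_cellE /= eval_cntE M0 M1j.
    rewrite -E in h2; apply: runs_le (runs_seq (runs_store _ _ _ _ _) h2); lia.
  + by rewrite s3 // (@same_cnt_set d.+1 M1 x 0 j hx d (ltnSn d)).
  + split=> //; apply: same_cnt_trans s1 _; apply: (same_cnt_trans (@same_cnt_set d M1 x 0 j hx)).
    by move=> d' hd; apply: s3; lia.
move=> M' [i' [q' [h I']]]; case: I' h => -> -> r' s' h; exists M' => //.
by apply: runs_le h; lia.
Qed.

End Compile.

(** * The program *)

(* The arrays of the program: V holds the current vertex of the walk, SB the
   index of a sample point in binary, Z that point, Y the point to be queried, D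
   and RS the second halves of all sample points and the observed signs, X and W
   the coins of a step, PW and NW the powers of X, QA and QB the lists of the
   current and of the next level, CA a candidate, and Out, Len, Num and Idx
   serve to write the output.  The names in v are scalars (entry 0 of an array),
   those in l loop variables, and those in p parameters. *)
Notation cV := 0 (only parsing).
Notation cSB := 1 (only parsing).
Notation cZ := 2 (only parsing).
Notation cY := 3 (only parsing).
Notation cD := 4 (only parsing).
Notation cRS := 5 (only parsing).
Notation cX := 6 (only parsing).
Notation cW := 7 (only parsing).
Notation cPW := 8 (only parsing).
Notation cNW := 9 (only parsing).
Notation cQA := 10 (only parsing).
Notation cQB := 11 (only parsing).
Notation cCA := 12 (only parsing).
Notation cOut := 13 (only parsing).
Notation cLen := 14 (only parsing).
Notation cNum := 15 (only parsing).
Notation cIdx := 16 (only parsing).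
Notation vz := 17 (only parsing).
Notation vf0 := 18 (only parsing).
Notation vf1 := 19 (only parsing).
Notation vg := 20 (only parsing).
Notation vr := 21 (only parsing).
Notation vcnt := 22 (only parsing).
Notation vcn2 := 23 (only parsing).
Notation vwp := 24 (only parsing).
Notation vrp := 25 (only parsing).
Notation vvt := 26 (only parsing).
Notation vps := 27 (only parsing).
Notation vng := 28 (only parsing).
Notation vx := 29 (only parsing).
Notation voff := 30 (only parsing).
Notation vP5 := 31 (only parsing).
Notation vk := 32 (only parsing).
Notation vS := 33 (only parsing).
Notation vpow := 34 (only parsing).
Notation ve := 35 (only parsing).
Notation vh := 36 (only parsing).
Notation vmf := 37 (only parsing).
Notation vtm := 38 (only parsing).
Notation vS4 := 39 (only parsing).
Notation vcy := 40 (only parsing).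
Notation li := 41 (only parsing).
Notation lj := 42 (only parsing).
Notation la := 43 (only parsing).
Notation ls := 44 (only parsing).
Notation lu := 45 (only parsing).
Notation ll := 46 (only parsing).
Notation lb := 47 (only parsing).
Notation vfl := 48 (only parsing).

Notation pn := 0 (only parsing).
Notation pp := 1 (only parsing).
Notation pt0 := 2 (only parsing).
Notation pk := 3 (only parsing).
Notation pS := 4 (only parsing).
Notation pm := 5 (only parsing).
Notation pq := 6 (only parsing).
Notation pmf := 7 (only parsing).
Notation ptm := 8 (only parsing).
Notation pd := 9 (only parsing).
Notation pt1 := 10 (only parsing).

Notation Sc c := (Rd c (Cst 0)).
Notation "c <~ e" := (HSet c (Cst 0) e) (at level 80).
Notation "c '[' i ']' <~ e" := (HSet c i e) (at level 80, i at level 79, e at level 79).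
Notation "p ;; q" := (HSeq p q) (at level 85, right associativity).
(** Boolean operations on 0/1 entries by arithmetic: 1 - b is negation, 2 <= a + b is conjunction,
    and 1 <= a tests a bit. *)
Notation Tog c e := (HSet c e (HSub (Cst 1) (Rd c e))).
Notation Both a b p := (HIf (Cst 2) (HAdd a b) p HSkip).
Notation When a p := (HIf (Cst 1) a p HSkip).

Definition point_prog : hcmd :=
  HFor la pd (
    vz <~ Rd cV (HAdd (HAdd (Par pd) (Par pk)) (Sc la)) ;;
    HFor li pk (Both (Rd cSB (Sc li)) (Rd cV (HAdd (Sc li) (Sc la))) (Tog vz (Cst 0))) ;;
    cZ [ Sc la ] <~ Sc vz).

(** The queried point starts at x and is changed in at most one coordinate per round, thus passing
    through all truncations x + y'. So n + 1 queries provide the data of a sample point for all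
    levels. *)
Definition ask_prog : hcmd :=
  HFor lj pn (cY [ Sc lj ] <~ Rd cZ (Sc lj)) ;;
  HQuery vf0 (Cst 0) cY ;;
  HFor lj pn (
    cD [ Sc vg ] <~ Rd cZ (HAdd (Par pn) (Sc lj)) ;;
    When (Rd cZ (HAdd (Par pn) (Sc lj))) (Tog cY (Sc lj)) ;;
    HQuery vf1 (Cst 0) cY ;;
    cRS [ Sc vg ] <~ Sc vf1 ;;
    When (Sc vf0) (Tog cRS (Sc vg)) ;;
    vg <~ HAdd (Sc vg) (Cst 1)).

(* Multiplication and powers of 2 are not available, so the binary digits of the
   index are updated by adding 1 with carry. *)
Definition incr_prog : hcmd :=
  vcy <~ Cst 1 ;;
  HFor li pk (
    When (Sc vcy)
      (HIf (Cst 1) (Rd cSB (Sc li)) (cSB [ Sc li ] <~ Cst 0)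
         (cSB [ Sc li ] <~ Cst 1 ;; vcy <~ Cst 0))).

Definition sample_prog : hcmd :=
  HFor ls pS (point_prog ;; ask_prog ;; incr_prog).

Lemma togb (b : bool) : 1 - b = ~~ b.
Proof. by case: b. Qed.

Section Sample.
Variables (n k : nat) (Fb : cube n -> bool) (w : seq bool) (par : nat -> nat).
Notation d := (n + n).
Notation m := (d + k + d).
Notation den := (den Fb w par).
Notation heval := (heval par).
Hypotheses (par_n : par pn = n) (par_k : par pk = k) (par_S : par pS = 2 ^ k) (par_d : par pd = d).

Lemma den_seq p1 p2 s : den (p1 ;; p2) s = den p2 (den p1 s).
Proof. by []. Qed.

(** The common form of the scalar products over F_2 in the program: a bit is toggled whenever both
    factors are 1. It serves for sample points, for the coordinates of the generator and for the
    character of a candidate. *)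
Lemma parity_loop x y c e0 e1 e2 s (b : bool) (B : nat -> bool) id :
  wf (HFor x y (Both e1 e2 (Tog c e0))) -> x != c ->
  (forall i t, i < par y -> (forall c', c' \notin [:: x; c] -> ar t c' = ar s c') ->
     heval (setc x 0 i t) e0 = id /\
     (2 <= heval (setc x 0 i t) e1 + heval (setc x 0 i t) e2) = B i) ->
  ar s c id = b ->
  let t := den (HFor x y (Both e1 e2 (Tog c e0))) s in
  ar t c id = b (+) \big[addb/false]_(i < par y) B i /\
  forall i, i != id -> ar t c i = ar s c i.
Proof.
move=> W xc H Hb.
apply: (den_for (I := fun N t => ar t c id = b (+) \big[addb/false]_(i < N) B i /\
  forall i, i != id -> ar t c i = ar s c i)).
- by case/andP: W.
- by split=> //; rewrite big_ord0 addbF.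
move=> i t iy fr _ [H1 H2]; rewrite big_ord_recr addbA.
have [E0 E1] : heval (setc x 0 i t) e0 = id /\
     (2 <= heval (setc x 0 i t) e1 + heval (setc x 0 i t) e2) = B i.
  by apply: H => // c' h; apply: fr; move: h; rewrite /= !inE !negb_or orbF.
have cx : (c == x) = false by rewrite eq_sym; apply/negbTE.
simpl_den; rewrite -[heval _ (HAdd e1 e2)]/(heval (setc x 0 i t) e1 + heval (setc x 0 i t) e2).
rewrite -[heval _ (Cst 2)]/2 E1; case: (B i); last first.
  by rewrite addbF /= cx H1; split=> // i' hi'; rewrite H2.
rewrite -[heval _ (HSub _ _)]/(1 - ar (setc x 0 i t) c (heval (setc x 0 i t) e0)) E0.
rewrite /= !eqxx cx H1 addbT togb; split=> // i' /negbTE h; rewrite h H2 //.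
by rewrite h.
Qed.

Lemma point_spec s (v : cube m) (sb : nat -> bool) :
  (forall i, ar s cV i = bit v i) -> (forall i, i < k -> ar s cSB i = sb i) ->
  forall a : 'I_d, ar (den point_prog s) cZ a = zpt v sb a.
Proof.
move=> hV hS.
suff H : forall a, a < d -> ar (den point_prog s) cZ a =
    (bit v (d + k + a) (+) \big[addb/false]_(i < k) (sb i && bit v (i + a))).
  by move=> a; rewrite H // ffunE.
rewrite /point_prog -{1}par_d.
apply: (den_for (I := fun N t => forall a, a < N -> ar t cZ a =
    (bit v (d + k + a) (+) \big[addb/false]_(i < k) (sb i && bit v (i + a))))) => //.
move=> a t ad fr _ IH; rewrite !den_seq; set t1 := den (vz <~ _) _.
have t1V i : ar t1 cV i = bit v i by rewrite /t1 /= fr.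
have t1S i : i < k -> ar t1 cSB i = sb i by move=> ik; rewrite /t1 /= fr // hS.
have t1a : ar t1 la 0 = a by [].
have t1z : ar t1 vz 0 = bit v (d + k + a) by rewrite /t1 /= par_d par_k fr.
have t1Z i : ar t1 cZ i = ar t cZ i by [].
clearbody t1.
have [] := @parity_loop li pk vz (Cst 0) (Rd cSB (Sc li)) (Rd cV (HAdd (Sc li) (Sc la))) t1
  (bit v (d + k + a)) (fun i => sb i && bit v (i + a)) 0 isT isT _ t1z.
  move=> i t2 ik fr2; split=> //=; rewrite !fr2 // t1a t1V t1S -?par_k //.
  by case: (sb i); case: bit.
rewrite par_k; set t2 := den _ t1 => H _ a'; rewrite ltnS leq_eqVlt.
have t2a : ar t2 la 0 = a by rewrite den_frame.
have t2Z i : ar t2 cZ i = ar t cZ i by rewrite den_frame.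
rewrite /= t2a H; case: eqP => [->|_] //= h; rewrite t2Z; exact: IH.
Qed.

Lemma copy_spec x y c c' s :
  [&& x != c, x != c', c != c', c < 62, x < 62 & c' < 62] ->
  forall j, j < par y ->
  ar (den (HFor x y (c [ Sc x ] <~ Rd c' (Sc x))) s) c j = ar s c' j.
Proof.
move=> /and5P[xc xc' cc' hc /andP[hx hc']].
apply: (den_for (I := fun N t => forall j, j < N -> ar t c j = ar s c' j)) => //.
  by rewrite /= hc hx hc'.
move=> j t jy fr _ IH j'.
have cx : (c == x) = false by rewrite eq_sym; apply/negbTE.
have c'x : (c' == x) = false by rewrite eq_sym; apply/negbTE.
rewrite ltnS leq_eqVlt /= !eqxx cx c'x /=; case: eqP => [->|_] //= h; last exact: IH.
by rewrite fr // !inE eq_sym (negbTE xc') eq_sym (negbTE cc').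
Qed.

Definition res (z : cube d) (j : nat) : bool :=
  Fb (lhalf z) (+) Fb (cadd (lhalf z) (trunc j.+1 (rhalf z))).

Lemma ask_spec s (z : cube d) : (forall a : 'I_d, ar s cZ a = z a) ->
  let t := den ask_prog s in let g := ar s vg 0 in
  [/\ ar t vg 0 = g + n,
      forall x, x < g -> ar t cD x = ar s cD x /\ ar t cRS x = ar s cRS x &
      forall j : 'I_n, ar t cD (g + j) = rhalf z j /\ ar t cRS (g + j) = res z j].
Proof.
move=> hZ; rewrite /ask_prog !den_seq; set g := ar s vg 0.
set t1 := den (HFor lj pn _) s.
have t1Y (j : 'I_n) : ar t1 cY j = lhalf z j.
  by rewrite copy_spec // ?par_n // (hZ (lshift n j)) ffunE.
have t1c c : c \notin [:: lj; cY] -> ar t1 c = ar s c by move=> h; rewrite den_frame.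
clearbody t1; set t2 := den (HQuery _ _ _) t1.
have t2f : ar t2 vf0 0 = Fb (lhalf z).
  by rewrite /t2 /=; congr (nat_of_bool (Fb _)); apply/ffunP => j; rewrite ffunE t1Y; case: (lhalf z j).
have t2Y (j : 'I_n) : ar t2 cY j = lhalf z j by rewrite -t1Y.
have t2c c : c \notin [:: lj; cY; vf0] -> ar t2 c = ar s c.
  move=> h; rewrite den_frame ?t1c //; move: h; rewrite !inE !negb_or => /and3P[? ? ?] //.
  by apply/andP.
clearbody t2.
(* After N rounds the point in Y is x plus the first N coordinates of y; round N adds coordinate N
   before it asks, hence the truncation at N + 1 in [res]. *)
pose I N t := [/\ ar t vg 0 = g + N, ar t vf0 0 = Fb (lhalf z),
   (forall j : 'I_n, ar t cY j = lhalf z j (+) ((j < N) && rhalf z j)),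
   (forall x, x < g -> ar t cD x = ar s cD x /\ ar t cRS x = ar s cRS x) &
   (forall j : 'I_n, j < N -> ar t cD (g + j) = rhalf z j /\ ar t cRS (g + j) = res z j)].
match goal with |- context [den (HFor lj pn ?b) t2] =>
  have H : I (par pn) (den (HFor lj pn b) t2); [apply: (den_for (I := I)) => //|] end.
- split=> // [|j|x xg]; [by rewrite t2c // addn0 | by rewrite t2Y ltn0 addbF | by rewrite !t2c].
move=> N t; rewrite par_n => Nn fr _ [Ig If IY Io Ij].
have tZ : ar t cZ (n + N) = rhalf z (Ordinal Nn).
  by rewrite fr // t2c // (hZ (rshift n (Ordinal Nn))) ffunE.
clear fr; set b := rhalf z (Ordinal Nn) in tZ *.
rewrite !den_seq.
set s1 := den _ (setc lj 0 N t).
have s1D x : ar s1 cD x = if x == g + N then b : nat else ar t cD x.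
  by rewrite /s1 /= Ig par_n tZ.
have s1Z : ar s1 cZ (n + N) = b by rewrite /s1 /=.
have s1c c : c \notin [:: lj; cD] -> ar s1 c = ar t c.
  by rewrite !inE !negb_or => /andP[/negbTE h1 /negbTE h2]; rewrite /s1 /= h1 h2.
have s1j : ar s1 lj 0 = N by [].
clearbody s1; set s2 := den _ s1.
have s2Y (j : 'I_n) : ar s2 cY j = lhalf z j (+) ((j < N.+1) && rhalf z j).
  rewrite /s2 /= s1j par_n s1Z s1c //=; case: (eqVneq (j : nat) N) => [jN|jN].
    have jE : j = Ordinal Nn by apply: val_inj.
    rewrite jE /= ltnS leqnn /= -/b; case: (b) => /=; last first.
      by rewrite s1c // (IY (Ordinal Nn)) /= ltnn addbF.
    by rewrite eqxx (IY (Ordinal Nn)) /= ltnn addbF addbT togb.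
  have -> : (j < N.+1) = (j < N) by rewrite ltnS leq_eqVlt (negbTE jN).
  by case: (b) => /=; rewrite ?(negbTE jN) ?s1c // IY.
have s2c c : c \notin [:: lj; cD; cY] -> ar s2 c = ar t c.
  move=> h; rewrite den_frame; last by move: h; rewrite !inE !negb_or => /and3P[].
  by rewrite s1c //; move: h; rewrite !inE !negb_or => /and3P[-> ->].
have s2D x : ar s2 cD x = if x == g + N then b : nat else ar t cD x by rewrite den_frame.
clearbody s2; set s3 := den _ s2.
have s3f : ar s3 vf1 0 = Fb (cadd (lhalf z) (trunc N.+1 (rhalf z))).
  rewrite /s3 /=; congr (nat_of_bool (Fb _)); apply/ffunP => j; rewrite !ffunE s2Y !ffunE.
  by case: (_ (+) _).
have s3Y (j : 'I_n) : ar s3 cY j = lhalf z j (+) ((j < N.+1) && rhalf z j) by rewrite -s2Y.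
have s3c c : c \notin [:: lj; cD; cY; vf1] -> ar s3 c = ar t c.
  move=> h; rewrite den_frame; last by move: h; rewrite !inE !negb_or => /and4P[].
  by rewrite s2c //; move: h; rewrite !inE !negb_or => /and4P[-> -> ->].
have s3D x : ar s3 cD x = if x == g + N then b : nat else ar t cD x by rewrite -s2D.
clearbody s3.
have s3g : ar s3 vg 0 = g + N by rewrite s3c.
have s3f0 : ar s3 vf0 0 = Fb (lhalf z) by rewrite s3c.
set s4 := den _ s3.
have s4R x : ar s4 cRS x = if x == g + N then Fb (cadd (lhalf z) (trunc N.+1 (rhalf z))) : nat else ar t cRS x.
  by rewrite /s4 /= s3g s3f s3c.
have s4c c : c != cRS -> ar s4 c = ar s3 c by move=> /negbTE h; rewrite /s4 /= h.
clearbody s4; set s5 := den _ s4.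
have s5R x : ar s5 cRS x = if x == g + N then res z N : nat else ar t cRS x.
  rewrite /s5 /= s4c // s3f0 s4c // s3g /res; case: (Fb (lhalf z)) => /=; rewrite !s4R.
    by case: eqP => // _; rewrite eqxx togb.
  by [].
have s5c c : c != cRS -> ar s5 c = ar s3 c by move=> h; rewrite den_frame ?inE // s4c.
clearbody s5.
have s6c c : c != vg -> ar (den (vg <~ HAdd (Sc vg) (Cst 1)) s5) c = ar s5 c.
  by move=> h; rewrite den_frame // inE.
split.
- by rewrite /= s5c // s3g addn1 addnS.
- by rewrite s6c // s5c.
- by move=> j; rewrite s6c // s5c // s3Y.
- move=> x xg; have xN : (x == g + N) = false by apply/negbTE; lia.
  by rewrite !s6c // s5R s5c // s3D xN; exact: Io.
move=> j; rewrite ltnS leq_eqVlt => jN; rewrite !s6c // s5R s5c // s3D eqn_add2l.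
case: eqP jN => [jN _|_ /= h]; last exact: Ij.
have -> : j = Ordinal Nn by apply: val_inj.
by [].
case: H => h1 _ _ h4 h5; rewrite par_n in h1 h5; split=> // j; exact: h5.
Qed.

(** When 1 is added to s, a carry reaches digit i exactly if all lower digits are 1, that is, if 2^i
    divides s + 1. *)
Lemma sbitS s i : sbit s.+1 i = (2 ^ i %| s.+1) (+) sbit s i.
Proof. by rewrite /sbit divnS ?expn_gt0 // oddD; case: dvdn. Qed.

Lemma carryS s i : (2 ^ i.+1 %| s.+1) = (2 ^ i %| s.+1) && sbit s i.
Proof.
have P : 0 < 2 ^ i by rewrite expn_gt0.
case: (boolP (2 ^ i %| s.+1)) => /= [H|/negP H]; last first.
  by apply/negbTE/negP => H'; apply: H; apply: dvdn_trans H'; apply: dvdn_exp2l.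
have E := divnS s P; rewrite H add1n in E.
rewrite -(divnK H) E expnS dvdn_pmul2r // dvdn2 /sbit /= negbK //.
Qed.

Lemma incr_spec s x : (forall i, i < k -> ar s cSB i = sbit x i) ->
  forall i, i < k -> ar (den incr_prog s) cSB i = sbit x.+1 i.
Proof.
move=> hS; rewrite /incr_prog den_seq; set t1 := den _ s.
have t1S i : i < k -> ar t1 cSB i = sbit x i by move=> ik; rewrite -hS.
have t1c : ar t1 vcy 0 = 1 by [].
clearbody t1.
pose I N t := ar t vcy 0 = (2 ^ N %| x.+1) /\
  forall i, i < k -> ar t cSB i = if i < N then sbit x.+1 i else sbit x i.
match goal with |- context [den (HFor li pk ?b) t1] =>
  have H : I (par pk) (den (HFor li pk b) t1); [apply: (den_for (I := I)) => //|] end.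
  by split=> [|i ik]; [rewrite t1c expn0 dvd1n | rewrite t1S].
  move=> N t; rewrite par_k => Nk _ _ [Ic IS].
  have tN : ar t cSB N = sbit x N by rewrite IS // ltnn.
  rewrite /I carryS /= Ic tN.
  split.
    by case: (2 ^ N %| x.+1) Ic => Ic; case: (sbit x N); rewrite /= ?Ic.
  move=> i ik; have -> : (i < N.+1) = (i == N) || (i < N) by rewrite ltnS leq_eqVlt.
  case: (eqVneq i N) => [->|iN] /=.
    by rewrite sbitS; case: (2 ^ N %| x.+1); case: (sbit x N) tN => tN; rewrite /= ?eqxx ?tN.
  by case: (2 ^ N %| x.+1); case: (sbit x N); rewrite /= ?(negbTE iN) IS.
by case: H => _ H i ik; rewrite par_k in H; rewrite H // ik.
Qed.

(** The last of the 2^k increments overflows and leaves the index at 0, so the next sample can start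
    without a reset. *)
Lemma sample_spec s (v : cube m) :
  (forall i, ar s cV i = bit v i) -> (forall i, i < k -> ar s cSB i = 0) ->
  let t := den sample_prog s in let g := ar s vg 0 in
  [/\ ar t vg 0 = g + 2 ^ k * n,
      forall i, i < k -> ar t cSB i = 0,
      forall x, x < g -> ar t cD x = ar s cD x /\ ar t cRS x = ar s cRS x &
      forall (x : nat) (j : 'I_n), x < 2 ^ k ->
         ar t cD (g + x * n + j) = rhalf (zpt v (sbit x)) j /\
         ar t cRS (g + x * n + j) = res (zpt v (sbit x)) j].
Proof.
move=> hV hS; set g := ar s vg 0.
have sbit0 i : i < k -> sbit 0 i = false by rewrite /sbit div0n.
have sbit2k i : i < k -> sbit (2 ^ k) i = false.
  by move=> ik; rewrite /sbit -(subnK (ltnW ik)) expnD mulnK ?expn_gt0 // oddX; lia.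
pose I N t := [/\ ar t vg 0 = g + N * n,
      forall i, i < k -> ar t cSB i = sbit N i,
      forall x, x < g -> ar t cD x = ar s cD x /\ ar t cRS x = ar s cRS x &
      forall (x : nat) (j : 'I_n), x < N ->
         ar t cD (g + x * n + j) = rhalf (zpt v (sbit x)) j /\
         ar t cRS (g + x * n + j) = res (zpt v (sbit x)) j].
have : I (par pS) (den sample_prog s); last first.
  by rewrite par_S => -[h1 h2 h3 h4]; split=> // i ik; rewrite h2 // sbit2k.
apply: (den_for (I := I)) => //.
  by split=> // [|i ik]; [rewrite mul0n addn0 | rewrite hS // sbit0].
move=> N t _ fr _ [Ig IS Io Ij]; rewrite 2!den_seq.
have tV i : ar (setc ls 0 N t) cV i = bit v i by rewrite /= fr.
have tS i : i < k -> ar (setc ls 0 N t) cSB i = sbit N i by move=> ik; rewrite /= IS.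
have H1 := point_spec tV tS; have F1 := @den_frame n Fb w par point_prog (setc ls 0 N t).
set t1 := den point_prog _ in H1 F1 *.
have t1g : ar t1 vg 0 = g + N * n by rewrite F1.
have t1S i : i < k -> ar t1 cSB i = sbit N i by move=> ik; rewrite F1 // tS.
have t1D c : c \in [:: cD; cRS] -> ar t1 c = ar t c.
  by rewrite !inE => /orP[]/eqP ->; rewrite F1.
clearbody t1; clear F1.
have [] := ask_spec H1; have F2 := @den_frame n Fb w par ask_prog t1.
set t2 := den ask_prog _ in F2 *; rewrite t1g => h1 h2 h3.
have t2S i : i < k -> ar t2 cSB i = sbit N i by move=> ik; rewrite F2 // t1S.
clearbody t2; clear F2.
have H3 := incr_spec t2S; have F3 := @den_frame n Fb w par incr_prog t2.
set t3 := den incr_prog _ in H3 F3 *.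
split=> //; first by rewrite F3 // h1 mulSn addnCA addnC addnA.
  move=> x xg; rewrite !F3 //; have [|-> ->] := h2 x; first lia.
  by rewrite !t1D //; exact: Io.
move=> x j; rewrite ltnS leq_eqVlt !F3 // => /orP[/eqP->|xN]; first exact: h3.
have [|-> ->] := h2 (g + x * n + j).
  have := leq_mul xN (leqnn n); rewrite mulSn; have := ltn_ord j; lia.
by rewrite !t1D //; exact: Ij.
Qed.

End Sample.

(** * A step of the walk, and the table of all samples *)

Definition conv_prog : hcmd :=
  HFor lj pq (cNW [ Sc lj ] <~ Cst 0) ;;
  HFor lj pq (HFor ll pq (Both (Rd cPW (Sc lj)) (Rd cX (Sc ll)) (
    vr <~ HAdd (Sc lj) (Sc ll) ;;
    HIf (Par pq) (Sc vr) (vr <~ HSub (Sc vr) (Par pq)) HSkip ;;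
    Tog cNW (Sc vr)))) ;;
  HFor lj pq (cPW [ Sc lj ] <~ Rd cNW (Sc lj)).

Definition walk_prog : hcmd :=
  HFor lj pq (HFlip cX (Sc lj)) ;;
  HFor lj pq (HFlip cW (Sc lj)) ;;
  HFor lj pq (cPW [ Sc lj ] <~ Cst 0) ;;
  cPW [ Cst 0 ] <~ Cst 1 ;;
  HFor li pm (
    HFor lj pq (Both (Rd cPW (Sc lj)) (Rd cW (Sc lj)) (Tog cV (Sc li))) ;;
    conv_prog).

Section WalkProg.
Variables (n m q : nat) (Fb : cube n -> bool) (w : seq bool) (par : nat -> nat).
Notation den := (den Fb w par).
Notation heval := (heval par).
Hypotheses (par_q : par pq = q) (par_m : par pm = m) (q0 : 0 < q).

Lemma flip_spec x y c s : [&& x != c, c < 62 & x < 62] ->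
  forall j, j < par y -> ar (den (HFor x y (HFlip c (Sc x))) s) c j = nth false w (cn s + j).
Proof.
move=> /and3P[xc hc hx].
apply: (den_for (I := fun N t => forall j, j < N -> ar t c j = nth false w (cn s + j))) => //.
  by rewrite /= hc hx.
move=> j t jy fr Hc IH j'.
have cx : (c == x) = false by rewrite eq_sym; apply/negbTE.
rewrite ltnS leq_eqVlt /= !eqxx cx /= Hc /= muln1; case: eqP => [->|_] //= h.
exact: IH.
Qed.

Lemma zero_spec x y c s : [&& x != c, c < 62 & x < 62] ->
  forall j, j < par y -> ar (den (HFor x y (c [ Sc x ] <~ Cst 0)) s) c j = 0.
Proof.
move=> /and3P[xc hc hx].
apply: (den_for (I := fun N t => forall j, j < N -> ar t c j = 0)) => //.
  by rewrite /= hc hx.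
move=> j t jy fr _ IH j'.
have cx : (c == x) = false by rewrite eq_sym; apply/negbTE.
rewrite ltnS leq_eqVlt /= !eqxx cx /=; case: eqP => [->|_] //= h.
exact: IH.
Qed.

Lemma conv_spec s (u x : cube q) :
  (forall j : 'I_q, ar s cPW j = u j) -> (forall j : 'I_q, ar s cX j = x j) ->
  forall j : 'I_q, ar (den conv_prog s) cPW j = conv u x j.
Proof.
move=> hu hx; rewrite /conv_prog 2!den_seq.
set t1 := den _ s.
have t1N r : r < q -> ar t1 cNW r = 0 by rewrite -par_q => rq; rewrite zero_spec.
have t1u (j : 'I_q) : ar t1 cPW j = u j by rewrite den_frame.
have t1x (j : 'I_q) : ar t1 cX j = x j by rewrite den_frame.
clearbody t1; set t2 := den _ t1 => j.
rewrite copy_spec ?par_q //.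
pose B r j l := [&& (j + l) %% q == r, bit u j & bit x l].
suff H : forall r : 'I_q, ar t2 cNW r = \big[addb/false]_(j < q) \big[addb/false]_(l < q) B r j l.
  by rewrite H ffunE; congr nat_of_bool; apply: eq_bigr => j' _; apply: eq_bigr => l _; rewrite /B !bitE.
pose I J t := forall r : 'I_q, ar t cNW r = \big[addb/false]_(j < J) \big[addb/false]_(l < q) B r j l.
suff : I (par pq) t2 by rewrite par_q.
apply: (den_for (I := I)) => //; first by move=> r; rewrite big_ord0 t1N.
move=> J t; rewrite par_q => Jq fr _ IJ.
pose I2 L t' := forall r : 'I_q, ar t' cNW r =
   \big[addb/false]_(j < J) \big[addb/false]_(l < q) B r j l (+) \big[addb/false]_(l < L) B r J l.
set t0 := setc lj 0 J t.
match goal with |- context [den (HFor ll pq ?b) t0] =>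
  have H : I2 (par pq) (den (HFor ll pq b) t0); [apply: (den_for (I := I2)) => //|] end.
- by move=> r; rewrite big_ord0 addbF /= IJ.
- move=> L t'; rewrite par_q => Lq fr' _ IL r.
  (* Since J + L < 2q, a single subtraction reduces the index modulo q. *)
  have rE : (if q <= J + L then J + L - q else J + L) = (J + L) %% q.
    case: leqP => h; last by rewrite modn_small.
    by rewrite -{2}(subnK h) modnDr modn_small //; lia.
  have t'u : ar t' cPW J = bit u J by rewrite fr' //= fr // (t1u (Ordinal Jq)) (bit_ord _ Jq).
  have t'x : ar t' cX L = bit x L by rewrite fr' //= fr // (t1x (Ordinal Lq)) (bit_ord _ Lq).
  have t'J : ar t' lj 0 = J by rewrite fr'.
  have IL' : ar t' cNW r = _ := IL r.
  rewrite big_ord_recr addbA -[B r J (ord_max : 'I_L.+1)]/(B r J L) /=.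
  rewrite t'J t'u t'x par_q [B r J L]/B.
  case: (bit u J); case: (bit x L); rewrite /= ?andbF ?addbF //.
  rewrite andbT -rE; case: (leqP q (J + L)) => h; rewrite /= ?eqxx /= [X in _ (+) X]eq_sym.
    by case: eqP => [<-|_]; rewrite ?addbF // addbT IL' togb.
  by case: eqP => [<-|_]; rewrite ?addbF // addbT IL' togb.
move=> r; rewrite big_ord_recr; move: (H r); rewrite par_q => -> //.
Qed.

Lemma walk_spec s (v : cube m) : (forall i, ar s cV i = bit v i) ->
  forall i, ar (den walk_prog s) cV i = bit (cadd v (@gen q m (cube_of (cn s) (q + q) w))) i.
Proof.
move=> hV; rewrite /walk_prog 4!den_seq.
set cb := cube_of _ _ _.
pose x : cube q := [ffun j => cb (lshift q j)]; pose y : cube q := [ffun j => cb (rshift q j)].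
set t1 := den _ s.
have t1X (j : 'I_q) : ar t1 cX j = x j by rewrite flip_spec ?par_q // !ffunE.
have t1n : cn t1 = cn s + q by rewrite cn_den //= par_q muln1.
have t1V i : ar t1 cV i = bit v i by rewrite den_frame.
clearbody t1; set t2 := den _ t1.
have t2W (j : 'I_q) : ar t2 cW j = y j by rewrite flip_spec ?par_q // t1n !ffunE addnA.
have t2X (j : 'I_q) : ar t2 cX j = x j by rewrite den_frame.
have t2V i : ar t2 cV i = bit v i by rewrite den_frame.
clearbody t2; set t3 := den _ t2.
have t3P (j : 'I_q) : ar t3 cPW j = 0 by rewrite zero_spec ?par_q.
have t3W (j : 'I_q) : ar t3 cW j = y j by rewrite den_frame.
have t3X (j : 'I_q) : ar t3 cX j = x j by rewrite den_frame.
have t3V i : ar t3 cV i = bit v i by rewrite den_frame.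
clearbody t3; set t4 := den _ t3.
have t4P (j : 'I_q) : ar t4 cPW j = pw x 0 j by rewrite /t4 /= ffunE t3P; case: eqP.
have t4W (j : 'I_q) : ar t4 cW j = y j by rewrite den_frame.
have t4X (j : 'I_q) : ar t4 cX j = x j by rewrite den_frame.
have t4V i : ar t4 cV i = bit v i by rewrite den_frame.
clearbody t4.
pose I N t := (forall j : 'I_q, ar t cPW j = pw x N j) /\
  forall i, ar t cV i = bit v i (+) ((i < N) && bit (@gen q m cb) i).
match goal with |- context [den (HFor li pm ?b) t4] =>
  have H : I (par pm) (den (HFor li pm b) t4); [apply: (den_for (I := I)) => //|] end.
- by split=> // i; rewrite t4V ltn0 addbF.
- move=> N t; rewrite par_m => Nm fr _ [IP IV]; rewrite den_seq.
  set t0 := setc li 0 N t.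
  have [] := @parity_loop n Fb w par lj pq cV (Sc li) (Rd cPW (Sc lj)) (Rd cW (Sc lj)) t0
     (bit v N) (fun j => bit (pw x N) j && bit y j) N isT isT.
  + move=> j t' jq fr'; split; first by rewrite /= fr'.
    rewrite par_q in jq; rewrite /= !fr' //= (fr cW) // (IP (Ordinal jq)) (t4W (Ordinal jq)).
    by rewrite !(bit_ord _ jq); do 2 case: (_ (Ordinal jq)).
  + by rewrite /= IV ltnn addbF.
  rewrite par_q; set t5 := den _ t0 => h1 h2.
  have t5P (j : 'I_q) : ar t5 cPW j = pw x N j by rewrite den_frame //= IP.
  have t5X (j : 'I_q) : ar t5 cX j = x j by rewrite den_frame //= fr.
  clearbody t5; split; first by move=> j; rewrite (conv_spec t5P t5X).
  move=> i; rewrite den_frame // ltnS leq_eqVlt; case: (eqVneq i N) => [->|iN] /=.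
    rewrite h1; congr (nat_of_bool (_ (+) _)); rewrite (bit_ord _ Nm) ffunE; apply: eq_bigr => j _.
    by rewrite !bitE ffunE.
  by rewrite h2 //= IV.
move=> i; case: H => _ ->; rewrite par_m bit_cadd; case: (ltnP i m) => // im.
by rewrite addbF (bit_out (gen _ _)) // addbF.
Qed.

End WalkProg.

(** Both modes share this code. The unit vector needed for the exhaustive sample is stored first;
    when coins are used, the flips overwrite all coordinates of V. In the exhaustive mode both loop
    counts [pmf] and [ptm] are 0. *)
Definition table_prog : hcmd :=
  cV [ HSub (Par pd) (Cst 1) ] <~ Cst 1 ;;
  HFor li pmf (HFlip cV (Sc li)) ;;
  sample_prog ;;
  HFor lu ptm (walk_prog ;; sample_prog).

Section TableProg.
Variables (n k q : nat) (Fb : cube n -> bool) (w : seq bool) (par : nat -> nat).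
Notation d := (n + n).
Notation m := (d + k + d).
Notation den := (den Fb w par).
Notation heval := (heval par).
Hypotheses (par_n : par pn = n) (par_k : par pk = k) (par_S : par pS = 2 ^ k) (par_d : par pd = d).
Hypotheses (par_q : par pq = q) (par_m : par pm = m) (q0 : 0 < q).

Definition has_table (t : hst) (vs : nat -> cube m) (N : nat) : Prop :=
  forall u x (j : 'I_n), u < N -> x < 2 ^ k ->
    ar t cD ((u * 2 ^ k + x) * n + j) = rhalf (zpt (vs u) (sbit x)) j /\
    ar t cRS ((u * 2 ^ k + x) * n + j) = res Fb (zpt (vs u) (sbit x)) j.

Lemma index_lt u x N j : u < N -> x < 2 ^ k -> j < n -> (u * 2 ^ k + x) * n + j < N * (2 ^ k * n).
Proof.
move=> uN xS jn; apply: (leq_trans (n := (u * 2 ^ k + x).+1 * n)).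
  by rewrite mulSn addnC ltn_add2r.
rewrite mulnA leq_mul2r; apply/orP; right.
apply: (leq_trans (n := u.+1 * 2 ^ k)); first by rewrite mulSn; lia.
by rewrite leq_mul2r uN orbT.
Qed.

Lemma has_table_step t t' vs N : has_table t vs N ->
  (forall x, x < N * (2 ^ k * n) -> ar t' cD x = ar t cD x /\ ar t' cRS x = ar t cRS x) ->
  (forall (x : nat) (j : 'I_n), x < 2 ^ k ->
     ar t' cD (N * (2 ^ k * n) + x * n + j) = rhalf (zpt (vs N) (sbit x)) j /\
     ar t' cRS (N * (2 ^ k * n) + x * n + j) = res Fb (zpt (vs N) (sbit x)) j) ->
  has_table t' vs N.+1.
Proof.
move=> H Ho Hn u x j; rewrite ltnS leq_eqVlt => /orP[/eqP ->|uN] xS.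
  by rewrite mulnDl -mulnA; exact: Hn.
have [-> ->] := Ho _ (index_lt uN xS (ltn_ord j)); exact: H.
Qed.

Lemma table_spec s (v0 : cube m) tm :
  (forall i, ar s cSB i = 0) -> ar s vg 0 = 0 -> par ptm = tm ->
  (forall i, ar (den (HFor li pmf (HFlip cV (Sc li)))
               (den (cV [ HSub (Par pd) (Cst 1) ] <~ Cst 1) s)) cV i = bit v0 i) ->
  has_table (den table_prog s)
    (vert (@gen q m) v0 w (cn s + par pmf)) tm.+1.
Proof.
move=> sSB sg ptmE; rewrite /table_prog 2!den_seq.
set s1 := den _ (den _ s) => s1V; rewrite den_seq.
have s1n : cn s1 = cn s + par pmf by rewrite /s1 cn_den //= muln1.
have s1S i : i < k -> ar s1 cSB i = 0 by rewrite /s1 !den_frame.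
have s1g : ar s1 vg 0 = 0 by rewrite /s1 !den_frame.
clearbody s1.
have [] := sample_spec Fb w par_n par_k par_S par_d s1V s1S.
set s2 := den sample_prog s1; rewrite s1g !add0n => h1 h2 _ h4.
have s2n : cn s2 = cn s + par pmf.
  rewrite /s2 cn_den // s1n; have -> : flips par sample_prog = 0; last by rewrite addn0.
  by rewrite /= !(muln0, addn0).
have s2V i : ar s2 cV i = bit v0 i by rewrite /s2 den_frame.
clearbody s2; set o := cn s + par pmf in s2n *.
pose vs := vert (@gen q m) v0 w o.
pose I N t := [/\ has_table t vs N.+1, forall i, ar t cV i = bit (vs N) i,
   forall i, i < k -> ar t cSB i = 0 & ar t vg 0 = N.+1 * (2 ^ k * n)].
match goal with |- context [den (HFor lu ptm ?b) s2] =>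
  have H : I (par ptm) (den (HFor lu ptm b) s2); [apply: (den_for (I := I)) => //|] end.
- split=> //; last by rewrite mul1n.
  move=> u x j; rewrite ltnS leqn0 => /eqP -> xS; rewrite mul0n add0n; exact: h4.
- move=> N t Ntm fr Hc [It IV IS Ig]; rewrite den_seq.
  set t0 := setc lu 0 N t.
  have t0V i : ar t0 cV i = bit (vs N) i by rewrite /= IV.
  have := walk_spec Fb w par_q par_m q0 t0V; have F := @den_frame n Fb w par walk_prog t0.
  set t1 := den walk_prog t0 in F *; rewrite /= Hc s2n.
  have -> : flips par (walk_prog;; sample_prog) = q + q.
    by rewrite /= !(muln0, addn0, muln1) par_q.
  rewrite -[cadd _ _]/(vs N.+1) => t1V.
  have t1S i : i < k -> ar t1 cSB i = 0 by move=> ik; rewrite F //= IS.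
  have t1g : ar t1 vg 0 = N.+1 * (2 ^ k * n) by rewrite F //= Ig.
  have t1D : has_table t1 vs N.+1 by move=> u x j uN xS; rewrite !F //=; exact: It.
  clearbody t1.
  have [] := sample_spec Fb w par_n par_k par_S par_d t1V t1S.
  have F2 := @den_frame n Fb w par sample_prog t1.
  set t2 := den sample_prog t1 in F2 *; rewrite t1g => g1 g2 g3 g4.
  split=> //; [exact: has_table_step t1D g3 g4 | by move=> i; rewrite F2 | by rewrite g1 mulSn addnC].
by case: H => h _ _ _; rewrite ptmE in h.
Qed.

End TableProg.

(** * Votes and the search level by level *)

Definition dblE (r : nat) (e : hexpr) : hexpr := iter r (fun e => HAdd e e) e.

Lemma heval_dblE par s r e : heval par s (dblE r e) = 2 ^ r * heval par s e.
Proof. by elim: r => [|r IH] /=; rewrite ?mul1n // -/(dblE r e) IH expnS; lia. Qed.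

(** The variable [lj] is the level, set by the loop in [search_prog] and not touched here. The
    offset [vg] runs through the table, one row of n entries per sample point. Adding 5 p^2 for each
    sign replaces a multiplication. *)
Definition vote_prog : hcmd :=
  vvt <~ Cst 0 ;; vg <~ Cst 0 ;;
  HFor lu pt1 (
    vps <~ Cst 0 ;; vng <~ Cst 0 ;;
    HFor ls pS (
      vx <~ Rd cRS (HAdd (Sc vg) (Sc lj)) ;;
      HFor li pn (Both (Rd cCA (Sc li)) (Rd cD (HAdd (Sc vg) (Sc li))) (Tog vx (Cst 0))) ;;
      HIf (Cst 1) (Sc vx) (vng <~ HAdd (Sc vng) (Sc vP5)) (vps <~ HAdd (Sc vps) (Sc vP5)) ;;
      vg <~ HAdd (Sc vg) (Par pn)) ;;
    HIf (dblE 8 (Par pS)) (HSub (Sc vps) (Sc vng)) (vvt <~ HAdd (Sc vvt) (Cst 1)) HSkip).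

Definition try_prog (b : nat) : hcmd :=
  HFor li pn (cCA [ Sc li ] <~ Rd cQA (HAdd (Sc vrp) (Sc li))) ;;
  cCA [ Sc lj ] <~ Cst b ;;
  vote_prog ;;
  HIf (HAdd (Par pt1) (Cst 1)) (HAdd (Sc vvt) (Sc vvt))
    (HFor li pn (cQB [ HAdd (Sc vwp) (Sc li) ] <~ Rd cCA (Sc li)) ;;
     vwp <~ HAdd (Sc vwp) (Par pn) ;; vcn2 <~ HAdd (Sc vcn2) (Cst 1))
    HSkip.

(** Loop counts must be parameters, so the loops run 2^k times, the maximal length of a list, and a
    guard skips the entries beyond the current length. The last conditional carries out [take]: the
    entries beyond 2^k are neither copied nor counted. *)
Definition level_prog : hcmd :=
  vcn2 <~ Cst 0 ;; vwp <~ Cst 0 ;; vrp <~ Cst 0 ;;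
  HFor lb pS (HIf (HAdd (Sc lb) (Cst 1)) (Sc vcnt)
    (try_prog 0 ;; try_prog 1 ;; vrp <~ HAdd (Sc vrp) (Par pn)) HSkip) ;;
  vx <~ Cst 0 ;;
  HFor lb pS (HFor li pn (cQA [ Sc vx ] <~ Rd cQB (Sc vx) ;; vx <~ HAdd (Sc vx) (Cst 1))) ;;
  vcnt <~ Sc vcn2 ;;
  HIf (Par pS) (Sc vcn2) (vcnt <~ Par pS) HSkip.

Definition search_prog : hcmd := vcnt <~ Cst 1 ;; HFor lj pn level_prog.

Lemma notin_of (L K : seq nat) c : all (fun c => c \notin L) K -> c \in K -> c \notin L.
Proof. by move=> /allP H /H. Qed.

Lemma neq_of (K : seq nat) c x : x \notin K -> c \in K -> c != x.
Proof. by move=> xK cK; apply: contraNneq xK => <-. Qed.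

Ltac frame_by h :=
  solve [apply: (notin_of _ h); exact: isT | apply: (neq_of _ h); exact: isT].

Section SearchProg.
Variables (n k p tm : nat) (Fb : cube n -> bool) (w : seq bool) (par : nat -> nat).
Notation d := (n + n).
Notation m := (d + k + d).
Notation den := (den Fb w par).
Notation heval := (heval par).
Hypotheses (par_n : par pn = n) (par_S : par pS = 2 ^ k) (par_t : par pt1 = tm.+1).
Variable vs : nat -> cube m.

Lemma vote_spec s (C : {set 'I_n}) (j : 'I_n) :
  has_table Fb s vs tm.+1 -> ar s lj 0 = j -> (forall i : 'I_n, ar s cCA i = (i \in C)) ->
  ar s vP5 0 = 5 * p ^ 2 ->
  ar (den vote_prog s) vvt 0 = \sum_(u < tm.+1) acc p Fb (vs u) j C.
Proof.
move=> sT sj sC sP; rewrite /vote_prog 2!den_seq; set t0 := den _ (den _ s).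
pose K := [:: cRS; cD; cCA; lj; vP5].
have t0c c : c \in K -> ar t0 c = ar s c.
  by move=> h; rewrite /t0 !den_frame //; apply: (notin_of _ h); exact: isT.
have t0v : ar t0 vvt 0 = 0 by [].
have t0g : ar t0 vg 0 = 0 by [].
clearbody t0.
pose I N t := ar t vg 0 = N * (2 ^ k * n) /\ ar t vvt 0 = \sum_(u < N) acc p Fb (vs u) j C.
match goal with |- context [den (HFor lu pt1 ?b) t0] =>
  have H : I (par pt1) (den (HFor lu pt1 b) t0); [apply: (den_for (I := I)) => //|] end.
- by rewrite /I big_ord0.
- move=> u t; rewrite par_t => ut fr _ [Ig Iv]; rewrite 3!den_seq.
  have tc c : c \in K -> ar t c = ar s c.
    by move=> h; rewrite fr ?t0c //; apply: (notin_of _ h); exact: isT.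
  set t1 := den (vng <~ Cst 0) _.
  have t1c c : c \in [:: vg, vvt & K] -> ar t1 c = ar t c.
    by move=> h; rewrite /t1 !den_frame ?ar_setc //; frame_by h.
  have t1p : ar t1 vps 0 = 0 by [].
  have t1n : ar t1 vng 0 = 0 by [].
  clearbody t1; clear fr.
  pose o x := obs Fb (zpt (vs u) (sbit x)) j C.
  pose I1 N t' := [/\ ar t' vg 0 = u * (2 ^ k * n) + N * n,
    ar t' vps 0 = \sum_(x < N) (~~ o x) * (5 * p ^ 2) &
    ar t' vng 0 = \sum_(x < N) (o x) * (5 * p ^ 2)].
  match goal with |- context [den (HFor ls pS ?b) t1] =>
    have H : I1 (par pS) (den (HFor ls pS b) t1); [apply: (den_for (I := I1)) => //|] end.
  + by split; rewrite ?big_ord0 // t1c // Ig addn0.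
  + move=> x t'; rewrite par_S => xS fr' _ [Jg Jp Jn]; rewrite 3!den_seq.
    have t'c c : c \in K -> ar t' c = ar s c.
      move=> h; rewrite fr'; last by apply: (notin_of _ h); exact: isT.
      rewrite t1c ?tc //; by rewrite !inE; move: h; rewrite /K !inE => ->; rewrite !orbT.
    set t2 := den (vx <~ _) _.
    have t2c c : c \in [:: vg, vps, vng & K] -> ar t2 c = ar t' c.
      by move=> h; rewrite /t2 !den_frame ?ar_setc //; frame_by h.
    have t2x : ar t2 vx 0 = res Fb (zpt (vs u) (sbit x)) j.
      rewrite /t2 /= Jg !t'c // sj mulnA -mulnDl.
      by have [] := sT u x j ut xS.
    clearbody t2.
    have [] := @parity_loop n Fb w par li pn vx (Cst 0) (Rd cCA (Sc li)) (Rd cD (HAdd (Sc vg) (Sc li))) t2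
       (res Fb (zpt (vs u) (sbit x)) j)
       (fun i => [exists a : 'I_n, (a == i :> nat) && ((a \in C) && rhalf (zpt (vs u) (sbit x)) a)]) 0 isT isT.
    * move=> i t3; rewrite par_n => iN fr3; split=> //=; rewrite !fr3 // !t2c // Jg !t'c //.
      rewrite (sC (Ordinal iN)) mulnA -mulnDl.
      have [-> _] := sT u x (Ordinal iN) ut xS.
      have -> : [exists a : 'I_n, (a == i :> nat) && ((a \in C) && rhalf (zpt (vs u) (sbit x)) a)] =
         (Ordinal iN \in C) && rhalf (zpt (vs u) (sbit x)) (Ordinal iN).
        apply/existsP/idP => [[a /andP[/eqP ai H]]|H]; last by exists (Ordinal iN); rewrite eqxx.
        by rewrite (_ : Ordinal iN = a) //; apply: val_inj.
      by case: (_ \in C); case: (rhalf _ _).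
    * exact: t2x.
    rewrite par_n; set t3 := den _ t2; set E := (X in nat_of_bool X) => t3x _.
    have {E t3x} t3x : ar t3 vx 0 = o x.
      rewrite t3x /E /o /obs -/(res Fb _ _); congr (nat_of_bool (_ (+) _)).
      rewrite [RHS]big_mkcond /=; apply: eq_bigr => i _.
      apply/existsP/idP => [[a /andP[/eqP ai /andP[aC H]]]|].
        by rewrite (_ : i = a) ?aC //; apply: val_inj.
      by case: ifP => // iC H; exists i; rewrite eqxx iC.
    have t3c c : c \in [:: vg, vps, vng & K] -> ar t3 c = ar t' c.
      by move=> h; rewrite den_frame ?t2c //; apply: (notin_of _ h); exact: isT.
    have t3P : ar t3 vP5 0 = 5 * p ^ 2 by rewrite t3c // t'c.
    clearbody t3; rewrite /I1 !big_ord_recr /= t3x.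
    case: (o x); rewrite /= t3P !t3c // Jg Jp Jn par_n ?mul1n ?mul0n ?addn0; split=> //;
      by rewrite mulSn addnAC addnA.
  case: H; rewrite par_S; set t4 := den _ t1 => h1 h2 h3.
  have t4v : ar t4 vvt 0 = \sum_(u < u) acc p Fb (vs u) j C by rewrite den_frame // t1c.
  clearbody t4; rewrite /I big_ord_recr /=.
  have -> : acc p Fb (vs u) j C = (heval t4 (dblE 8 (Par pS)) <= ar t4 vps 0 - ar t4 vng 0).
    by rewrite heval_dblE h2 h3 /acc /= par_S.
  by case: ifP => h; rewrite /= ?h1 ?t4v ?addn0 ?addn1 mulSn addnC.
by case: H => _ ->; rewrite par_t.
Qed.

Lemma store_loop x y c e1 e2 s (a : nat) (f : nat -> nat) :
  wf (HFor x y (c [ e1 ] <~ e2)) -> x != c ->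
  (forall i t, i < par y -> (forall c', c' \notin [:: x; c] -> ar t c' = ar s c') ->
     heval (setc x 0 i t) e1 = a + i /\ heval (setc x 0 i t) e2 = f i) ->
  let t := den (HFor x y (c [ e1 ] <~ e2)) s in
  (forall i, i < par y -> ar t c (a + i) = f i) /\
  (forall i, i < a -> ar t c i = ar s c i).
Proof.
move=> W xc H.
apply: (den_for (I := fun N t => (forall i, i < N -> ar t c (a + i) = f i) /\
  (forall i, i < a -> ar t c i = ar s c i))) => //; first by case/andP: W.
move=> i t iy fr _ [H1 H2]; have [E1 E2] := H i t iy fr.
have cx : (c == x) = false by rewrite eq_sym; apply/negbTE.
simpl_den; rewrite E1 E2; split=> i' /=; rewrite eqxx cx.
  by rewrite ltnS leq_eqVlt eqn_add2l; case: eqP => [->|_] //=; apply: H1.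
move=> i'a; have ne : (i' == a + i) = false by lia.
by rewrite ne H2.
Qed.

Definition stored (c : nat) (A : seq {set 'I_n}) (t : hst) : Prop :=
  forall e (i : 'I_n), e < size A -> ar t c (e * n + i) = (i \in nth set0 A e).

Lemma try_spec s (P : {set 'I_n}) (j : 'I_n) (b : bool) (A : seq {set 'I_n}) :
  has_table Fb s vs tm.+1 -> ar s lj 0 = j -> ar s vP5 0 = 5 * p ^ 2 ->
  (forall i : 'I_n, ar s cQA (ar s vrp 0 + i) = (i \in P)) ->
  stored cQB A s -> ar s vwp 0 = size A * n -> ar s vcn2 0 = size A ->
  let t := den (try_prog b) s in
  let A' := A ++ [seq C <- [:: setb P j b] | accept p tm Fb vs j C] in
  [/\ stored cQB A' t, ar t vwp 0 = size A' * n & ar t vcn2 0 = size A'].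
Proof.
move=> sT sj sP sQ sA sw sc; rewrite /try_prog 3!den_seq.
pose K := [:: cRS; cD; lj; vP5; cQB; vwp; vcn2].
have [] := @store_loop li pn cCA (Sc li) (Rd cQA (HAdd (Sc vrp) (Sc li))) s 0
  (fun i => ar s cQA (ar s vrp 0 + i)) isT isT.
  by move=> i t ik fr; split=> //=; rewrite !fr.
rewrite par_n; set t1 := den _ s => t1C _.
have t1c c : c \in K -> ar t1 c = ar s c by move=> h; rewrite den_frame //; frame_by h.
clearbody t1; set t2 := den (cCA [ _ ] <~ _) t1.
have t2C (i : 'I_n) : ar t2 cCA i = (i \in setb P j b).
  rewrite /t2 /= t1c // sj inE (t1C _ (ltn_ord i)) sQ; by case: ifP.
have t2c c : c \in K -> ar t2 c = ar s c.
  by move=> h; rewrite den_frame ?t1c //; frame_by h.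
clearbody t2.
have t2T : has_table Fb t2 vs tm.+1 by move=> u x i uN xS; rewrite !t2c //; exact: sT.
have := vote_spec t2T _ t2C _; rewrite !t2c // => /(_ j sj sP).
have F := @den_frame n Fb w par vote_prog t2.
set t3 := den vote_prog t2 in F * => t3v.
have t3C (i : 'I_n) : ar t3 cCA i = (i \in setb P j b) by rewrite F.
have t3c c : c \in K -> ar t3 c = ar s c by move=> h; rewrite F ?t2c //; frame_by h.
clearbody t3; clear F.
have -> : [seq C <- [:: setb P j b] | accept p tm Fb vs j C] =
   if tm.+2 <= ar t3 vvt 0 + ar t3 vvt 0 then [:: setb P j b] else [::].
  by rewrite /= /accept t3v addnn -mul2n.
rewrite -[den _ t3]/(if par pt1 + 1 <= ar t3 vvt 0 + ar t3 vvt 0 then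
   den (HFor li pn (cQB [ HAdd (Sc vwp) (Sc li) ] <~ Rd cCA (Sc li)) ;;
     vwp <~ HAdd (Sc vwp) (Par pn) ;; vcn2 <~ HAdd (Sc vcn2) (Cst 1)) t3 else t3) par_t addn1.
case: ifP => _; last first.
  by rewrite cats0; split; [move=> e i eA; rewrite t3c // sA | rewrite t3c | rewrite t3c].
rewrite 2!den_seq.
have [] := @store_loop li pn cQB (HAdd (Sc vwp) (Sc li)) (Rd cCA (Sc li)) t3 (size A * n)
  (fun i => ar t3 cCA i) isT isT.
  by move=> i t ik fr; split=> //=; rewrite !fr // t3c // sw.
rewrite par_n; set t4 := den _ t3 => h1 h2.
have t4w : ar t4 vwp 0 = size A * n by rewrite den_frame // t3c.
have t4c : ar t4 vcn2 0 = size A by rewrite den_frame // t3c.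
have t4C (i : 'I_n) : ar t4 cCA i = (i \in setb P j b) by rewrite den_frame.
clearbody t4; rewrite /stored size_cat /= addn1; split; last 2 first.
- by rewrite t4w par_n mulSn addnC.
- by rewrite t4c addn1.
move=> e i; rewrite ltnS leq_eqVlt nth_cat /=; case: (eqVneq e (size A)) => [->|eA] /=.
  by rewrite ltnn subnn /= h1 // t3C.
move=> eA'; rewrite eA' h2; last first.
  have := leq_mul eA' (leqnn n); rewrite mulSn; have := ltn_ord i; lia.
by rewrite t3c // sA.
Qed.

Definition level_inv (j : nat) (t : hst) : Prop :=
  [/\ has_table Fb t vs tm.+1, ar t vP5 0 = 5 * p ^ 2, ar t vcnt 0 = size (level p tm Fb vs j) &
      stored cQA (level p tm Fb vs j) t].

Lemma size_level j : size (level p tm Fb vs j) <= 2 ^ k.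
Proof.
by case: j => [|j] /=; rewrite ?expn_gt0 // size_take_min geq_minl.
Qed.

Lemma level_spec s (j : 'I_n) : level_inv j s -> ar s lj 0 = j -> level_inv j.+1 (den level_prog s).
Proof.
move=> [sT sP sC sQ] sj; rewrite /level_prog 3!den_seq; set t0 := den _ (den _ (den _ s)).
pose K := [:: cRS; cD; lj; vP5; cQA; vcnt].
have t0c c : c \in K -> ar t0 c = ar s c.
  by move=> h; rewrite /t0 !den_frame //; frame_by h.
have t0w : ar t0 vwp 0 = 0 by [].
have t0n : ar t0 vcn2 0 = 0 by [].
have t0r : ar t0 vrp 0 = 0 by [].
clearbody t0; set L := level p tm Fb vs j in sC sQ.
have sL : size L <= 2 ^ k by exact: size_level.
pose cand M := [seq C <- [seq setb P j b | P <- M, b <- [:: false; true]] | accept p tm Fb vs j C].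
pose I N t := [/\ stored cQB (cand (take N L)) t, ar t vwp 0 = size (cand (take N L)) * n,
   ar t vcn2 0 = size (cand (take N L)) & ar t vrp 0 = minn N (size L) * n].
rewrite den_seq; set t1 := den _ t0.
have : I (2 ^ k) t1.
  rewrite -par_S; apply: (den_for (I := I)) => //.
    by rewrite /I take0 /cand /= t0w t0n t0r min0n; split.
  move=> N t NS fr _ [I1 I2 I3 I4].
  have tc c : c \in K -> ar t c = ar s c.
    by move=> h; rewrite fr ?t0c //; frame_by h.
  clear fr; set t' := setc lb 0 N t.
  rewrite -[den _ t']/(if N + 1 <= ar t vcnt 0 then
     den (try_prog 0 ;; try_prog 1 ;; vrp <~ HAdd (Sc vrp) (Par pn)) t' else t') tc // sC addn1.
  case: (ltnP N (size L)) => NL; last first.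
    rewrite /I (take_oversize (leqW NL)) (minn_idPr (leqW NL)).
    by move: I1 I2 I3 I4; rewrite (take_oversize NL) (minn_idPr NL) => *; split.
  have t'c c : c \in K -> ar t' c = ar s c.
    by move=> h; rewrite ar_setc ?tc //; frame_by h.
  have t'T : has_table Fb t' vs tm.+1 by move=> u x i uN xS; rewrite !t'c //; exact: sT.
  have t'Q (i : 'I_n) : ar t' cQA (ar t' vrp 0 + i) = (i \in nth set0 L N).
    by rewrite t'c // /t' /= I4 (minn_idPl (ltnW NL)) sQ.
  have [] := @try_spec t' (nth set0 L N) j false _ t'T _ _ t'Q I1 I2 I3; rewrite ?t'c //.
  have F1 := @den_frame n Fb w par (try_prog 0) t'.
  rewrite 2!den_seq; set t2 := den (try_prog 0) t' in F1 * => J1 J2 J3.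
  have t2c c : c \in K -> ar t2 c = ar s c by move=> h; rewrite F1 ?t'c //; frame_by h.
  have t2r : ar t2 vrp 0 = N * n by rewrite F1 //= I4 (minn_idPl (ltnW NL)).
  clearbody t2; clear F1.
  have t2T : has_table Fb t2 vs tm.+1 by move=> u x i uN xS; rewrite !t2c //; exact: sT.
  have t2Q (i : 'I_n) : ar t2 cQA (ar t2 vrp 0 + i) = (i \in nth set0 L N).
    by rewrite t2c // t2r sQ.
  have [] := @try_spec t2 (nth set0 L N) j true _ t2T _ _ t2Q J1 J2 J3; rewrite ?t2c //.
  have F2 := @den_frame n Fb w par (try_prog 1) t2.
  set t3 := den (try_prog 1) t2 in F2 * => G1 G2 G3.
  have t3r : ar t3 vrp 0 = N * n by rewrite F2.
  clearbody t3; clear F2.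
  have E : cand (take N.+1 L) = (cand (take N L) ++ [seq C <- [:: setb (nth set0 L N) j false] | accept p tm Fb vs j C]) ++
        [seq C <- [:: setb (nth set0 L N) j true] | accept p tm Fb vs j C].
    rewrite (take_nth set0 NL) -cats1 /cand allpairs_cat filter_cat -catA; congr (_ ++ _).
    by rewrite -filter_cat.
  rewrite /I E; split=> //.
  by rewrite /= t3r par_n (minn_idPl NL) mulSn addnC.
rewrite /I take_oversize // => -[I1 _ I3 _].
have t1c c : c \in K -> ar t1 c = ar s c by move=> h; rewrite den_frame ?t0c //; frame_by h.
clearbody t1; rewrite 2!den_seq; set t2 := den _ t1; set A := cand L in I1 I3.
have t2x : ar t2 vx 0 = 0 by [].
have t2B c : c \in [:: cQB, vcn2 & K] -> ar t2 c = ar t1 c.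
  by move=> h; rewrite den_frame //; frame_by h.
clearbody t2.
pose I' N t := ar t vx 0 = N * n /\ forall x, x < N * n -> ar t cQA x = ar t1 cQB x.
set t3 := den _ t2.
have : I' (2 ^ k) t3.
  rewrite -par_S; apply: (den_for (I := I')) => //.
  move=> N t NS fr _ [H1 H2]; set t' := setc lb 0 N t.
  pose I2 M t := ar t vx 0 = N * n + M /\ forall x, x < N * n + M -> ar t cQA x = ar t1 cQB x.
  have : I2 (par pn) (den (HFor li pn (cQA [ Sc vx ] <~ Rd cQB (Sc vx) ;; vx <~ HAdd (Sc vx) (Cst 1))) t').
    apply: (den_for (I := I2)) => //.
      by rewrite /I2 addn0.
    move=> M t4 Mn fr4 _ [H3 H4]; split; first by rewrite /= H3; lia.
    move=> x; rewrite addnS ltnS leq_eqVlt /= H3; case: eqP => [->|_] /=; last exact: H4.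
    by rewrite fr4 //= fr // t2B.
  by rewrite /I2 /I' par_n => -[H3 H4]; rewrite mulSn addnC.
move=> [_ H3].
have t3c c : c \in [:: cRS; cD; vP5; lj] -> ar t3 c = ar s c.
  move=> h; rewrite den_frame; last by frame_by h.
  by rewrite t2B ?t1c //; move: h; rewrite !inE => /or4P[]/eqP->.
have t3n : ar t3 vcn2 0 = size A by rewrite den_frame // t2B.
have AE : level p tm Fb vs j.+1 = take (2 ^ k) A by [].
clearbody t3; set t5 := den _ t3.
have t5c c : c \in [:: cRS; cD; vP5; lj; cQA] -> ar t5 c = ar t3 c.
  by move=> h; rewrite den_frame //; frame_by h.
have t5n : ar t5 vcnt 0 = size (take (2 ^ k) A).
  rewrite /t5 /= t3n par_S size_take_min; case: (leqP (2 ^ k) (size A)) => h //=.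
split.
- by move=> u x i uN xS; rewrite !t5c // !t3c //; exact: sT.
- by rewrite t5c // t3c.
- by rewrite t5n.
move=> e i; rewrite AE size_take_min leq_min => /andP[eS eA].
rewrite t5c // H3; last first.
  have := leq_mul eS (leqnn n); rewrite mulSn; have := ltn_ord i; lia.
by rewrite I1 // nth_take.
Qed.

Lemma search_spec s : has_table Fb s vs tm.+1 -> ar s vP5 0 = 5 * p ^ 2 ->
  (forall i, ar s cQA i = 0) -> level_inv n (den search_prog s).
Proof.
move=> sT sP sQ; rewrite /search_prog den_seq; set s1 := den _ s.
suff : level_inv (par pn) (den (HFor lj pn level_prog) s1) by rewrite par_n.
apply: (den_for (I := level_inv)) => //.
  by split=> // e i; rewrite ltnS leqn0 => /eqP -> /=; rewrite sQ inE.
move=> j t; rewrite par_n => jn _ _ [h1 h2 h3 h4].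
exact: (@level_spec _ (Ordinal jn)).
Qed.

End SearchProg.

(** Logarithms are found by repeated doubling or tripling in loops whose number of rounds, p or n,
    is a crude upper bound; a guard stops the growth. The 18 in the last test makes n >= 10 whenever
    coins are used, so that constants can be absorbed into ln n in the coin bound; it costs at most
    a factor 2^18 in the sample size. *)
Definition prep_prog : hcmd :=
  vk <~ Cst 0 ;; vS <~ Cst 1 ;; vpow <~ Cst 1 ;;
  HFor li pp (HIf (HAdd (Sc vpow) (Cst 1)) (Par pp)
    (vpow <~ HAdd (Sc vpow) (Sc vpow) ;; vS <~ dblE 6 (Sc vS) ;; vk <~ HAdd (Sc vk) (Cst 6)) HSkip) ;;
  vS4 <~ Cst 1 ;;
  HFor li pn (vS4 <~ dblE 2 (Sc vS4)) ;;
  vpow <~ Cst 8 ;; ve <~ Cst 3 ;;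
  HFor li pn (HIf (HAdd (Sc vpow) (Cst 1)) (dblE 3 (Par pn))
    (vpow <~ HAdd (Sc vpow) (Sc vpow) ;; ve <~ HAdd (Sc ve) (Cst 1)) HSkip) ;;
  vh <~ Cst 3 ;;
  HFor li pn (HIf (HAdd (dblE 1 (Sc vh)) (Cst 1)) (HAdd (Sc ve) (Cst 5))
    (vh <~ HAdd (Sc vh) (dblE 1 (Sc vh))) HSkip) ;;
  vP5 <~ Cst 0 ;;
  HFor li pp (vP5 <~ HAdd (Sc vP5) (HAdd (Par pp) (dblE 2 (Par pp)))) ;;
  vmf <~ HAdd (dblE 2 (Par pn)) (Sc vk) ;;
  vtm <~ Par pt0 ;;
  HIf (dblE 1 (Par pn)) (HAdd (Sc vk) (Cst 18))
    (vk <~ dblE 1 (Par pn) ;; vS <~ Sc vS4 ;; vmf <~ Cst 0 ;; vtm <~ Cst 0) HSkip.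

(* 2^E is about 8 / theta, 2^e about 8 n, and 3^a is of the order of e. *)
Definition dims (n p E e a : nat) : Prop :=
  [/\ p <= 2 ^ E, 2 ^ E < 2 * p, 8 * n <= 2 ^ e, 2 ^ e < 16 * n &
      e + 5 <= 2 * 3 ^ a /\ (a = 1 \/ 2 * 3 ^ a < 3 * (e + 5))].

(** Time and coins are bounded in terms of dimensions chosen before the oracle is known; uniqueness
    identifies these with what the program computes. Each power is confined to a range of ratio 2 or
    3, except that the tripling starts at a = 1. *)
Lemma dims_unique n p E e a E' e' a' : dims n p E e a -> dims n p E' e' a' ->
  [/\ E = E', e = e' & a = a'].
Proof.
move=> [h1 h2 h3 h4 [h5 h6]] [g1 g2 g3 g4 [g5 g6]].
have u b x y : 1 < b -> b ^ x < b ^ y.+1 -> b ^ y < b ^ x.+1 -> x = y.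
  by move=> b1; rewrite !ltn_exp2l // => *; lia.
have eE : E = E' by apply: (u 2) => //; rewrite expnS; lia.
have ee : e = e' by apply: (u 2) => //; rewrite expnS; lia.
split=> //; subst e'; apply: (u 3) => //; rewrite expnS.
  by case: h6 => [->|]; [have : 0 < 3 ^ a' by rewrite expn_gt0 |]; lia.
by case: g6 => [->|]; [have : 0 < 3 ^ a by rewrite expn_gt0 |]; lia.
Qed.

Section Prep.
Variables (n : nat) (Fb : cube n -> bool) (w : seq bool) (par : nat -> nat).
Notation den := (den Fb w par).
Notation heval := (heval par).

Lemma for_scalars (I : nat -> hst -> Prop) x y p s :
  wf p -> I 0 s ->
  (forall i t, i < par y -> I i t -> I i.+1 (den p (setc x 0 i t))) ->
  I (par y) (den (HFor x y p) s).
Proof. by move=> W I0 IS; apply: den_for => // i t iy _ _; exact: IS. Qed.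

Definition prep_result (p tm E a : nat) (t : hst) : Prop :=
  [/\ ar t vh 0 = 3 ^ a, ar t vP5 0 = 5 * p ^ 2 &
    if 2 * n <= 6 * E + 18 then
      [/\ ar t vk 0 = 2 * n, ar t vS 0 = 2 ^ (2 * n), ar t vmf 0 = 0 & ar t vtm 0 = 0]
    else [/\ ar t vk 0 = 6 * E, ar t vS 0 = 2 ^ (6 * E),
             ar t vmf 0 = 4 * n + 6 * E & ar t vtm 0 = tm]].

Lemma prep_spec s p tm : 0 < n -> 0 < p -> par pn = n -> par pp = p -> par pt0 = tm ->
  exists E e a, dims n p E e a /\ prep_result p tm E a (den prep_prog s).
Proof.
move=> n0 p0 par_n par_p par_t; rewrite /prep_prog.
rewrite 3!den_seq; set t0 := den _ (den _ (den _ s)).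
have t0k : [/\ ar t0 vk 0 = 0, ar t0 vS 0 = 1 & ar t0 vpow 0 = 1] by [].
clearbody t0; rewrite den_seq; set t1 := den _ t0.
have [E [Ek ES Ep]] : exists E, [/\ ar t1 vk 0 = 6 * E, ar t1 vS 0 = 2 ^ (6 * E) & p <= 2 ^ E < 2 * p].
  pose I N t := exists E, [/\ ar t vk 0 = 6 * E /\ ar t vS 0 = 2 ^ (6 * E), ar t vpow 0 = 2 ^ E,
     2 ^ E < 2 * p & E = N \/ p <= 2 ^ E].
  have : I (par pp) t1.
    apply: (for_scalars (I := I)) => //.
      by case: t0k => h1 h2 h3; exists 0; split=> //; [lia | left].
    move=> i t ip [E [[h1 h2] h3 h4 h5]].
    rewrite /I /= h3 par_p addn1; case: ltnP => h /=; last by exists E; split=> //; right.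
    exists E.+1; rewrite h1 h2 mulnS expnD -[2 ^ 6]/64 expnS; split; try by lia.
  rewrite par_p => -[E [[h1 h2] _ h3 h4]]; exists E; split=> //; rewrite h3 andbT.
  by case: h4 => [->|//]; exact/ltnW/ltn_expl.
clearbody t1; rewrite den_seq; set t2 := den _ t1.
have t2c c : c \in [:: vk; vS] -> ar t2 c = ar t1 c by move=> h; rewrite den_frame //; frame_by h.
have t24 : ar t2 vS4 0 = 1 by [].
clearbody t2; rewrite den_seq; set t3 := den _ t2.
have t3c c : c \in [:: vk; vS] -> ar t3 c = ar t1 c.
  by move=> h; rewrite den_frame ?t2c //; frame_by h.
have t34 : ar t3 vS4 0 = 2 ^ (2 * n).
  have : ar t3 vS4 0 = 2 ^ (2 * par pn); last by rewrite par_n.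
  apply: (for_scalars (I := fun N t => ar t vS4 0 = 2 ^ (2 * N))) => //.
  by move=> i t _ IH; rewrite /= IH mulnS expnD; lia.
clearbody t3; rewrite 2!den_seq; set t4 := den _ (den _ t3).
have t4c c : c \in [:: vk; vS; vS4] -> ar t4 c = ar t3 c.
  by move=> h; rewrite !den_frame //; frame_by h.
have [t4p t4e] : ar t4 vpow 0 = 8 /\ ar t4 ve 0 = 3 by [].
clearbody t4; rewrite den_seq; set t5 := den _ t4.
have t5c c : c \in [:: vk; vS; vS4] -> ar t5 c = ar t3 c.
  by move=> h; rewrite !den_frame ?t4c //; frame_by h.
have [e [e1 e2 e3]] : exists e, [/\ ar t5 ve 0 = e, 8 * n <= 2 ^ e < 16 * n & e <= n + 3].
  pose I N t := exists e, [/\ ar t ve 0 = e, ar t vpow 0 = 2 ^ e, 2 ^ e < 16 * n,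
      e <= N + 3 & e = N + 3 \/ 8 * n <= 2 ^ e].
  have : I (par pn) t5.
    apply: (for_scalars (I := I)) => //.
      by exists 3; split=> //; [lia | left].
    move=> i t _ [e [h1 h2 h3 h4 h5]].
    rewrite /I /= h2 par_n addn1; case: ltnP => h /=.
      exists e.+1; rewrite h1 expnS; split; try lia.
    by exists e; split=> //; [lia | right; lia].
  rewrite par_n => -[e [h1 _ h3 h4 h5]]; exists e; split=> //; rewrite h3 andbT.
  case: h5 => // ->; rewrite expnD mulnC leq_mul2r; apply/orP; right; exact/ltnW/ltn_expl.
clearbody t5; rewrite den_seq; set t6 := den _ t5.
have t6c c : c \in [:: vk; vS; vS4] -> ar t6 c = ar t3 c.
  by move=> h; rewrite !den_frame ?t5c //; frame_by h.
have t6e : ar t6 ve 0 = e by rewrite den_frame.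
have t6h : ar t6 vh 0 = 3 by [].
clearbody t6; rewrite den_seq; set t7 := den _ t6.
have t7c c : c \in [:: vk; vS; vS4] -> ar t7 c = ar t3 c.
  by move=> h; rewrite !den_frame ?t6c //; frame_by h.
have [a [a1 a2 a3]] : exists a, [/\ ar t7 vh 0 = 3 ^ a, e + 5 <= 2 * 3 ^ a &
    a = 1 \/ 2 * 3 ^ a < 3 * (e + 5)].
  pose I N t := exists a, [/\ ar t ve 0 = e, ar t vh 0 = 3 ^ a,
     a = 1 \/ 2 * 3 ^ a < 3 * (e + 5) & a = N.+1 \/ e + 5 <= 2 * 3 ^ a].
  have : I (par pn) t7.
    apply: (for_scalars (I := I)) => //.
      by exists 1; split=> //; left.
    move=> i t _ [a [h1 h2 h3 h4]].
    rewrite /I /= h2 h1 addn1; case: ltnP => h /=.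
      exists a.+1; rewrite h1 expnS; split=> //; [lia | right; lia |].
      by case: h4 => ?; [left; lia | right; lia].
    by exists a; split=> //; right; lia.
  rewrite par_n => -[a [_ h2 h3 h4]]; exists a; split=> //.
  case: h4 => // ->; rewrite expnS; have := ltn_expl n (isT : 1 < 3); lia.
clearbody t7; rewrite den_seq; set t8 := den _ t7.
have t8c c : c \in [:: vh; vk; vS; vS4] -> ar t8 c = ar t7 c.
  by move=> h; rewrite !den_frame //; frame_by h.
have t85 : ar t8 vP5 0 = 0 by [].
clearbody t8; rewrite den_seq; set t9 := den _ t8.
have t9c c : c \in [:: vh; vk; vS; vS4] -> ar t9 c = ar t7 c.
  by move=> h; rewrite !den_frame ?t8c //; frame_by h.
have t95 : ar t9 vP5 0 = 5 * p ^ 2.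
  have : ar t9 vP5 0 = par pp * (5 * p); last by rewrite par_p; lia.
  apply: (for_scalars (I := fun N t => ar t vP5 0 = N * (5 * p))) => //.
  by move=> i t _ IH; rewrite /= IH par_p; lia.
clearbody t9; exists E, e, a; move/andP: Ep => [Ep Ep']; move/andP: e2 => [e2 e2']; split=> //.
rewrite /prep_result /= par_n par_t !(t9c vk) // !(t7c vk) // !(t3c vk) // Ek.
have -> : (n + n <= 6 * E + 18) = (2 * n <= 6 * E + 18) by rewrite mul2n addnn.
case: ifP => h /=; rewrite !(t9c vh) // a1 t95.
  by rewrite !(t9c vS4) // !(t7c vS4) // t34; split=> //; split=> //; lia.
rewrite !(t9c vS) // !(t7c vS) // !(t3c vS) // ES !(t9c vk) // !(t7c vk) // !(t3c vk) // Ek.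
by split=> //; split=> //; lia.
Qed.

End Prep.

(* The output is prepared at the indices from S n on, beyond the registers that
   the final list will occupy. *)
Definition final_prog : hcmd :=
  voff <~ Cst 0 ;;
  HFor lb pS (HFor li pn (voff <~ HAdd (Sc voff) (Cst 1))) ;;
  vx <~ Cst 0 ;;
  HFor lb pS (HFor li pn (
    cOut [ HAdd (Sc voff) (Sc vx) ] <~ Rd cQA (Sc vx) ;; vx <~ HAdd (Sc vx) (Cst 1))) ;;
  vz <~ Cst 0 ;;
  HFor lb pS (HIf (HAdd (Sc lb) (Cst 1)) (Sc vcnt) (vz <~ HAdd (Sc vz) (Par pn)) HSkip) ;;
  cLen [ Sc voff ] <~ Sc vz ;;
  cNum [ Sc voff ] <~ Sc vcnt.

Section Final.
Variables (n S : nat) (Fb : cube n -> bool) (w : seq bool) (par : nat -> nat).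
Notation den := (den Fb w par).
Notation heval := (heval par).
Hypotheses (par_n : par pn = n) (par_S : par pS = S).

Lemma final_spec s c : ar s vcnt 0 = c -> c <= S -> (forall i, ar s cIdx i = 0) ->
  let t := den final_prog s in
  [/\ ar t voff 0 = S * n, forall x, x < S * n -> ar t cOut (S * n + x) = ar s cQA x,
      ar t cLen (S * n) = c * n, ar t cNum (S * n) = c & ar t cIdx (S * n) = 0].
Proof.
move=> sc cS sI; rewrite /final_prog 2!den_seq; set t1 := den _ (den _ s).
have t1o : ar t1 voff 0 = S * n.
  rewrite -par_S; apply: (for_scalars (I := fun N t => ar t voff 0 = N * n)) => //.
  move=> N t _ IH; rewrite mulSn addnC -[X in _ + X]par_n.
  apply: (for_scalars (I := fun M t => ar t voff 0 = N * n + M)) => //; first by rewrite /= IH addn0.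
  by move=> M t' _ IH'; rewrite /= IH' addn1 addnS.
have t1c c' : c' \in [:: vcnt; cQA; cIdx] -> ar t1 c' = ar s c'.
  by move=> h; rewrite !den_frame //; frame_by h.
clearbody t1; rewrite 2!den_seq; set t2 := den _ (den _ t1).
have [_ t2O] : ar t2 vx 0 = S * n /\ forall x, x < S * n -> ar t2 cOut (S * n + x) = ar s cQA x.
  pose I N t := ar t vx 0 = N * n /\ forall x, x < N * n -> ar t cOut (S * n + x) = ar s cQA x.
  suff : I (par pS) t2 by rewrite par_S.
  apply: (den_for (I := I)) => //.
  move=> N t _ fr _ [H1 H2]; set t' := setc lb 0 N t.
  pose I2 M t := ar t vx 0 = N * n + M /\
    forall x, x < N * n + M -> ar t cOut (S * n + x) = ar s cQA x.
  match goal with |- I N.+1 (den ?P t') => have : I2 (par pn) (den P t') end.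
    apply: (den_for (I := I2)) => //; first by rewrite /I2 addn0.
    move=> M t3 _ fr3 _ [H3 H4].
    have t3o : ar t3 voff 0 = S * n by rewrite fr3 //= fr.
    split; first by rewrite /= H3 addn1 addnS.
    move=> x; rewrite addnS ltnS leq_eqVlt /= H3 t3o eqn_add2l.
    case: eqP => [->|_] /=; last exact: H4.
    by rewrite fr3 //= fr //= t1c.
  by rewrite /I2 /I par_n mulSn addnC.
have t2o : ar t2 voff 0 = S * n by rewrite !den_frame.
have t2c c' : c' \in [:: vcnt; cIdx] -> ar t2 c' = ar s c'.
  move=> h; rewrite !den_frame ?t1c //; try frame_by h.
  by move: h; rewrite !inE => /orP[]/eqP->.
clearbody t2; rewrite 2!den_seq; set t4 := den _ (den _ t2).
have t4z : ar t4 vz 0 = c * n.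
  have : ar t4 vz 0 = minn (par pS) c * n; last by rewrite par_S (minn_idPr cS).
  apply: (den_for (I := fun N t => ar t vz 0 = minn N c * n)) => //; first by rewrite min0n.
  move=> N t _ fr _ IH; rewrite /= addn1 fr //= t2c // sc.
  case: ltnP => h /=; first by rewrite IH par_n (minn_idPl h) (minn_idPl (ltnW h)) mulSn addnC.
  by rewrite IH (minn_idPr h) (minn_idPr (leqW h)).
have t4o : ar t4 voff 0 = S * n by rewrite !den_frame.
have t4c c' : c' \in [:: vcnt; cIdx] -> ar t4 c' = ar s c'.
  by move=> h; rewrite !den_frame ?t2c //; frame_by h.
have t4O x : x < S * n -> ar t4 cOut (S * n + x) = ar s cQA x by move=> h; rewrite !den_frame ?t2O.
have t4n : ar t4 vcnt 0 = c by rewrite t4c.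
have t4I : ar t4 cIdx (S * n) = 0 by rewrite t4c.
by clearbody t4; rewrite /= t4o ?eqxx t4z t4n; split.
Qed.

End Final.

(** * Output of the list, and the search for the parameters *)

Definition rdc (c : nat) : expr := Fetch (cellE c (Const 0)).

(* Increasing M[0], the base address of all arrays, by 64 voff turns entry voff
   into entry 0 and makes room for the list below. *)
Definition output_cmd : command :=
  Seq (Store (Const 0) (Add (Fetch (Const 0)) (mulK (rdc voff))))
  (Seq (While (Le (Add (rdc cIdx) (Const 1)) (rdc cLen))
          (Seq (Store (Add (Const 1) (rdc cIdx)) (Fetch (cellE cOut (rdc cIdx))))
               (Store (cellE cIdx (Const 0)) (Add (rdc cIdx) (Const 1)))))
       (Store (Const 0) (rdc cNum))).

Definition updp (par : nat -> nat) (y v : nat) : nat -> nat :=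
  fun y' => if y' == y then v else par y'.

Definition setpar (y : nat) (e : hexpr) : command := Store (cellE 62 (Const y)) (cexp e).

Section Raw.
Variables (R : realType) (n : nat) (F : cube n -> int) (delta theta : R) (w : seq bool).
Notation runs := (runs F delta theta w).

Lemma rep_setpar par M s y v : rep n par M s ->
  rep n (updp par y v) (update M (adr n 62 y) v) s.
Proof.
move=> [M0 Mc Mp]; split=> [|c' i' h'|y'].
- by rewrite update_other.
- rewrite update_adr //; last by lia.
  have ne : (c' == 62) = false by lia.
  by rewrite ne Mc.
by rewrite update_adr // eqxx /updp /=; case: eqP.
Qed.

Lemma runs_setpar par M s y e i q : rep n par M s -> ewf e ->
  exists2 M', runs (setpar y e) M i q M' i q 1 & rep n (updp par y (heval par s e)) M' s.
Proof.
move=> r he; have [M0 _ _] := r; exists (update M (adr n 62 y) (heval par s e)).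
  have -> : update M (adr n 62 y) (heval par s e) =
      update M (eval M (cellE 62 (Const y))) (eval M (cexp e)).
    by rewrite (eval_cexp r he) eval_cellE M0.
  exact: runs_store.
exact: rep_setpar.
Qed.

Lemma rep_ext par par' M s : par =1 par' -> rep n par M s -> rep n par' M s.
Proof. by move=> E [h1 h2 h3]; split=> // y; rewrite -E. Qed.

Lemma eval_rdc M c : eval M (rdc c) = M (adr (M 0) c 0).
Proof. by rewrite -[0 in RHS]/(eval M (Const 0)) -eval_cellE. Qed.

Local Opaque mulK rdc cellE parE cntE.

(** The condition N <= off keeps the registers M[1], ..., M[N] of the list below the new base
    address n + 64 off, so writing them does not destroy the arrays still to be read. *)
Lemma runs_output par M s off N i q : rep n par M s ->
  ar s voff 0 = off -> ar s cLen off = N -> N <= off -> ar s cIdx off = 0 ->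
  exists2 M', runs output_cmd M i q M' i q (4 * N + 5) &
    M' 0 = ar s cNum off /\ forall x, x < N -> M' x.+1 = ar s cOut (off + x).
Proof.
move=> [M0 Mc Mp] so sN No sI.
set M1 := update M 0 (n + 64 * off).
have E1 : M1 = update M (eval M (Const 0)) (eval M (Add (Fetch (Const 0)) (mulK (rdc voff)))).
  by rewrite /= eval_mulK eval_rdc M0 Mc // so.
set b := n + 64 * off.
have M1c c j : c < 62 -> M1 (adr b c j) = ar s c (off + j).
  by move=> hc; rewrite -Mc // /M1 /update /adr /b; case: eqP => [|_]; [lia | congr M; lia].
have W r j M2 : j + r = N -> M2 0 = b -> M2 (adr b cIdx 0) = j ->
    (forall c x, c \in [:: cOut; cLen; cNum] -> M2 (adr b c x) = ar s c (off + x)) ->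
    (forall x, x < j -> M2 x.+1 = ar s cOut (off + x)) ->
  exists2 M', runs (While (Le (Add (rdc cIdx) (Const 1)) (rdc cLen))
          (Seq (Store (Add (Const 1) (rdc cIdx)) (Fetch (cellE cOut (rdc cIdx))))
               (Store (cellE cIdx (Const 0)) (Add (rdc cIdx) (Const 1))))) M2 i q M' i q (4 * r + 1) &
    [/\ M' 0 = b, M' (adr b cNum 0) = ar s cNum off & forall x, x < N -> M' x.+1 = ar s cOut (off + x)].
  elim: r j M2 => [|r IH] j M2 jr h0 hi hc hx.
    exists M2; first by apply: runs_while0; rewrite /= !eval_rdc h0 hi hc // addn0 sN addn1; apply/negbTE; lia.
    by split; rewrite ?hc ?addn0 // => x xN; apply: hx; lia.
  set M3 := update M2 j.+1 (ar s cOut (off + j)).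
  have E3 : M3 = update M2 (eval M2 (Add (Const 1) (rdc cIdx))) (eval M2 (Fetch (cellE cOut (rdc cIdx)))).
    by rewrite /= eval_cellE !eval_rdc h0 hi hc.
  have M3b c x : M3 (adr b c x) = M2 (adr b c x).
    by rewrite /M3 /update /adr /b; case: eqP => //; lia.
  have M30 : M3 0 = b by [].
  set M4 := update M3 (adr b cIdx 0) j.+1.
  have E4 : M4 = update M3 (eval M3 (cellE cIdx (Const 0))) (eval M3 (Add (rdc cIdx) (Const 1))).
    by rewrite /= eval_cellE eval_rdc M30 M3b hi addn1.
  have M40 : M4 0 = b by rewrite /M4 update_other.
  have [||||M' h1 h2] := IH j.+1 M4 _ M40; first lia.
  - by rewrite /M4 update_adr.
  - move=> c x hc'; rewrite /M4 update_adr // ?M3b ?hc //; last by move: hc'; rewrite !inE => /or3P[]/eqP->.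
    by move: hc'; rewrite !inE => /or3P[]/eqP->.
  - move=> x xj; rewrite /M4 update_other; last by rewrite /b; lia.
    by rewrite /M3 /update; case: eqP => [[->]|ne] //; apply: hx; lia.
  exists M' => //.
  have T : eval_test delta theta M2 (Le (Add (rdc cIdx) (Const 1)) (rdc cLen)).
    by rewrite /= !eval_rdc h0 hi hc // addn0 sN; lia.
  rewrite E4 in h1; have := runs_store F delta theta w (cellE cIdx (Const 0)) (Add (rdc cIdx) (Const 1)) M3 i q.
  rewrite {1}E3 => hs.
  by apply: runs_le (runs_whileS T (runs_seq (runs_store _ _ _ _ _ _ _ _ _) hs) h1); lia.
have [||//|M' h1 [h2 h3 h4]] := W N 0 M1 (add0n _) (erefl _).
- by rewrite M1c // addn0.
- by move=> c x hc; apply: M1c; move: hc; rewrite !inE => /or3P[]/eqP->.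
have E5 : eval M' (rdc cNum) = ar s cNum off by rewrite eval_rdc h2 h3.
exists (update M' 0 (ar s cNum off)).
  rewrite E1 in h1; rewrite -{1}E5.
  by apply: runs_le (runs_seq (runs_store _ _ _ _ _ _ _ _ _) (runs_seq h1 (runs_store _ _ _ _ _ _ _ _ _))); lia.
by split=> // x xN; rewrite /update /= h4.
Qed.

End Raw.

Definition flag_loop (body : command) : command := While (Le (cexp (Sc vfl)) (Const 0)) body.

(* p is the least number with 8 <= p theta, and pt0 the least t with
   n <= 2^(t+1) delta. *)
Definition psearch : command :=
  flag_loop (If (LeTheta (Const 8) (cexp (Par pp)))
    (ccmd 0 (vfl <~ Cst 1)) (setpar pp (HAdd (Par pp) (Cst 1)))).

Definition tsearch : command :=
  Seq (ccmd 0 (vfl <~ Cst 0 ;; vpow <~ Cst 2))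
  (flag_loop (If (LeDelta (cexp (Par pn)) (cexp (Sc vpow)))
    (ccmd 0 (vfl <~ Cst 1))
    (Seq (ccmd 0 (vpow <~ HAdd (Sc vpow) (Sc vpow))) (setpar pt0 (HAdd (Par pt0) (Cst 1)))))).

Definition setdims : command :=
  foldr (fun ye c => Seq (setpar ye.1 ye.2) c) Skip
    [:: (pk, Sc vk); (pS, Sc vS); (pm, HAdd (dblE 2 (Par pn)) (Sc vk));
        (pq, HAdd (Sc vh) (dblE 1 (Sc vh))); (pmf, Sc vmf); (ptm, Sc vtm);
        (pd, dblE 1 (Par pn)); (pt1, HAdd (Sc vtm) (Cst 1))].

Definition main_prog : hcmd := table_prog ;; search_prog ;; final_prog.

Definition program : command :=
  Seq (Store (cellE 62 (Const pn)) (Fetch (Const 0)))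
  (Seq psearch (Seq tsearch (Seq (ccmd 0 prep_prog) (Seq setdims
  (Seq (ccmd 0 main_prog) output_cmd))))).

Section Params.
Variables (n p tm E a : nat).
(* In this case all points of F_2^(2n) are used. *)
Definition exact : bool := 2 * n <= 6 * E + 18.
Definition dim_k : nat := if exact then 2 * n else 6 * E.
Definition dim_m : nat := n + n + dim_k + (n + n).
Definition dim_q : nat := 3 ^ a.+1.
Definition dim_f : nat := if exact then 0 else dim_m.
Definition dim_t : nat := if exact then 0 else tm.

Definition par_prep : nat -> nat := fun y =>
  match y with 0 => n | 1 => p | 2 => tm | _ => 0 end.

Definition par_main : nat -> nat := fun y =>
  match y with
  | 0 => n | 1 => p | 2 => tm | 3 => dim_k | 4 => 2 ^ dim_k | 5 => dim_m | 6 => dim_q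
  | 7 => dim_f | 8 => dim_t | 9 => n + n | 10 => dim_t.+1 | _ => 0
  end.

(** Either [dim_f] is 0 and this is the unit vector of [zpt_exact], or [dim_f] is the full dimension
    and all coordinates are coins. *)
Definition seed0 (w : seq bool) : cube dim_m :=
  [ffun i : 'I_dim_m => if i < dim_f then nth false w i else i == (n + n).-1 :> nat].

Definition seeds (w : seq bool) : nat -> cube dim_m :=
  vert (@gen dim_q dim_m) (seed0 w) w dim_f.

Definition time_bound : nat :=
  1 + (1 + (1 + ((p + 1) * 3 + 1) + (1 + (1 + 3 + ((tm + 1) * 6 + 1)) +
   (1 + cost par_prep prep_prog + (1 + 17 + (1 + cost par_main main_prog +
   (4 * (2 ^ dim_k * n) + 5))))))) + 10.

Definition coin_count : nat := dim_f + dim_t * (dim_q + dim_q).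
Definition query_count : nat := dim_t.+1 * (2 ^ dim_k * n.+1).

End Params.

(** * Execution of the whole program *)

Section Assembly.
Variables (R : realType) (n : nat) (F : cube n -> int) (delta theta : R) (w : seq bool).
Notation runs := (runs F delta theta w).
Let Fb (y : cube n) : bool := F y == (-1)%R.

Lemma runs_flag_loop (Inv : nat -> memory -> Prop) (Fin : memory -> Prop) body N r M i q :
  (forall j M, Inv j M -> eval M (cexp (Sc vfl)) = 0) ->
  (forall M, Fin M -> eval M (cexp (Sc vfl)) = 1) -> Inv 0 M ->
  (forall j M, j < r -> Inv j M -> exists2 M', runs body M i q M' i q N & Inv j.+1 M') ->
  (forall M, Inv r M -> exists2 M', runs body M i q M' i q N & Fin M') ->
  exists2 M', runs (flag_loop body) M i q M' i q ((r + 1) * (N + 1) + 1) & Fin M'.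
Proof.
move=> I0 F1 IM IS IF.
have W u j M1 : j + u = r -> Inv j M1 ->
    exists2 M', runs (flag_loop body) M1 i q M' i q ((u + 1) * (N + 1) + 1) & Fin M'.
  elim: u j M1 => [|u IH] j M1 ju IM1.
    rewrite addn0 in ju; rewrite ju in IM1; have [M2 h2 f2] := IF _ IM1.
    exists M2 => //; have T2 : eval_test delta theta M2 (Le (cexp (Sc vfl)) (Const 0)) = false.
      by rewrite -[eval_test _ _ _ _]/(eval M2 (cexp (Sc vfl)) <= 0) (F1 _ f2).
    have T1 : eval_test delta theta M1 (Le (cexp (Sc vfl)) (Const 0)).
      by rewrite -[eval_test _ _ _ _]/(eval M1 (cexp (Sc vfl)) <= 0) (I0 _ _ IM1).
    by apply: runs_le (runs_whileS T1 h2 (runs_while0 _ _ _ _ _ T2)); lia.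
  have [M2 h2 f2] := IS j M1 (ltac:(lia)) IM1.
  have [M3 h3 f3] := IH j.+1 M2 (ltac:(lia)) f2.
  exists M3 => //; have T1 : eval_test delta theta M1 (Le (cexp (Sc vfl)) (Const 0)).
    by rewrite -[eval_test _ _ _ _]/(eval M1 (cexp (Sc vfl)) <= 0) (I0 _ _ IM1).
  by apply: runs_le (runs_whileS T1 h2 h3); rewrite !mulnDl; lia.
by have [M' h f] := W r 0 M (add0n _) IM; exists M'.
Qed.

Lemma runs_hcmd p par M s : par 0 = n -> wf p -> rep n par M s ->
  exists2 M', runs (ccmd 0 p) M (cn s) (qn s) M' (cn (den Fb w par p s)) (qn (den Fb w par p s)) (cost par p) &
    rep n par M' (den Fb w par p s).
Proof.
by move=> p0 wp r; have [M' h [h1 _]] := ccmd_correct F delta theta w p0 0 wp r; exists M'.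
Qed.

Lemma updp_twice par y u v : updp (updp par y u) y v =1 updp par y v.
Proof. by move=> y'; rewrite /updp; case: eqP. Qed.

Lemma runs_psearch par M s p i q : rep n par M s -> par pp = 0 -> ar s vfl 0 = 0 ->
  (8 <= p%:R * theta)%R -> (forall j, j < p -> ~~ (8 <= j%:R * theta)%R) ->
  exists2 M', runs psearch M i q M' i q ((p + 1) * 3 + 1) &
    rep n (updp par pp p) M' (setc vfl 0 1 s).
Proof.
move=> r pz fz hp hj.
pose Inv j M := rep n (updp par pp j) M s.
pose Fin M := rep n (updp par pp p) M (setc vfl 0 1 s).
have T j M1 : Inv j M1 -> eval_test delta theta M1 (LeTheta (Const 8) (cexp (Par pp))) =
    (8 <= j%:R * theta)%R by move=> r1; rewrite /eval_test (eval_cexp r1).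
apply: (@runs_flag_loop Inv Fin _ 2).
- by move=> j M1 r1; rewrite (eval_cexp r1).
- by move=> M1 r1; rewrite (eval_cexp r1).
- by apply: rep_ext r => y; rewrite /updp; case: eqP => // ->.
- move=> j M1 jp r1.
  have [M2 h2 r2] := runs_setpar F delta theta w pp i q r1 (isT : ewf (HAdd (Par pp) (Cst 1))).
  exists M2; first by apply: runs_if; rewrite (T _ _ r1) (negbTE (hj _ jp)).
  by apply: rep_ext r2 => y; rewrite updp_twice /= /updp eqxx addn1.
move=> M1 r1; exists (update M1 (adr n vfl 0) 1); last by apply: rep_set.
apply: runs_if; rewrite (T _ _ r1) hp.
have -> : update M1 (adr n vfl 0) 1 = update M1 (eval M1 (cellE vfl (Const 0))) (eval M1 (Const 1)).
  by have [M0 _ _] := r1; rewrite eval_cellE M0.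
exact: runs_store.
Qed.

Lemma runs_tsearch par M s tm : rep n par M s -> par pn = n -> par pt0 = 0 ->
  (n%:R <= 2 ^+ tm.+1 * delta)%R -> (forall j, j < tm -> ~~ (n%:R <= 2 ^+ j.+1 * delta)%R) ->
  exists2 M', runs tsearch M (cn s) (qn s) M' (cn s) (qn s) (1 + (3 + ((tm + 1) * 6 + 1))) &
    exists s', [/\ rep n (updp par pt0 tm) M' s', cn s' = cn s, qn s' = qn s &
       forall c, c \notin [:: vpow; vfl] -> ar s' c = ar s c].
Proof.
move=> r pz tz ht hj.
pose Inv j M := exists s', [/\ rep n (updp par pt0 j) M s', ar s' vpow 0 = 2 ^ j.+1 /\ ar s' vfl 0 = 0,
   cn s' = cn s, qn s' = qn s & forall c, c \notin [:: vpow; vfl] -> ar s' c = ar s c].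
pose Fin M := exists s', [/\ rep n (updp par pt0 tm) M s', ar s' vfl 0 = 1,
   cn s' = cn s, qn s' = qn s & forall c, c \notin [:: vpow; vfl] -> ar s' c = ar s c].
have r0 : rep n (updp par pt0 0) M s by apply: rep_ext r => y; rewrite /updp; case: eqP => // ->.
have p0 j : updp par pt0 j 0 = n by rewrite /updp.
have [M1 h1 r1] := @runs_hcmd (vfl <~ Cst 0 ;; vpow <~ Cst 2) _ _ _ (p0 0) isT r0.
have I1 : Inv 0 M1.
  exists (den Fb w (updp par pt0 0) (vfl <~ Cst 0 ;; vpow <~ Cst 2) s); split=> // c.
  by move=> h; rewrite den_frame //; move: h; rewrite !inE orbC.
have T j M2 s' : rep n (updp par pt0 j) M2 s' -> ar s' vpow 0 = 2 ^ j.+1 ->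
    eval_test delta theta M2 (LeDelta (cexp (Par pn)) (cexp (Sc vpow))) = (n%:R <= 2 ^+ j.+1 * delta)%R.
  by move=> r2 hp; rewrite /eval_test !(eval_cexp r2) //= hp p0 natrX.
have [] := @runs_flag_loop Inv Fin (If (LeDelta (cexp (Par pn)) (cexp (Sc vpow)))
    (ccmd 0 (vfl <~ Cst 1))
    (Seq (ccmd 0 (vpow <~ HAdd (Sc vpow) (Sc vpow))) (setpar pt0 (HAdd (Par pt0) (Cst 1))))) 5 tm M1 (cn s) (qn s).
- by move=> j M2 [s' [r2 [_ f2] _ _ _]]; rewrite (eval_cexp r2).
- by move=> M2 [s' [r2 f2 _ _ _]]; rewrite (eval_cexp r2).
- exact: I1.
- move=> j M2 jt [s' [r2 [hp hf] cs qs fs]].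
  have [M3 h3 r3] := @runs_hcmd (vpow <~ HAdd (Sc vpow) (Sc vpow)) _ _ _ (p0 j) isT r2.
  rewrite -[cn (den _ _ _ _ _)]/(cn s') -[qn (den _ _ _ _ _)]/(qn s') cs qs in h3.
  have [M4 h4 r4] := runs_setpar F delta theta w pt0 (cn s) (qn s) r3 (isT : ewf (HAdd (Par pt0) (Cst 1))).
  exists M4.
    apply: (runs_le (N := 1 + (1 + (1 + 1)))) => //; apply: runs_if.
    by rewrite (T _ _ _ r2 hp) (negbTE (hj _ jt)); exact: runs_seq h3 h4.
  exists (setc vpow 0 (2 ^ j.+2) s'); split=> //.
  + apply: rep_ext (_ : rep n _ M4 _); last first.
      by move: r4; rewrite /= hp addnn -mul2n -expnS; exact.
    by move=> y; rewrite updp_twice /= /updp eqxx addn1.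
  + by move=> c h; rewrite ar_setc ?fs //; move: h; rewrite !inE negb_or => /andP[].
- move=> M2 [s' [r2 [hp hf] cs qs fs]].
  have [M3 h3 r3] := @runs_hcmd (vfl <~ Cst 1) _ _ _ (p0 tm) isT r2.
  rewrite -[cn (den _ _ _ _ _)]/(cn s') -[qn (den _ _ _ _ _)]/(qn s') cs qs in h3; exists M3.
    apply: (runs_le (N := 1 + 1)) => //; apply: runs_if.
    by rewrite (T _ _ _ r2 hp) ht.
  exists (setc vfl 0 1 s'); split=> // c h.
  by rewrite ar_setc ?fs //; move: h; rewrite !inE negb_or => /andP[].
move=> M2 h2 [s' [r2 _ cs qs fs]]; exists M2; first exact: runs_seq h1 h2.
by exists s'.
Qed.

Lemma runs_setdims par M s i q : rep n par M s ->
  exists2 M', runs setdims M i q M' i q 17 &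
    rep n (fun y => match y with
      | 3 => ar s vk 0 | 4 => ar s vS 0 | 5 => 4 * par 0 + ar s vk 0 | 6 => 3 * ar s vh 0
      | 7 => ar s vmf 0 | 8 => ar s vtm 0 | 9 => par 0 + par 0 | 10 => (ar s vtm 0).+1
      | _ => par y end) M' s.
Proof.
move=> r; have S := runs_setpar F delta theta w.
have [M1 h1 r1] := S _ _ _ pk (Sc vk) i q r isT.
have [M2 h2 r2] := S _ _ _ pS (Sc vS) i q r1 isT.
have [M3 h3 r3] := S _ _ _ pm (HAdd (dblE 2 (Par pn)) (Sc vk)) i q r2 isT.
have [M4 h4 r4] := S _ _ _ pq (HAdd (Sc vh) (dblE 1 (Sc vh))) i q r3 isT.
have [M5 h5 r5] := S _ _ _ pmf (Sc vmf) i q r4 isT.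
have [M6 h6 r6] := S _ _ _ ptm (Sc vtm) i q r5 isT.
have [M7 h7 r7] := S _ _ _ pd (dblE 1 (Par pn)) i q r6 isT.
have [M8 h8 r8] := S _ _ _ pt1 (HAdd (Sc vtm) (Cst 1)) i q r7 isT.
exists M8.
  have h9 : runs Skip M8 i q M8 i q 1 by exists 1.
  apply: runs_le (runs_seq h1 (runs_seq h2 (runs_seq h3 (runs_seq h4 (runs_seq h5
    (runs_seq h6 (runs_seq h7 (runs_seq h8 h9)))))))) => //.
apply: rep_ext r8 => y; do 11 (case: y => [|y]; [rewrite /updp /=; lia|]).
by rewrite /updp /=.
Qed.

Section Program.
Variables (p tm E e a : nat).
Hypotheses (n0 : 0 < n) (hD : dims n p E e a).
Hypotheses (hp : (8 <= p%:R * theta)%R) (hpm : forall j, j < p -> ~~ (8 <= j%:R * theta)%R).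
Hypotheses (ht : (n%:R <= 2 ^+ tm.+1 * delta)%R)
  (htm : forall j, j < tm -> ~~ (n%:R <= 2 ^+ j.+1 * delta)%R).
Notation K := (dim_k n E).
Notation m := (dim_m n E).
Notation q := (dim_q a).
Notation mf := (dim_f n E).
Notation tt := (dim_t n tm E).
Notation par := (par_main n p tm E a).

Lemma seed0_spec s : (forall i, ar s cV i = 0) -> cn s = 0 ->
  forall i, ar (den Fb w par (HFor li pmf (HFlip cV (Sc li)))
               (den Fb w par (cV [ HSub (Par pd) (Cst 1) ] <~ Cst 1) s)) cV i = bit (seed0 n E w) i.
Proof.
move=> s0 c0; set t0 := den _ _ _ _ s.
have t0V i : ar t0 cV i = (i == (n + n).-1) by rewrite /t0 /= s0 subn1; case: eqP.
have t0c : cn t0 = 0 by [].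
clearbody t0; set t1 := den _ _ _ _ t0.
have H : forall i, ar t1 cV i = if i < mf then nth false w i else i == (n + n).-1.
  have : forall i, ar t1 cV i = if i < par pmf then nth false w i else i == (n + n).-1; last by [].
  apply: (den_for (I := fun N t => forall i, ar t cV i = if i < N then nth false w i else i == (n + n).-1)) => //.
  move=> N t _ _ Hc IH i; rewrite /= Hc t0c /= muln1 add0n ltnS leq_eqVlt.
  by case: (eqVneq i N) => [->|_] //=; rewrite IH.
move=> i; rewrite H; case: (ltnP i m) => im; first by rewrite (bit_ord _ im) ffunE /=; case: ifP.
rewrite bit_out // ifF; last by move: im; rewrite /dim_f; case: exact => //; lia.
by move: im; rewrite /dim_m; case: eqP => //; lia.
Qed.

Lemma program_runs : exists M',
  [/\ runs program (update (fun=> 0) 0 n) 0 0 M' (coin_count n tm E a) (query_count n tm E) (time_bound n p tm E a),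
      M' 0 = size (level p tt Fb (seeds n E a w) n) &
      forall k (i : 'I_n), k < size (level p tt Fb (seeds n E a w) n) ->
        M' (1 + k * n + i) = (i \in nth set0 (level p tt Fb (seeds n E a w) n) k)].
Proof.
pose s0 := Hst (fun _ _ => 0) 0 0; pose M0 : memory := update (fun=> 0) 0 n.
have r0 : rep n (fun=> 0) M0 s0.
  by split=> // *; rewrite /M0 /update /adr; case: eqP => //; lia.
have r1 := rep_setpar pn n r0; set M1 := update M0 _ _ in r1.
have h1 : runs (Store (cellE 62 (Const pn)) (Fetch (Const 0))) M0 0 0 M1 0 0 1.
  have -> : M1 = update M0 (eval M0 (cellE 62 (Const pn))) (eval M0 (Fetch (Const 0))).
    by rewrite eval_cellE.
  exact: runs_store.
have [M2 h2 r2] := runs_psearch 0 0 r1 erefl erefl hp hpm.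
have [M3 h3 [s3 [r3 c3 q3 f3]]] := runs_tsearch r2 erefl erefl ht htm.
have {f3} f3 c : c \notin [:: vpow; vfl] -> forall i, ar s3 c i = 0.
  by move=> h i; rewrite f3 //= ifF //; move: h; rewrite !inE negb_or => /andP[_ /negbTE].
have {r3} r3 : rep n (par_prep n p tm) M3 s3.
  by apply: rep_ext r3 => y; do 3 (case: y => [|y] //).
have p0 : 0 < p by move: hp; case: (posnP p) => // ->; lra.
have [M4 h4 r4] := @runs_hcmd prep_prog (par_prep n p tm) _ _ erefl isT r3.
have [E' [e' [a' [hD']]]] := @prep_spec n Fb w (par_prep n p tm) s3 p tm n0 p0 erefl erefl erefl.
(* The dimensions computed in this run are those that enter the bounds fixed beforehand. *)
have [<- _ <-] := dims_unique hD hD'.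
have f4 c : c \notin [:: vpow, vfl & mods prep_prog] -> forall i, ar (den Fb w (par_prep n p tm) prep_prog s3) c i = 0.
  move=> h i; rewrite den_frame ?f3 //; move: h; rewrite !inE !negb_or.
    by move=> /and3P[-> ->].
  by move=> /and3P[_ _].
have [c4 q4] := @pure_den n Fb w (par_prep n p tm) prep_prog s3 isT.
rewrite c4 q4 c3 q3 in h4; rewrite c3 in c4; rewrite q3 in q4.
set t := den _ _ _ prep_prog s3 in h4 r4 f4 c4 q4 * => -[tvh tP5 tdim].
have [M5 h5 r5] := runs_setdims 0 0 r4.
have [tK tS tf tt'] : [/\ ar t vk 0 = K, ar t vS 0 = 2 ^ K, ar t vmf 0 = mf & ar t vtm 0 = tt].
  move: tdim; rewrite /dim_f /dim_t /dim_m /dim_k /exact; case: ifP => _ [-> -> -> ->]; split=> //.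
  by lia.
have {r5} r5 : rep n par M5 t.
  apply: rep_ext r5 => y; rewrite tK tS tf tt' tvh.
  by do 11 (case: y => [|y]; [rewrite /= ?/dim_m ?/dim_q ?expnS; lia|]).
have [M6 h6 r6] := @runs_hcmd main_prog par _ _ erefl isT r5.
have tV := seed0_spec (f4 cV isT) c4.
have q0 : 0 < q by rewrite expn_gt0.
have H1 := @table_spec n K q Fb w par erefl erefl erefl erefl erefl erefl q0 t (seed0 n E w) tt
   (f4 cSB isT) (f4 vg isT 0) erefl tV.
rewrite c4 add0n -[par pmf]/mf -/(seeds n E a w) in H1.
have F1 := @den_frame n Fb w par table_prog t.
set t1 := den _ _ par table_prog t in F1 H1.
have t15 : ar t1 vP5 0 = 5 * p ^ 2 by rewrite F1.
have t1Q i : ar t1 cQA i = 0 by rewrite F1 // f4.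
have t1I i : ar t1 cIdx i = 0 by rewrite F1 // f4.
have [_ _ H2 H3] := @search_spec n K p tt Fb w par erefl erefl erefl (seeds n E a w) t1 H1 t15 t1Q.
have F2 := @den_frame n Fb w par search_prog t1.
set t2 := den _ _ par search_prog t1 in F2 H2 H3.
have t2I i : ar t2 cIdx i = 0 by rewrite F2 // t1I.
set L := level _ _ _ _ n in H2 H3 *.
have sL : size L <= 2 ^ K by exact: size_level.
have [g1 g2 g3 g4 g5] := @final_spec n (2 ^ K) Fb w par erefl erefl t2 _ H2 sL t2I.
have t3E : den Fb w par main_prog t = den Fb w par final_prog t2 by [].
rewrite -t3E in g1 g2 g3 g4 g5.
set t3 := den Fb w par main_prog t in h6 r6 g1 g2 g3 g4 g5.
have c6 : cn t3 = coin_count n tm E a.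
  rewrite /t3 cn_den // c4 add0n /= !(muln0, addn0, add0n, muln1) /coin_count //.
have q6 : qn t3 = query_count n tm E.
  rewrite /t3 qn_den // q4 add0n /= !(muln0, addn0, add0n, muln1) /query_count.
  by rewrite mulSn add1n.
have NL : size L * n <= 2 ^ K * n by rewrite leq_mul2r sL orbT.
have [M7 h7 [z1 z2]] := runs_output F delta theta w (cn t3) (qn t3) r6 g1 g3 NL g5.
rewrite c6 q6 in h7; rewrite c4 q4 c6 q6 in h6.
exists M7; split; last first.
- move=> k i kL; have kN : k * n + i < size L * n.
    apply: (leq_trans (n := k.+1 * n)); first by rewrite mulSn addnC ltn_add2r.
    by rewrite leq_mul2r kL orbT.
  rewrite -addnA add1n z2 // g2 ?H3 //; exact: leq_trans kN NL.
- by rewrite z1 g4.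
rewrite /program.
apply: runs_le (runs_seq h1 (runs_seq h2 (runs_seq h3 (runs_seq h4 (runs_seq h5 (runs_seq h6 h7)))))).
rewrite /time_bound; have : 4 * (size L * n) <= 4 * (2 ^ K * n) by rewrite leq_mul2l.
by lia.
Qed.

End Program.

End Assembly.

(** * Resource bounds *)

Section Cost.

Fixpoint csize (p : hcmd) : nat :=
  match p with
  | HQuery _ _ _ => 9
  | HSeq p1 p2 | HIf _ _ p1 p2 => 1 + (csize p1 + csize p2)
  | HFor _ _ p => csize p + 8
  | _ => 1
  end.

Fixpoint cdepth (p : hcmd) : nat :=
  match p with
  | HQuery _ _ _ => 1
  | HSeq p1 p2 | HIf _ _ p1 p2 => maxn (cdepth p1) (cdepth p2)
  | HFor _ _ p => (cdepth p).+1
  | _ => 0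
  end.

(** A polynomial bound read off the syntax: its degree is the nesting depth of loops, a query
    counting as a loop because of the copied point. *)
Lemma cost_bound par X p : 0 < X -> (forall y, par y <= X) -> cost par p <= csize p * X ^ cdepth p.
Proof.
move=> X0 hX.
have S p1 p2 : cost par p1 <= csize p1 * X ^ cdepth p1 -> cost par p2 <= csize p2 * X ^ cdepth p2 ->
    1 + (cost par p1 + cost par p2) <= (1 + (csize p1 + csize p2)) * X ^ maxn (cdepth p1) (cdepth p2).
  move=> h1 h2; rewrite !mulnDl; apply: leq_add; first by rewrite mul1n expn_gt0 X0.
  apply: leq_add; [apply: leq_trans h1 _ | apply: leq_trans h2 _];
    by rewrite leq_mul2l leq_pexp2l ?leq_maxl ?leq_maxr ?orbT.
elim: p => [|c' e1 e2|c' e|c' e a|p1 IH1 p2 IH2|a b p1 IH1 p2 IH2|x y p IH] /=; rewrite ?expn0 //.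
- by rewrite expn1; have := hX 0; lia.
- exact: S.
- exact: S.
have P : 0 < X ^ cdepth p by rewrite expn_gt0 X0.
rewrite expnS mulnCA.
apply: (leq_trans (n := X * (csize p * X ^ cdepth p + 5) + 3)).
  by rewrite leq_add2r leq_mul // leq_add2r.
rewrite mulnDl [X in _ <= X]mulnDr mulnDr -addnA leq_add2l.
by nia.
Qed.

End Cost.

Local Close Scope nat_scope.

Section Numeric.
Variable R : realType.

Lemma ln2_ge : 2^-1 <= ln (2 : R).
Proof.
have : ln (1 + (- 2^-1)) <= - 2^-1 :> R by apply: le_ln1Dx; lra.
have -> : 1 + (- 2^-1) = 2^-1 :> R by lra.
by rewrite lnV ?posrE //; lra.
Qed.

(** Used to absorb the term ln^2 n of the walk into n. It follows from ln z < z for the square root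
    z of x. *)
Lemma ln_sqr_le (x : R) : 1 <= x -> ln x ^+ 2 <= 4 * x.
Proof.
move=> x1; have x0 : 0 < x by lra.
have [z z0 E] : exists2 z : R, 0 < z & x = z ^+ 2.
  by exists (Num.sqrt x); rewrite ?sqrtr_gt0 // sqr_sqrtr // ltW.
have := ln_ge0 x1; have h1 := ln_sublinear z0; rewrite E lnXn // mulr2n => l0.
have h : ln z ^+ 2 <= z ^+ 2 by apply: lerXn2r; rewrite ?nnegrE; lra.
have -> : (ln z + ln z) ^+ 2 = 4 * ln z ^+ 2 by ring.
by lra.
Qed.

Lemma pow2_ln (k : nat) (y : R) : 2 ^+ k <= y -> k%:R <= 2 * ln y.
Proof.
move=> h; have P := pow2_gt0 R k.
have : ln (2 ^+ k) <= ln y by rewrite ler_ln ?posrE //; lra.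
rewrite lnXn // -[ln 2 *+ k]mulr_natl => H; have L := ln2_ge.
have : k%:R * 2^-1 <= k%:R * ln 2 :> R by rewrite ler_wpM2l.
lra.
Qed.

Variables (n p tm E e a : nat) (delta theta : R).
Hypotheses (n0 : (0 < n)%N) (d0 : 0 < delta) (t0 : 0 < theta) (hD : dims n p E e a).
Hypotheses (hp : 8 <= p%:R * theta) (hp' : (p%:R - 1) * theta < 8).
Hypotheses (htm : forall j, (j < tm)%N -> ~~ (n%:R <= 2 ^+ j.+1 * delta)).
Hypothesis d1 : delta <= 1.

Let D := ln delta^-1.
Let lam : R := ln n%:R.

Lemma n_ge1 : 1 <= n%:R :> R.
Proof. by rewrite ler1n. Qed.

Lemma lam_ge0 : 0 <= lam.
Proof. exact: ln_ge0 n_ge1. Qed.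

Lemma D_ge0 : 0 <= D.
Proof. by apply: ln_ge0; rewrite invf_ge1. Qed.

(** Minimality of [tm], applied at tm - 1, says 2^tm < n / delta. *)
Lemma tm_bound : tm%:R <= 2 * (lam + D).
Proof.
case: (posnP tm) => [->|tp]; first by have := lam_ge0; have := D_ge0; lra.
have := @htm tm.-1; rewrite prednK // => /(_ (leqnn _)); rewrite -ltNge => H.
have -> : lam + D = ln (n%:R / delta).
  by rewrite /lam /D -lnM ?posrE ?invr_gt0 // ltr0n.
by apply: pow2_ln; rewrite ler_pdivlMr // ltW.
Qed.

(** The factor 2^24 is 2^6, from rounding p up to a power of 2, times the 2^18 by which the
    exhaustive sample may be larger. *)
Lemma pow6_bound : 2 ^+ dim_k n E <= 2 ^+ 24 * p%:R ^+ 6 :> R.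
Proof.
have [_ h _ _ _] := hD.
have K : (dim_k n E <= 6 * E + 18)%N by rewrite /dim_k /exact; case: ifP => //; lia.
apply: (le_trans (y := 2 ^+ (6 * E + 18))); first by rewrite ler_eXn2l // ltr1n.
rewrite exprD mulnC exprM.
have h' : 2 ^+ E <= 2 * p%:R :> R by rewrite -natrX -natrM ler_nat ltnW.
have h6 : (2 ^+ E) ^+ 6 <= (2 * p%:R) ^+ 6 :> R.
  by apply: lerXn2r; rewrite ?nnegrE ?exprn_ge0 ?mulr_ge0.
rewrite exprMn in h6; have -> : (2 ^+ 24 : R) = 2 ^+ 6 * 2 ^+ 18 by rewrite -exprD.
have P := pow2_gt0 R 18; nra.
Qed.

Lemma q_bound : (dim_q a <= 54 + 5 * e)%N.
Proof.
have [_ _ _ _ [_ h]] := hD; rewrite /dim_q expnS.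
case: h => [->|h]; first by rewrite expn1; lia.
by lia.
Qed.

Lemma e_bound : e%:R <= 2 * (4 + lam).
Proof.
have [_ _ _ h _] := hD.
have : e%:R <= 2 * ln (16 * n%:R : R).
  by apply: pow2_ln; rewrite -natrX -natrM ler_nat ltnW.
rewrite lnM ?posrE ?ltr0n // => H.
have : ln (16 : R) <= 4.
  have -> : (16 : R) = 2 ^+ 4 by rewrite -natrX.
  rewrite lnXn // -[_ *+ 4]mulr_natl; have : ln (2 : R) <= 1; last lra.
  have : ln (1 + 1) <= 1 :> R by apply: le_ln1Dx; lra.
  by have -> : 1 + 1 = 2 :> R by lra.
move: H; rewrite -/lam; lra.
Qed.

(** If coins are used, then k < 2n and a matrix takes at most 6n coins. The steps take 2 [tm] [q]
    coins, of order (ln n + ln(1/delta)) ln n, and ln^2 n <= 4n. *)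
Lemma coin_bound : (coin_count n tm E a)%:R <= 5000 * (n%:R + lam * D).
Proof.
have l0 := lam_ge0; have D0 := D_ge0; have n1 := n_ge1.
rewrite /coin_count /dim_f /dim_t; case X : (exact n E); first by rewrite mul0n /=; nra.
have K : (dim_m n E <= 6 * n)%N by rewrite /dim_m /dim_k X; move: X; rewrite /exact; lia.
(* The margin 18 in [exact] excludes small n here, so ln n >= 1/2 and the additive constants in the
   bound for [q] become multiples of ln n. *)
have n10 : (10 <= n)%N by move: X; rewrite /exact; lia.
have lam1 : 2^-1 <= lam.
  apply: le_trans ln2_ge _; rewrite /lam ler_ln ?posrE ?ltr0n // ler_nat; lia.
have Q : (dim_q a)%:R <= 268 * lam.
  apply: (le_trans (y := (54 + 5 * e)%:R)); first by rewrite ler_nat q_bound.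
  rewrite natrD natrM; have := e_bound; lra.
have M : (dim_m n E)%:R <= 6 * n%:R :> R by rewrite -natrM ler_nat.
have L2 := ln_sqr_le n1; rewrite -/lam in L2.
have T := tm_bound.
rewrite natrD natrM natrD.
have TQ : tm%:R * ((dim_q a)%:R + (dim_q a)%:R) <= 2 * (lam + D) * (536 * lam).
  by apply: ler_pM => //; [rewrite addr_ge0 | lra].
have lD : 0 <= lam * D by rewrite mulr_ge0.
have TE : 2 * (lam + D) * (536 * lam) = 1072 * lam ^+ 2 + 1072 * (lam * D) by ring.
rewrite TE in TQ.
lra.
Qed.

Lemma p_bound : p%:R <= 8 / theta + 1.
Proof. by rewrite -lerBlDr ler_pdivlMr // ltW. Qed.

(** With u = 1/theta, l = ln u and A = ln n + ln(1/delta), the count is of order n u^6 (A + 1), and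
    2A + 1 has to be bounded by a multiple of u^5 (A + l) / l. Here l <= u <= u^5 takes care of A,
    and u^5 l / l >= 1 of the 1, even when l is close to 0. *)
Lemma query_bound : theta < 1 ->
  (query_count n tm E)%:R <= (2 ^+ 27 * 9 ^+ 6) * (n%:R / (theta ^+ 11 * ln theta^-1)
                        * ln (n%:R / (delta * theta))).
Proof.
move=> t1; have l0 := lam_ge0; have D0 := D_ge0; have n1 := n_ge1.
pose u := theta^-1; have u1 : 1 < u by rewrite invf_gt1.
pose l := ln u; have lp : 0 < l by exact: ln_gt0.
have lu : l <= u by apply/ltW/ln_sublinear; lra.
have -> : ln (n%:R / (delta * theta)) = lam + D + l.
  have np : 0 < n%:R :> R by lra.
  by rewrite invfM !lnM ?posrE ?invr_gt0 ?mulr_gt0 ?invr_gt0 // /lam /D /l addrA.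
have -> : n%:R / (theta ^+ 11 * ln theta^-1) = n%:R * u ^+ 11 / l.
  by rewrite invfM -exprVn mulrA.
have pu : p%:R <= 9 * u by have := p_bound; rewrite -/u; lra.
have p6 : p%:R ^+ 6 <= (9 * u) ^+ 6.
  by apply: lerXn2r; rewrite ?nnegrE //; lra.
have T : (dim_t n tm E)%:R <= 2 * (lam + D).
  rewrite /dim_t; case: ifP => _; last exact: tm_bound.
  by lra.
have u6 : 0 < u ^+ 6 by rewrite exprn_gt0 //; lra.
have u5 : u <= u ^+ 5 by rewrite exprS ler_peMr ?exprn_ege1 //; lra.
rewrite /query_count natrM natrM natrX.
have HS : 2 ^+ dim_k n E <= 2 ^+ 24 * 9 ^+ 6 * u ^+ 6 :> R.
  apply: le_trans pow6_bound _; rewrite -mulrA -exprMn ler_pM2l ?pow2_gt0 //.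
have N1 : n.+1%:R <= 2 * n%:R :> R by rewrite -natr1; lra.
have T1 : (dim_t n tm E).+1%:R <= 2 * (lam + D) + 1 by rewrite -natr1; lra.
set A := lam + D in T T1 *; have A0 : 0 <= A by rewrite addr_ge0.
set c := 2 ^+ 24 * 9 ^+ 6 in HS *; have c0 : 0 < c by rewrite mulr_gt0 // exprn_gt0.
have K0 := pow2_gt0 R (dim_k n E).
apply: (le_trans (y := (2 * A + 1) * (c * u ^+ 6 * (2 * n%:R)))).
  apply: ler_pM => //; first by rewrite mulr_ge0 // ltW.
  by apply: ler_pM => //; exact: ltW.
have -> : 2 ^+ 27 * 9 ^+ 6 = 8 * c :> R.
  have E8 : (8 : R) = 2 ^+ 3 by rewrite -natrX.
  by rewrite /c E8 mulrA -exprD.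
have -> : 8 * c * (n%:R * u ^+ 11 / l * (A + l)) = (c * u ^+ 6 * n%:R) * (8 * (u ^+ 5 * (A + l) / l)).
  have -> : u ^+ 11 = u ^+ 6 * u ^+ 5 by rewrite -exprD.
  by ring.
have -> : (2 * A + 1) * (c * u ^+ 6 * (2 * n%:R)) = (c * u ^+ 6 * n%:R) * (2 * (2 * A + 1)) by ring.
rewrite ler_pM2l; last by rewrite !mulr_gt0 //; lra.
have H1 : A * l <= A * u ^+ 5 by rewrite ler_wpM2l //; lra.
have H2 : 1 * l <= u ^+ 5 * l by rewrite ler_pM2r //; lra.
have H3 : 0 <= A * u ^+ 5 by rewrite mulr_ge0 // exprn_ge0 //; lra.
have H : (2 * A + 1) * l <= 4 * (u ^+ 5 * (A + l)) by lra.
have : 2 * A + 1 <= 4 * (u ^+ 5 * (A + l)) / l by rewrite ler_pdivlMr.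
by rewrite -mulrA; lra.
Qed.

End Numeric.

Definition par_max (n p tm E a : nat) : nat :=
  (n + p + tm + 2 ^ dim_k n E + dim_m n E + dim_q a + 1)%N.

Definition tcoef : nat := (100 + csize prep_prog + csize main_prog)%N.
Definition tdeg : nat := (cdepth prep_prog + cdepth main_prog + 2)%N.

Lemma time_bound_le n p tm E a : (0 < n)%N ->
  (time_bound n p tm E a <= tcoef * par_max n p tm E a ^ tdeg)%N.
Proof.
move=> n0; set X := par_max _ _ _ _ _; have X0 : (0 < X)%N by rewrite /X /par_max addn1.
have KK : (dim_k n E < 2 ^ dim_k n E)%N by exact: ltn_expl.
have h1 y : (par_prep n p tm y <= X)%N.
  by rewrite /X /par_max; do 3 (case: y => [|y]; [rewrite /=; lia|]).
have fm : (dim_f n E <= dim_m n E)%N by rewrite /dim_f; case: ifP.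
have tt : (dim_t n tm E <= tm)%N by rewrite /dim_t; case: ifP.
have h2 y : (par_main n p tm E a y <= X)%N.
  rewrite /X /par_max; do 11 (case: y => [|y]; [rewrite /=; first [lia | rewrite /dim_m; lia]|]).
  by [].
have B1 := cost_bound prep_prog X0 h1; have B2 := cost_bound main_prog X0 h2.
have P1 : (X ^ cdepth prep_prog <= X ^ tdeg)%N by rewrite leq_pexp2l // /tdeg -addnA leq_addr.
have P2 : (X ^ cdepth main_prog <= X ^ tdeg)%N by rewrite leq_pexp2l // /tdeg; lia.
  have P3 : (X * X <= X ^ tdeg)%N by rewrite mulnn leq_pexp2l // /tdeg; lia.
rewrite /time_bound /tcoef; move: B1 B2 P1 P2 P3.
set c1 := csize prep_prog; set c2 := csize main_prog.
set Y := (X ^ tdeg)%N; move: (X ^ cdepth prep_prog)%N (X ^ cdepth main_prog)%N => Y1 Y2.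
move: (cost _ prep_prog) (cost _ main_prog) => k1 k2 B1 B2 P1 P2 P3.
have B1' : (k1 <= c1 * Y)%N by apply: leq_trans B1 _; rewrite leq_mul2l P1 orbT.
have B2' : (k2 <= c2 * Y)%N by apply: leq_trans B2 _; rewrite leq_mul2l P2 orbT.
have X3 : (2 ^ dim_k n E * n <= X * X)%N.
  by apply: leq_mul; rewrite /X /par_max; move: (2 ^ dim_k n E)%N => K; lia.
have XX : (X <= X * X)%N by rewrite leq_pmulr.
have p1 : (p <= X)%N by rewrite /X /par_max; move: (2 ^ dim_k n E)%N => K; lia.
have p2 : (tm <= X)%N by rewrite /X /par_max; move: (2 ^ dim_k n E)%N => K; lia.
rewrite [leqRHS]mulnDl [((_ + c1) * _)%N]mulnDl; move: X3 XX p1 p2 P3 X0 B1' B2'.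
generalize (2 ^ dim_k n E * n)%N (X * X)%N (c1 * Y)%N (c2 * Y)%N.
clear; move: X Y => X Y; lia.
Qed.

Section TimeBound.
Variable R : realType.
Variables (n p tm E e a : nat) (delta theta : R).
Hypotheses (n0 : (0 < n)%N) (d0 : 0 < delta) (t0 : 0 < theta) (hD : dims n p E e a).
Hypotheses (hp : 8 <= p%:R * theta) (hp' : (p%:R - 1) * theta < 8).
Hypotheses (htm : forall j, (j < tm)%N -> ~~ (n%:R <= 2 ^+ j.+1 * delta)).
Hypothesis d1 : delta <= 1.

Lemma par_max_bound : let Y := n%:R + theta^-1 + ln delta^-1 in
  1 <= Y /\ (par_max n p tm E a)%:R <= (200 + 2 ^+ 25 * 9 ^+ 6) * Y ^+ 6.
Proof.
move=> Y; have n1 := n_ge1 R n0; have D0 := D_ge0 d0 d1.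
have ti : 0 < theta^-1 by rewrite invr_gt0.
have Y1 : 1 <= Y by rewrite /Y; lra.
split=> //.
have Y6 : Y <= Y ^+ 6 by rewrite exprS ler_peMr ?exprn_ege1 //; lra.
have pY : p%:R <= 9 * Y by have := p_bound t0 hp'; rewrite /Y; lra.
have lY : ln n%:R <= n%:R :> R by apply/ltW/ln_sublinear; lra.
have tY : tm%:R <= 2 * Y by have := tm_bound n0 d0 htm d1; rewrite /Y; lra.
have KY : 2 ^+ dim_k n E <= 2 ^+ 24 * 9 ^+ 6 * Y ^+ 6.
  apply: le_trans (pow6_bound n0 d0 t0 hD hp hp' d1) _; rewrite -mulrA -exprMn ler_pM2l ?pow2_gt0 //.
  by apply: lerXn2r; rewrite ?nnegrE //; lra.
have qY : (dim_q a)%:R <= 94 + 10 * Y.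
  apply: (le_trans (y := (54 + 5 * e)%:R)); first by rewrite ler_nat (q_bound n0 d0 t0 hD hp hp' d1).
  rewrite natrD natrM; have := e_bound R n0 hD; have : n%:R <= Y by rewrite /Y; lra.
  lra.
have mY : (dim_m n E)%:R <= 4 * Y + 2 ^+ dim_k n E.
  apply: (le_trans (y := (4 * n + 2 ^ dim_k n E)%:R)).
    rewrite ler_nat /dim_m; have := ltn_expl (dim_k n E) (isT : (1 < 2)%N).
    generalize (dim_k n E) (2 ^ dim_k n E)%N; clear; lia.
  rewrite natrD natrM natrX lerD2r; have : n%:R <= Y by rewrite /Y; lra.
  lra.
have nY : n%:R <= Y by rewrite /Y; lra.
have E25 : 2 ^+ 25 * 9 ^+ 6 = 2 * (2 ^+ 24 * 9 ^+ 6) :> R by rewrite exprS mulrA.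
rewrite /par_max; move: mY; generalize (dim_m n E) => m mY.
rewrite !natrD natrX E25; move: KY; set c := 2 ^+ 24 * 9 ^+ 6 => KY.
lra.
Qed.

Lemma time_bound_real (c : nat) :
  tcoef%:R * (200 + 2 ^+ 25 * 9 ^+ 6) ^+ tdeg <= c%:R :> R -> (6 * tdeg <= c)%N ->
  (time_bound n p tm E a)%:R <= c%:R * (n%:R + theta^-1 + ln delta^-1) ^+ c.
Proof.
move=> h1 h2; have [Y1 H] := par_max_bound; move: Y1 H; set Y := _ + ln _ => Y1 H.
apply: (le_trans (y := (tcoef * par_max n p tm E a ^ tdeg)%:R)).
  by rewrite ler_nat time_bound_le.
rewrite natrM natrX; move: h1 h2; generalize tdeg tcoef => td tc h1 h2.
set C := 200 + _ in h1 H.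
have C0 : 0 <= C by rewrite addr_ge0 // mulr_ge0 // exprn_ge0.
have Y0 : 0 <= Y by lra.
apply: (le_trans (y := tc%:R * (C * Y ^+ 6) ^+ td)).
  by rewrite ler_wpM2l // lerXn2r ?nnegrE // mulr_ge0 // exprn_ge0.
rewrite exprMn -exprM mulrA; apply: ler_pM => //.
- by rewrite mulr_ge0 // exprn_ge0.
- by rewrite exprn_ge0.
- by rewrite ler_weXn2l.
Qed.

End TimeBound.

Section Existence.
Variable R : realType.

Lemma ex_p (theta : R) : 0 < theta -> exists p : nat,
  8 <= p%:R * theta /\ forall j, (j < p)%N -> ~~ (8 <= j%:R * theta).
Proof.
move=> t0; have ex : exists p : nat, 8 <= p%:R * theta.
  exists (Num.bound (8 / theta)); rewrite -ler_pdivrMr //; apply/ltW/archi_boundP.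
  by rewrite divr_ge0 // ltW.
case: (ex_minnP ex) => p hp pmin; exists p; split=> // j jp; apply/negP => /pmin.
by rewrite leqNgt jp.
Qed.

Lemma ex_tm (n : nat) (delta : R) : 0 < delta -> exists tm : nat,
  n%:R <= 2 ^+ tm.+1 * delta /\ forall j, (j < tm)%N -> ~~ (n%:R <= 2 ^+ j.+1 * delta).
Proof.
move=> d0; have ex : exists tm : nat, n%:R <= 2 ^+ tm.+1 * delta.
  exists (Num.bound (n%:R / delta)); rewrite -ler_pdivrMr //.
  apply: le_trans (ltW (archi_boundP _)) _; first by rewrite divr_ge0 // ltW.
  by rewrite -natrX ler_nat; apply/ltnW/(leq_trans (ltn_expl _ (isT : (1 < 2)%N))); rewrite leq_exp2l.
case: (ex_minnP ex) => tm h tmin; exists tm; split=> // j jt; apply/negP => /tmin.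
by rewrite leqNgt jt.
Qed.

(** The dimensions are obtained from a run of [prep_prog] with an arbitrary oracle and no coins, as
    they depend on neither. *)
Lemma ex_dims n p : (0 < n)%N -> (0 < p)%N -> exists E e a, dims n p E e a.
Proof.
move=> n0 p0; have [E [e [a [h _]]]] := @prep_spec n (fun=> false) [::] (par_prep n p 0)
  (Hst (fun _ _ => 0%N) 0 0) p 0 n0 p0 erefl erefl erefl.
by exists E, e, a.
Qed.

End Existence.

(** * Correctness of the output with the required probability *)

Section Correctness.
Variables (R : realType) (n p tm E e a : nat) (delta theta : R) (F : cube n -> int).
Hypothesis F_sign : forall y, F y = 1 \/ F y = -1.
Hypotheses (n0 : (0 < n)%N) (t0 : 0 < theta) (hD : dims n p E e a).
Hypotheses (hp : 8 <= p%:R * theta) (hpm : forall j, (j < p)%N -> ~~ (8 <= j%:R * theta)).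
Hypotheses (ht : n%:R <= 2 ^+ tm.+1 * delta).
Hypotheses (htm : forall j, (j < tm)%N -> ~~ (n%:R <= 2 ^+ j.+1 * delta)).
Let Fb (y : cube n) : bool := F y == -1.

Lemma halted_program_run (w : seq bool) :
  let s := run program F delta theta w (time_bound n p tm E a) in
  [/\ halted s, coins s = coin_count n tm E a, queries s = query_count n tm E
    & output n s = level p (dim_t n tm E) Fb (seeds n E a w) n].
Proof.
have [M' [[T hT H] M0 Mk]] := program_runs F w n0 hD hp hpm ht htm.
set N := time_bound n p tm E a in hT *; rewrite /run.
have -> : iter N (step F delta theta w) (init program n) =
    Config [::] M' (coin_count n tm E a) (query_count n tm E).
  by rewrite -(subnK hT) iterD H; elim: (N - T)%N => //= m ->.
split=> //; rewrite /output /= M0; set L := level _ _ _ _ _ in M0 Mk *.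
apply: (@eq_from_nth _ set0); rewrite size_map size_iota // => k kL.
rewrite (nth_map 0%N) ?size_iota // nth_iota // add0n.
by apply/setP => i; rewrite inE Mk // eqb0 negbK.
Qed.

Lemma p_minimal : (p%:R - 1) * theta < 8.
Proof.
case: (posnP p) => [p0|pp]; first by move: hp; rewrite p0; lra.
have /hpm : (p.-1 < p)%N by rewrite ltn_predL.
by rewrite -ltNge -[in p%:R](prednK pp) -(natr1 p.-1) addrK.
Qed.

Lemma seeds_exact w u : exact n E -> bad p Fb theta u (seeds n E a w 0) = false.
Proof.
move=> ex; have h : ((n + n).-1 < dim_m n E)%N by rewrite /dim_m; lia.
have -> : seeds n E a w 0 = unitv (Ordinal h).
  by apply/ffunP => i; rewrite /seeds /= !ffunE /dim_f ex.
by apply: exact_not_bad; rewrite // /dim_k ex mul2n addnn.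
Qed.

Lemma program_correct : 1 - delta <= coin_prob R (coin_count n tm E a) (fun w =>
  correct_list F theta (output n (run program F delta theta w (time_bound n p tm E a)))).
Proof.
rewrite coin_probE.
have lvl w := level_correct_list F_sign n0 t0 hp p_minimal (vs := seeds n E a w).
have [h1 h2 h3 h4 [h5 _]] := hD.
have d0 : 0 < delta.
  have : 0 < n%:R :> R by rewrite ltr0n.
  by move=> /lt_le_trans /(_ ht); rewrite pmulr_rgt0 // exprn_gt0.
(* With the exhaustive sample the output is correct for every outcome of the coins, so the
   probability is 1. *)
case X : (exact n E).
  apply: (le_trans (y := 1)); first by lra.
  rewrite -[leLHS](ebits_cst (coin_count n tm E a)); apply: ebits_le => w _.
  have [_ _ _ ->] := halted_program_run w.
  rewrite lvl //; first by right; rewrite /dim_k X mul2n addnn.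
  by move=> j _; rewrite /dim_t X big_ord1 seeds_exact.
have pk : (p ^ 6 <= 2 ^ dim_k n E)%N.
  by rewrite /dim_k X mulnC expnM leq_exp2r.
(* As k < 2n, the dimension is at most 6n <= 2^e; the 5 in e + 5 provides the factor 32, which makes
   the bias at most 1 / 32. *)
have mh : (32 * dim_m n E <= 2 ^ (2 * 3 ^ a))%N.
  apply: (leq_trans (n := 2 ^ (e + 5))); last by rewrite leq_exp2l.
  have : (dim_m n E <= 6 * n)%N by rewrite /dim_m /dim_k X; move: X; rewrite /exact; lia.
  rewrite expnD; move: h3; generalize (2 ^ e)%N (dim_m n E) => z m; lia.
apply: le_trans (good_prob F t0 hp pk mh ht) _.
have -> : coin_count n tm E a = (dim_m n E + tm * (3 ^ a.+1 + 3 ^ a.+1))%N.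
  by rewrite /coin_count /dim_f /dim_t X.
apply: ebits_le => w _; rewrite ler_nat.
have [_ _ _ ->] := halted_program_run w.
case: forallP => //= good; rewrite lvl //; first by left.
move=> j jn; rewrite /dim_t X; apply: leq_trans (good (Ordinal jn)); rewrite leq_mul2l /=.
apply: leq_sum => u _; rewrite /seeds /dim_f X; set v1 := seed0 _ _ _.
have -> // : v1 = cube_of 0 (dim_m n E) w.
by apply/ffunP => i; rewrite !ffunE add0n /dim_f X ltn_ord.
Qed.

End Correctness.

(* A is a single program and C, c are absolute constants.  T and r bound the
   running time and the number of random bits for all oracles F and all
   outcomes of the coins.  The resource bounds are required for exactly those
   parameters for which the corresponding formulas are meaningful: delta <= 1,
   and theta < 1 when log(1/theta) occurs as a divisor.  As
   n + 1/theta + log(1/delta) >= 1, the bound on T is a general polynomial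
   bound in the three quantities. *)
Theorem theorem6p7 (R : realType) :
  exists (A : command) (C : R) (c : nat),
  forall (n : nat) (delta theta : R),
    (0 < n)%N -> 0 < delta -> 0 < theta ->
  exists T r : nat,
    [/\ forall F : cube n -> int, (forall y, F y = 1 \/ F y = -1) ->
          (forall w : r.-tuple bool,
             let s := run A F delta theta w T in
             [/\ halted s,
                 (coins s <= r)%N &
                 delta <= 1 -> theta < 1 ->
                 (queries s)%:R <=
                   C * (n%:R / (theta ^+ 11 * ln theta^-1)
                        * ln (n%:R / (delta * theta)))]) /\
          1 - delta <=
            coin_prob R r (fun w =>
              correct_list F theta (output n (run A F delta theta w T))),
        delta <= 1 -> r%:R <= C * (n%:R + ln n%:R * ln delta^-1) &
        delta <= 1 ->
          T%:R <= c%:R * (n%:R + theta^-1 + ln delta^-1) ^+ c].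
Proof.
pose X : R := tcoef%:R * (200 + 2 ^+ 25 * 9 ^+ 6) ^+ tdeg.
(* The two summands of C come from the query bound and the coin bound. As c is both factor and
   exponent in the time bound, it is chosen above the constant [X] as well as the degree 6
   [tdeg]. *)
exists program, (2 ^+ 27 * 9 ^+ 6 + 5000), (Num.bound X + 6 * tdeg)%N.
move=> n delta theta n0 d0 t0.
have [p [hp hpm]] := ex_p t0; have [tm [ht htm]] := ex_tm n d0.
have p0 : (0 < p)%N by case: (posnP p) hp => // ->; rewrite mul0r lern0.
have [E [e [a hD]]] := ex_dims n0 p0.
have hp' := p_minimal hp hpm.
exists (time_bound n p tm E a), (coin_count n tm E a).
have A0 : 0 <= 2 ^+ 27 * 9 ^+ 6 :> R by rewrite mulr_ge0 // exprn_ge0.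
split=> [F Fs|d1|d1].
- split=> [w s|]; last exact: (program_correct Fs n0 t0 hD hp hpm ht htm).
  have [h1 h2 h3 _] := halted_program_run F n0 hD hp hpm ht htm w.
  rewrite /s h2 h3; split=> // d1 t1.
  have := query_bound n0 d0 t0 hD hp hp' htm d1 t1.
  set Y := _ / _ * _ => h; apply: le_trans h _; rewrite ler_wpM2r ?lerDl //.
  have u1 : 1 < theta^-1 by rewrite invf_gt1.
  apply: mulr_ge0; first by rewrite divr_ge0 // mulr_ge0 ?exprn_ge0 ?ln_ge0 //; lra.
  rewrite ln_ge0 // ler_pdivlMr ?mulr_gt0 // mul1r.
  apply: (le_trans (y := 1)); last exact: n_ge1.
  by rewrite mulr_ile1 //; lra.
- have := coin_bound n0 d0 t0 hD hp hp' htm d1.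
  move=> h; apply: le_trans h _; rewrite ler_wpM2r ?lerDr //.
  by rewrite addr_ge0 // mulr_ge0 ?(lam_ge0 R n0) ?(D_ge0 d0 d1).
- apply: (time_bound_real n0 d0 t0 hD hp hp' htm d1); last by rewrite leq_addl.
  rewrite natrD -[leLHS]addr0 lerD //; apply/ltW/archi_boundP.
  by rewrite mulr_ge0 // exprn_ge0 // addr_ge0 // mulr_ge0 // exprn_ge0.
Qed.
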